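(* Let $d\ge1$, $\sigma\in\mathbb{N}^*$ and $\lambda\in\{\pm1\}$. Fix $s<0$. Consider $$ i\partial_tu+\frac12\Delta u=\lambda|u|^{2\sigma}u,\qquad x\in\mathbb{T}^d. \qquad (\ast)$$ 1. For all $\rho>0$, one can find a solution $u$ to $(\ast)$ with $\|u(0)\|_{H^s(\mathbb{T}^d)}<\rho$ such that for all $\delta>0$ there exists a solution $\widetilde u$ to $(\ast)$ with $$\|u(0)-\widetilde u(0)\|_{H^s(\mathbb{T}^d)}<\delta$$ and $$\sup_{0\le t\le\delta}\Big|\int_{\mathbb{T}^d}\big(u(t,x)-\widetilde u(t,x)\big)\,dx\Big|\ge c\rho,$$ for some constant $c>0$ independent of $\rho$ and $\delta$. In particular, the solution map fails to be continuous as a map from $H^s(\mathbb{T}^d)$ to $H^k(\mathbb{T}^d)$, no matter how close to $-\infty$ the exponent $k$ may be. 2. Suppose $\sigma\ge2$. For any $\rho>0$ and $\delta>0$ there exist smooth solutions $u,\widetilde u$ of $(\ast)$ such that $u(0)-\widetilde u(0)$ is equal to a constant of magnitude at most $\delta$, and $$\|u(0)\|_{H^s(\mathbb{T}^d)}+\|\widetilde u(0)\|_{H^s(\mathbb{T}^d)}\le\rho,\qquad \sup_{0\le t\le\delta}\Big|\int_{\mathbb{T}^d}\big(u(t,x)-\widetilde u(t,x)\big)\,dx\Big|\ge c\rho,$$ for some constant $c>0$ independent of $\rho$ and $\delta$. 3. For any $t\ne0$, the flow-map associated with $(\ast)$ is discontinuous as a map from $L^2(\mathbb{T}^d)$, equipped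 with its weak topology, into the space of distributions $(C^\infty(\mathbb{T}^d))^*$ at any constant $\alpha_0\in\mathbb{C}\setminus\{0\}\subset L^2(\mathbb{T}^d)$.
   Context: $\mathbb{T}=\mathbb{R}/2\pi\mathbb{Z}$, $\mathbb{N}^*=\{1,2,\dots\}$. $H^s(\mathbb{T}^d)$ is the usual (possibly negative order) Sobolev space. The solution map (flow-map) of $(\ast)$ sends the initial datum $u(0)$ to the corresponding solution; in item 3 it is the map $u(0)\mapsto u(t)$ at the fixed time $t$. *)

(* Defs.v *)
From HB Require Import structures.
From mathcomp Require Import all_boot all_order all_algebra.
From mathcomp Require Import all_classical all_reals all_analysis.
From mathcomp Require Import complex.

Set Implicit Arguments.
Unset Strict Implicit.
Unset Printing Implicit Defensive.
Import Order.TTheory GRing.Theory Num.Theory.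
Import numFieldNormedType.Exports.

Local Open Scope classical_set_scope.
Local Open Scope ring_scope.
Local Open Scope complex_scope.

Notation normc := ComplexField.Normc.normc.

(** * Smooth complex-valued functions *)

Section Smooth.
Variables (R : realType) (V : normedModType R).

Definition cderive (v : V) (f : V -> R[i]) (x : V) : R[i] :=
  'D_v (fun y => complex.Re (f y)) x +i* 'D_v (fun y => complex.Im (f y)) x.

Definition cderives (vs : seq V) (f : V -> R[i]) : V -> R[i] :=
  foldr cderive f vs.

(* C^oo on the open set U: all iterated directional derivatives exist and are
   continuous on U.  Since U is open, the junk values of ['D_v] outside of U do
   not influence the derivatives taken at points of U. *)
Definition smooth_on (U : set V) (f : V -> R[i]) : Prop :=
  forall (vs : seq V) (x : V), U x ->
    [/\ {for x, continuous (fun y => complex.Re (cderives vs f y))},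
        {for x, continuous (fun y => complex.Im (cderives vs f y))} &
        forall v, derivable (fun y => complex.Re (cderives vs f y)) x v /\
                  derivable (fun y => complex.Im (cderives vs f y)) x v].

End Smooth.

(** * The torus [(R / 2 pi Z)^d]

    Functions on the torus are functions on ['rV[R]_d] that are 2 pi-periodic in
    each coordinate; they are integrated over the fundamental domain
    [[0, 2 pi[^d] against the (unnormalised) Lebesgue measure. *)

Section Torus.
Variable R : realType.

Lemma measurable_tuple_cons (m : nat) :
  measurable_fun [set: m.-tuple R * R]
    (fun p : m.-tuple R * R => [tuple of p.2 :: p.1]).
Proof. exact: measurable_cons measurable_snd measurable_fst. Qed.

Definition lebesgue_tuple_step (m : nat)
    (mu : {measure set (m.-tuple R) -> \bar R}) :
    {measure set (m.+1.-tuple R) -> \bar R} :=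
  measure_function_pushforward__canonical__measure_function_Measure
    (mu \x lebesgue_measure)%E (@measurable_tuple_cons m).

(* The Lebesgue measure on R^n: an iterated product measure, transported to
   tuples, which carry the product sigma-algebra. *)
Fixpoint lebesgue_tuple (n : nat) : {measure set (n.-tuple R) -> \bar R} :=
  match n with
  | 0 => dirac [tuple]
  | m.+1 => lebesgue_tuple_step (lebesgue_tuple m)
  end.

Variable d : nat.
Local Notation fct := ('rV[R]_d -> R[i]).

Definition periodic (f : fct) : Prop :=
  forall (x : 'rV[R]_d) (j : 'I_d), f (x + (2 * pi) *: delta_mx 0 j) = f x.

Definition row_of (x : d.-tuple R) : 'rV[R]_d := \row_j tnth x j.

Definition cube : set (d.-tuple R) :=
  [set x | forall j, 0 <= tnth x j < 2 * pi].

Definition torus_int (f : fct) : R[i] :=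
  (\int[lebesgue_tuple d]_(x in cube) complex.Re (f (row_of x)))
  +i* (\int[lebesgue_tuple d]_(x in cube) complex.Im (f (row_of x))).

(* Elements of L^2(T^d), given by Borel representatives. *)
Definition L2 : set fct :=
  [set f | [/\ periodic f,
     measurable_fun cube (fun x => complex.Re (f (row_of x))),
     measurable_fun cube (fun x => complex.Im (f (row_of x))) &
     (\int[lebesgue_tuple d]_(x in cube) (normc (f (row_of x)) ^+ 2)%:E
        < +oo)%E]].

Definition L2_inner (f g : fct) : R[i] :=
  torus_int (fun x => f x * conjc (g x)).

(** ** Distributions

    A distribution is a functional on test functions; its values at functions
    that are not test functions are irrelevant. *)

Definition test_function : set fct :=
  [set psi | periodic psi /\ smooth_on setT psi].

Definition distribution_space : set (fct -> R[i]) :=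
  [set T |
    (forall (a : R[i]) (psi chi : fct), test_function psi -> test_function chi ->
       T (fun x => a * psi x + chi x) = a * T psi + T chi) /\
    (exists (N : nat) (C : R), forall (psi : fct) (M : R), test_function psi ->
       (forall (js : seq 'I_d) (x : 'rV[R]_d), (size js <= N)%N ->
          normc (cderives [seq delta_mx 0 j | j <- js] psi x) <= M) ->
       normc (T psi) <= C * M)].

Definition distribution_of (f : fct) : fct -> R[i] :=
  fun psi => torus_int (fun x => f x * psi x).

Definition expi (theta : R) : R[i] := cos theta +i* sin theta.

Definition fourier_coef (T : fct -> R[i]) (k : 'rV[int]_d) : R[i] :=
  (((2 * pi) ^+ d)^-1)%:C *
  T (fun x => expi (- \sum_(j < d) (k 0 j)%:~R * x 0 j)).

(* The norm of H^s(T^d), with value +oo outside of H^s. *)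
Definition sobolev_norm (s : R) (T : fct -> R[i]) : \bar R :=
  poweR (\esum_(k in [set: 'rV[int]_d])
           ((1 + \sum_(j < d) (k 0 j)%:~R ^+ 2) `^ s
            * normc (fourier_coef T k) ^+ 2)%:E)
        (2^-1).

Definition sobolev_space (s : R) : set (fct -> R[i]) :=
  [set T | distribution_space T /\ (sobolev_norm s T < +oo)%E].

(** ** The nonlinear Schroedinger equation *)

Definition laplacian (f : fct) (x : 'rV[R]_d) : R[i] :=
  \sum_(j < d) cderive (delta_mx 0 j) (cderive (delta_mx 0 j) f) x.

Record nls_solution (sigma : nat) (lam : R) (J : set R)
    (u : R -> 'rV[R]_d -> R[i]) : Prop := NlsSolution {
  nls_interval : is_interval J;
  nls_open : open J;
  nls_initial_time : J 0;
  nls_smooth : smooth_on (J `*` setT) (fun p : R * 'rV[R]_d => u p.1 p.2);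
  nls_periodic : forall t, J t -> periodic (u t);
  nls_equation : forall t x, J t ->
    'i * cderive (1 : R^o) (fun t' => u t' x) t + (2^-1)%:C * laplacian (u t) x
    = lam%:C * (normc (u t x) ^+ (2 * sigma))%:C * u t x
}.

(** ** Solution maps

    A solution map may be defined on any set [D] of data; it only has to contain
    and to propagate correctly all the data launching smooth solutions on the
    time interval considered. *)

Definition nls_solution_map (sigma : nat) (lam s k T : R)
    (D : set (fct -> R[i])) (S : (fct -> R[i]) -> R -> fct -> R[i]) : Prop :=
  [/\ D `<=` sobolev_space s,
      forall f t, D f -> 0 <= t <= T -> sobolev_space k (S f t) &
      forall J u, nls_solution sigma lam J u -> `[0, T] `<=` J ->
        D (distribution_of (u 0)) /\
        forall t, 0 <= t <= T -> forall psi, test_function psi ->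
          S (distribution_of (u 0)) t psi = distribution_of (u t) psi].

(* Continuity of f |-> S f from D, with the H^s norm, to H^k-valued functions of
   time, with the topology of uniform convergence on [0, T]. *)
Definition sobolev_continuous (s k T : R)
    (D : set (fct -> R[i])) (S : (fct -> R[i]) -> R -> fct -> R[i]) : Prop :=
  forall f, D f -> forall eps : R, 0 < eps ->
    exists2 eta : R, 0 < eta & forall g, D g ->
      (sobolev_norm s (fun psi => (f psi - g psi)%R) < eta%:E)%E ->
      forall t, 0 <= t <= T ->
        (sobolev_norm k (fun psi => (S f t psi - S g t psi)%R) < eps%:E)%E.

Definition nls_flow_at (sigma : nat) (lam t : R)
    (D : set fct) (Phi : fct -> fct -> R[i]) : Prop :=
  [/\ D `<=` L2,
      forall f, D f -> distribution_space (Phi f) &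
      forall J u, nls_solution sigma lam J u -> J t ->
        D (u 0) /\
        forall psi, test_function psi ->
          Phi (u 0) psi = distribution_of (u t) psi].

(* Continuity at f of Phi, from D with the topology induced by the weak topology
   of L^2 to distributions with the weak-* topology. *)
Definition weakly_continuous_at (D : set fct) (Phi : fct -> fct -> R[i])
    (f : fct) : Prop :=
  forall psi, test_function psi -> forall eps : R, 0 < eps ->
    exists (n : nat) (g : 'I_n -> fct) (eta : R),
      [/\ forall i, L2 (g i), 0 < eta &
          forall h, D h ->
            (forall i, normc (L2_inner (fun x => h x - f x) (g i)) < eta) ->
            normc (Phi h psi - Phi f psi) < eps].

End Torus.

(* Main.v *)
Require Import Defs.
From HB Require Import structures.
From mathcomp Require Import all_boot all_order all_algebra.
From mathcomp Require Import all_classical all_reals all_analysis.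
From mathcomp Require Import complex.
From mathcomp Require Import measurable_realfun ring lra zify.

Set Implicit Arguments.
Unset Strict Implicit.
Unset Printing Implicit Defensive.
Import Order.TTheory GRing.Theory Num.Theory.
Import numFieldNormedType.Exports.

Local Open Scope classical_set_scope.
Local Open Scope ring_scope.
Local Open Scope complex_scope.

(** Why the theorem holds.  Superpose a large fast wave [a1 exp(i N x_1)] on the
    constant [a0].  When [s < 0] the fast wave is arbitrarily small in [H^s] as
    [N] grows, but the nonlinearity sees its modulus [a1], which is independent of
    [N]: at leading order the mean of the solution keeps its modulus and rotates as
    [a0 exp(- i lam t shift_poly sigma |a0|^2 a1^2)].  The polynomial [shift_poly]
    tends to infinity with [a1]; it therefore suffices to choose [a1] so that two
    means come into phase opposition within time [delta], and then [N] so that the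
    data are close.

    Parts 1 and 3 compare this solution with the plane wave issued from [a0],
    whose mean rotates at the speed [lam |a0|^(2 sigma)].  Part 2 compares two
    solutions with the same fast wave and slightly different means: for
    [sigma >= 2] the rotation speed contains a product of [a1^2] with a
    nonconstant power of [|a0|^2], and so its variation is unbounded in [a1].  In
    part 3 the fast wave tends weakly to zero by Bessel's inequality, and [a1] is
    chosen small instead, so that the two phases differ by less than [pi].

    The heart of the proof is [two_mode_solution]: for [N] large, the solution
    exists and is smooth on any prescribed time interval, and it is uniformly close
    to two rotating modes.  With [z = N x_1] and [nu = N^2] the equation becomes
    [i v_t + (nu / 2) v_zz = lam |v|^(2 sigma) v].  The nonlinearity, evaluated on
    the modes 0 and 1, produces a term of frequency [k] which oscillates in time
    like [exp(- i nu k t / 2)] up to slow factors, whereas a free wave of frequency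
    [k] oscillates like [exp(- i nu k^2 t / 2)].  These agree only for [k = 0] and
    [k = 1], where the term is absorbed in the rotation of the modes; all the other
    terms have response [O(1 / nu)].  Picard's iteration started from the two modes
    and this small response converges on the whole time interval, because the
    Duhamel operator is a contraction for a norm weighted by [exp(- L |t|)], with
    [L] independent of [nu] ([nonlin_incr_bounded], [duhamel_bound], [iterateP]).

    The iterates are finite trigonometric polynomials, measured in a Wiener algebra
    with weight [exp |k|].  All their space derivatives converge uniformly, and the
    equation exchanges time derivatives for space derivatives: the limit and its
    space derivatives generate an algebra that is closed under all the directional
    derivatives ([jet_derive], [smooth_family]), whence smoothness. *)

(** * Complex-valued functions: components, modulus, directional derivatives *)

Section ComplexCalculus.
Variable R : realType.
Implicit Types V : normedModType R.

Lemma cReD (a b : R[i]) : complex.Re (a + b) = complex.Re a + complex.Re b.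
Proof. by case: a b => [? ?] [? ?]. Qed.

Lemma cImD (a b : R[i]) : complex.Im (a + b) = complex.Im a + complex.Im b.
Proof. by case: a b => [? ?] [? ?]. Qed.

Lemma cReN (a : R[i]) : complex.Re (- a) = - complex.Re a.
Proof. by case: a. Qed.

Lemma cImN (a : R[i]) : complex.Im (- a) = - complex.Im a.
Proof. by case: a. Qed.

Lemma cReM (a b : R[i]) : complex.Re (a * b) =
  complex.Re a * complex.Re b - complex.Im a * complex.Im b.
Proof. by case: a b => [? ?] [? ?]. Qed.

Lemma cImM (a b : R[i]) : complex.Im (a * b) =
  complex.Re a * complex.Im b + complex.Im a * complex.Re b.
Proof. by case: a b => [? ?] [? ?]. Qed.

Lemma eq_ReIm (a b : R[i]) :
  complex.Re a = complex.Re b -> complex.Im a = complex.Im b -> a = b.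
Proof. by case: a b => [? ?] [? ?] /= -> ->. Qed.

Lemma realCD (x y : R) : (x + y)%:C = x%:C + y%:C. Proof. exact: rmorphD. Qed.
Lemma realCN (x : R) : (- x)%:C = - x%:C. Proof. exact: rmorphN. Qed.
Lemma realCM (x y : R) : (x * y)%:C = x%:C * y%:C. Proof. exact: rmorphM. Qed.
Lemma realCX (x : R) n : (x ^+ n)%:C = x%:C ^+ n. Proof. exact: rmorphXn. Qed.
Lemma realCV (x : R) : (x^-1)%:C = x%:C^-1. Proof. exact: fmorphV. Qed.
Lemma realC_nat n : (n%:R)%:C = n%:R :> R[i]. Proof. exact: rmorph_nat. Qed.
Lemma realC_sum I (r : seq I) (P : pred I) (F : I -> R) :
  (\sum_(i <- r | P i) F i)%:C = \sum_(i <- r | P i) (F i)%:C.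
Proof. exact: rmorph_sum. Qed.
Lemma realC_eq0 (x : R) : (x%:C == 0) = (x == 0).
Proof. exact: (fmorph_eq0 (real_complex R)). Qed.

Lemma cReJ (a : R[i]) : complex.Re (conjc a) = complex.Re a.
Proof. by case: a. Qed.

Lemma cImJ (a : R[i]) : complex.Im (conjc a) = - complex.Im a.
Proof. by case: a. Qed.

Lemma conjD (a b : R[i]) : conjc (a + b) = conjc a + conjc b.
Proof. exact: rmorphD. Qed.

Lemma conjM (a b : R[i]) : conjc (a * b) = conjc a * conjc b.
Proof. exact: rmorphM. Qed.

Lemma normcD_le (a b : R[i]) : normc (a + b) <= normc a + normc b.
Proof. exact: le_normcD. Qed.

Lemma normcNE (a : R[i]) : normc (- a) = normc a.
Proof. exact: normcN. Qed.

Lemma normcB_le (a b : R[i]) : normc (a - b) <= normc a + normc b.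
Proof. by rewrite (le_trans (normcD_le _ _))// normcNE. Qed.

Lemma normcBC (a b : R[i]) : normc (a - b) = normc (b - a).
Proof. by rewrite -normcNE opprB. Qed.

Lemma normc_ge0 (a : R[i]) : 0 <= normc a.
Proof. by case: a => x y; rewrite sqrtr_ge0. Qed.

Lemma normcEM (a b : R[i]) : normc (a * b) = normc a * normc b.
Proof. exact: ComplexField.Normc.normcM. Qed.

Lemma normcX (a : R[i]) n : normc (a ^+ n) = normc a ^+ n.
Proof.
elim: n => [|n IH]; first by rewrite !expr0 ComplexField.Normc.normc1.
by rewrite !exprS normcEM IH.
Qed.

Lemma normcJE (a : R[i]) : normc (conjc a) = normc a.
Proof. by case: a => x y; rewrite /= sqrrN. Qed.

Lemma normc_real (r : R) : normc r%:C = `|r|.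
Proof. by rewrite /= expr0n/= addr0 sqrtr_sqr. Qed.

Lemma normc_sq (a : R[i]) :
  normc a ^+ 2 = complex.Re a ^+ 2 + complex.Im a ^+ 2.
Proof. by case: a => x y; rewrite /= sqr_sqrtr// addr_ge0// sqr_ge0. Qed.

Lemma normc_sqC (a : R[i]) : (normc a ^+ 2)%:C = a * conjc a.
Proof.
by apply: eq_ReIm; rewrite normc_sq ?cReM ?cImM ?cReJ ?cImJ /=; ring.
Qed.

Lemma normc_Re (a : R[i]) : `|complex.Re a| <= normc a.
Proof.
case: a => x y /=; rewrite -sqrtr_sqr ler_sqrt ?addr_ge0 ?sqr_ge0//.
by rewrite lerDl sqr_ge0.
Qed.

Lemma normc_Im (a : R[i]) : `|complex.Im a| <= normc a.
Proof.
case: a => x y /=; rewrite -sqrtr_sqr ler_sqrt ?addr_ge0 ?sqr_ge0//.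
by rewrite lerDr sqr_ge0.
Qed.

Lemma normc_ReIm (a : R[i]) : normc a <= `|complex.Re a| + `|complex.Im a|.
Proof.
rewrite -(@ler_pXn2r _ 2)// ?nnegrE ?addr_ge0// ?normc_ge0//.
by rewrite normc_sq sqrrD !real_normK ?num_real// lerD2r lerDl mulrn_wge0.
Qed.

Lemma normc_eq0 (a : R[i]) : (normc a == 0) = (a == 0).
Proof.
apply/eqP/eqP => [/ComplexField.Normc.eq0_normc//|->].
exact: ComplexField.Normc.normc0.
Qed.

Lemma normc_gt0 (a : R[i]) : (0 < normc a) = (a != 0).
Proof. by rewrite lt_neqAle normc_ge0 andbT eq_sym normc_eq0. Qed.

(** Stated as a relation and not through the total function [cderive], so that
    differentiability is carried along. *)
Definition is_cderive V (x v : V) (f : V -> R[i]) (a : R[i]) : Prop :=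
  is_derive x v (fun y => complex.Re (f y)) (complex.Re a) /\
  is_derive x v (fun y => complex.Im (f y)) (complex.Im a).

Lemma is_derive_congr V (x v : V) (f g : V -> R) (a b : R) :
  is_derive x v f a -> f = g -> a = b -> is_derive x v g b.
Proof. by move=> + <- <-. Qed.

Lemma is_cderiveE V (x v : V) f a : is_cderive x v f a -> cderive v f x = a.
Proof. by case=> h1 h2; rewrite /cderive !derive_val; case: a h1 h2. Qed.

Lemma is_cderive_uniq V (x v : V) f a b :
  is_cderive x v f a -> is_cderive x v f b -> a = b.
Proof. by move=> /is_cderiveE <- /is_cderiveE <-. Qed.

Lemma is_cderive_eq V (x v : V) f a b :
  is_cderive x v f a -> a = b -> is_cderive x v f b.
Proof. by move=> + <-. Qed.

Lemma is_cderive_ext V (x v : V) f g a :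
  f =1 g -> is_cderive x v f a -> is_cderive x v g a.
Proof. by move=> /funext ->. Qed.

Lemma is_cderive_near V (x v : V) f g a : (\near x, f x = g x) ->
  is_cderive x v f a -> is_cderive x v g a.
Proof.
move=> fg [h1 h2]; split; [move: h1|move: h2]; apply: near_eq_is_derive;
  by apply: filterS fg => y ->.
Qed.

(** All the derivatives of the proof are computed along lines, where the chain
    rule in one variable is enough. *)
Lemma is_cderive_line V (x v : V) f a :
  is_cderive x v f a <-> is_cderive (0 : R) 1 (fun h => f (x + h *: v)) a.
Proof.
have real_line (g : V -> R) l :
    is_derive x v g l <-> is_derive (0 : R) 1 (fun h => g (x + h *: v)) l.
  have e : (fun h : R => h^-1 *: (g (h *: v + x) - g x)) =
      (fun h : R => h^-1 *: (g (x + (h *: (1 : R) + 0 : R) *: v) - g (x + 0 *: v))).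
    apply/funext => h; rewrite scale0r !addr0 [h *: (1 : R)]mulr1.
    by rewrite [x + _]addrC.
  by split=> -[d1 d2]; split; rewrite /derivable/derive in d1 d2 *;
    [rewrite -e| rewrite -e|rewrite e|rewrite e].
by split => -[h1 h2]; split; apply/real_line.
Qed.

Lemma is_cderive_cst V (x v : V) c : is_cderive x v (fun=> c) 0.
Proof. by split; exact: is_derive_cst. Qed.

Lemma is_cderiveD V (x v : V) f g a b : is_cderive x v f a ->
  is_cderive x v g b -> is_cderive x v (fun y => f y + g y) (a + b).
Proof.
move=> [f1 f2] [g1 g2]; split.
  by rewrite cReD; under [X in is_derive _ _ X]eq_fun do rewrite cReD;
    exact: is_deriveD.
by rewrite cImD; under [X in is_derive _ _ X]eq_fun do rewrite cImD;
  exact: is_deriveD.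
Qed.

Lemma is_cderiveM V (x v : V) f g a b : is_cderive x v f a ->
  is_cderive x v g b ->
  is_cderive x v (fun y => f y * g y) (a * g x + f x * b).
Proof.
move=> [f1 f2] [g1 g2]; split.
  under [X in is_derive _ _ X]eq_fun do rewrite cReM.
  apply: (is_derive_congr (is_deriveB (is_deriveM f1 g1) (is_deriveM f2 g2))) => //.
  by rewrite cReD !cReM /GRing.scale /=; ring.
under [X in is_derive _ _ X]eq_fun do rewrite cImM.
apply: (is_derive_congr (is_deriveD (is_deriveM f1 g2) (is_deriveM f2 g1))) => //.
by rewrite cImD !cImM /GRing.scale /=; ring.
Qed.

Lemma is_cderiveZ V (x v : V) c f a : is_cderive x v f a ->
  is_cderive x v (fun y => c * f y) (c * a).
Proof.
move=> fa; apply: is_cderive_eq; first exact: is_cderiveM (is_cderive_cst _ _ c) fa.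
by rewrite mul0r add0r.
Qed.

Lemma is_cderiveJ V (x v : V) f a : is_cderive x v f a ->
  is_cderive x v (fun y => conjc (f y)) (conjc a).
Proof.
move=> [f1 f2]; split.
  by rewrite cReJ; under [X in is_derive _ _ X]eq_fun do rewrite cReJ.
by rewrite cImJ; under [X in is_derive _ _ X]eq_fun do rewrite cImJ;
  exact: (is_deriveN f2).
Qed.

Lemma is_cderive_comp (f : R -> R[i]) (g : R -> R) (x : R) a b :
  is_cderive (g x) 1 f a -> is_derive x 1 g b ->
  is_cderive x 1 (f \o g) (b%:C * a).
Proof.
move=> [f1 f2] gb; split; apply: is_derive_eq.
- by apply: (@is_derive1_comp _ (fun y => complex.Re (f y)) g); eassumption.
- by rewrite cReM /=; ring.
- by apply: (@is_derive1_comp _ (fun y => complex.Im (f y)) g); eassumption.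
- by rewrite cImM /=; ring.
Qed.

Lemma is_derive_affine (x c d : R) : is_derive x 1 (fun y => c + d * y) d.
Proof.
apply: (is_derive_congr (is_deriveD (is_derive_cst c x 1)
    (is_deriveM (is_derive_cst d x 1) (is_derive_id x 1)))) => //.
by rewrite /GRing.scale /=; ring.
Qed.

Lemma is_cderive_affine (f : R -> R[i]) (x c d : R) a :
  is_cderive (c + d * x) 1 f a ->
  is_cderive x 1 (fun y => f (c + d * y)) (d%:C * a).
Proof.
move=> fa.
by apply: (@is_cderive_comp f (fun y => c + d * y)) => //; exact: is_derive_affine.
Qed.

End ComplexCalculus.

(** * Geometric limits and primitives on the real line *)

Section RealAnalysis.
Variable R : realType.

(** The intervals of centre [x n] and radius [2 K / 2 ^ n] are nested, so the
    supremum of their left ends belongs to all of them. *)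
Lemma geometric_limit (x : nat -> R) (K : R) :
  (forall n, `|x n.+1 - x n| <= K / 2 ^+ n) ->
  exists l, forall n, `|l - x n| <= 2 * K / 2 ^+ n.
Proof.
move=> hx.
pose a n := x n - 2 * K / 2 ^+ n; pose b n := x n + 2 * K / 2 ^+ n.
have half n : 2 * K / 2 ^+ n.+1 = K / 2 ^+ n :> R.
  by rewrite exprS; field; rewrite expf_neq0.
have two n : 2 * K / 2 ^+ n = K / 2 ^+ n + K / 2 ^+ n :> R by ring.
have aS n : a n <= a n.+1.
  by rewrite /a half two; have := hx n; rewrite ler_norml => /andP[]; lra.
have bS n : b n.+1 <= b n.
  by rewrite /b half two; have := hx n; rewrite ler_norml => /andP[]; lra.
have am m n : a n <= a (n + m)%N.
  by elim: m => [|m IH]; rewrite ?addn0// addnS (le_trans IH).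
have bm m n : b (n + m)%N <= b n.
  by elim: m => [|m IH]; rewrite ?addn0// addnS (le_trans (bS _)).
have K0 n : 0 <= K / 2 ^+ n := le_trans (normr_ge0 _) (hx n).
have ab n m : a n <= b m.
  rewrite (le_trans (am m n))// (le_trans _ (bm n m))// addnC /a /b two.
  by have := K0 (m + n)%N; lra.
exists (sup [set a n | n in setT]) => n.
have h1 : a n <= sup [set a n | n in setT].
  apply: ub_le_sup; last by exists n.
  by exists (b 0%N) => _ [m _ <-].
have h2 : sup [set a n | n in setT] <= b n.
  apply: ge_sup; first by exists (a 0%N); exists 0%N.
  by move=> _ [m _ <-].
by rewrite ler_norml; move: h1 h2; rewrite /a /b; lra.
Qed.

Lemma geometric_climit (x : nat -> R[i]) (K : R) :
  (forall n, normc (x n.+1 - x n) <= K / 2 ^+ n) ->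
  exists l, forall n, normc (l - x n) <= 4 * K / 2 ^+ n.
Proof.
move=> hx.
have [n|l1 h1] := @geometric_limit (fun n => complex.Re (x n)) K.
  by rewrite -cReN -cReD (le_trans (normc_Re _)).
have [n|l2 h2] := @geometric_limit (fun n => complex.Im (x n)) K.
  by rewrite -cImN -cImD (le_trans (normc_Im _)).
exists (l1 +i* l2) => n; rewrite (le_trans (normc_ReIm _))//.
rewrite cReD cImD cReN cImN /=.
by rewrite (le_trans (lerD (h1 n) (h2 n)))// le_eqVlt; apply/orP; left; apply/eqP; ring.
Qed.

(** Written symmetrically in the sign of [h]: time runs in both directions. *)
Lemma mean_value (f g : R -> R) (h : R) :
  (forall x : R, `|x| <= `|h| -> is_derive x 1 f (g x)) ->
  exists2 c, `|c| <= `|h| & f h - f 0 = g c * h.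
Proof.
move=> fg.
have cont a b : (forall x, a <= x <= b -> `|x| <= `|h|) ->
    {within `[a, b], continuous f}.
  move=> ab; apply: derivable_within_continuous => x; rewrite in_itv/= => /ab xh.
  by have [] := fg _ xh.
have [h0|h0|->] := ltgtP h 0; last first.
- by exists 0; rewrite ?subrr ?mulr0.
- have [||c] := @MVT _ f g 0 h h0.
  + by move=> x; rewrite in_itv/= => /andP[x0 xh]; apply: fg; rewrite !gtr0_norm// ltW.
  + by apply: cont => x /andP[x0 xh]; rewrite !ger0_norm// (le_trans x0).
  + rewrite in_itv/= => /andP[c0 ch] e; exists c; last by rewrite e subr0.
    by rewrite !gtr0_norm// ltW.
- have [||c] := @MVT _ f g h 0 h0.
  + by move=> x; rewrite in_itv/= => /andP[x0 xh]; apply: fg; rewrite !ltr0_norm// lerN2 ltW.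
  + by apply: cont => x /andP[x0 xh]; rewrite !ler0_norm ?lerN2 ?(ltW h0).
  + rewrite in_itv/= => /andP[c0 ch] e; exists c.
      by rewrite !ltr0_norm// lerN2 ltW.
    by rewrite -opprB e; ring.
Qed.

Lemma is_derive_eps (f : R -> R) (l : R) :
  (forall eps, 0 < eps -> exists2 d, 0 < d & forall h, `|h| < d ->
     `|f h - f 0 - h * l| <= eps * `|h|) ->
  is_derive (0 : R) 1 f l.
Proof.
move=> H.
have cv : (fun h : R => h^-1 *: (f (h *: (1 : R) + 0 : R) - f 0)) @ 0^' --> l.
  apply/cvgrPdist_le => eps e0.
  have [d d0 hd] := H _ e0.
  near=> h.
  have hN0 : h != 0 by near: h; exact: nbhs_dnbhs_neq.
  have hd' : `|h| < d.
    near: h; apply: dnbhs0_lt => //.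
  rewrite addr0 [h *: (1 : R)]mulr1.
  have h0 : 0 < `|h| by rewrite normr_gt0.
  rewrite -(ler_pM2r h0) -normrM (le_trans _ (hd _ hd'))//.
  rewrite -normrN le_eqVlt; apply/orP; left; apply/eqP; congr (`|_|).
  by rewrite /GRing.scale /=; field.
by split; [apply/cvg_ex; exists l|exact/cvg_lim].
Unshelve. all: by end_near. Qed.

(** The mean value theorem bounds the difference quotients of [fn n] by the
    oscillation of [gn n], uniformly in [n]; hence [n] can tend to infinity before
    the increment tends to zero. *)
Lemma is_derive_uniform_limit (f g : R -> R) (fn gn : nat -> R -> R)
    (e : nat -> R) (r : R) :
  0 < r ->
  (forall n (h : R), `|h| < r -> is_derive h 1 (fn n) (gn n h)) ->
  (forall n h, `|h| < r -> `|f h - fn n h| <= e n) ->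
  (forall n h, `|h| < r -> `|g h - gn n h| <= e n) ->
  (forall n, {for 0, continuous (gn n)}) ->
  (forall eps, 0 < eps -> exists n, e n <= eps) ->
  is_derive (0 : R) 1 f (g 0).
Proof.
move=> r0 fg hf hg gc he; apply: is_derive_eps => eps e0.
have [m hm] := he (eps / 8) ltac:(by rewrite divr_gt0).
have /(cvgrPdist_le _ _)/(_ _ (divr_gt0 e0 (ltr0n _ 8))) := gc m.
rewrite -nbhs_nearE => /nbhs_ballP[d /= d0 hd].
exists (Num.min r d); first by rewrite lt_min r0.
move=> h; rewrite lt_min => /andP[hr hdd].
have [->|h0] := eqVneq h 0.
  by rewrite subrr mul0r subr0 normr0 mulr0.
have hp : 0 < `|h| by rewrite normr_gt0.
have [n hn] := he (Num.min (eps / 8) (eps * `|h| / 8))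
  ltac:(by rewrite lt_min !divr_gt0 ?mulr_gt0).
move: hn; rewrite le_min => /andP[n1 n2].
have [c ch ec] := @mean_value (fn n) (gn n) h (fun x xh => fg n x (le_lt_trans xh hr)).
have cr := le_lt_trans ch hr.
have r0' : `|(0 : R)| < r by rewrite normr0.
have gm : `|gn m 0 - gn m c| <= eps / 8.
  by apply: hd; rewrite /ball /= sub0r normrN (le_lt_trans ch).
have key : `|gn n c - g 0| <= eps / 2.
  have -> : gn n c - g 0 = - (g c - gn n c) + (g c - gn m c) -
    (gn m 0 - gn m c) - (g 0 - gn m 0) by ring.
  have a1 := hg n c cr; have a2 := hg m c cr; have a3 := hg m 0 r0'.
  have := ler_normB (- (g c - gn n c) + (g c - gn m c) - (gn m 0 - gn m c))
    (g 0 - gn m 0).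
  have := ler_normB (- (g c - gn n c) + (g c - gn m c)) (gn m 0 - gn m c).
  have := ler_normD (- (g c - gn n c)) (g c - gn m c).
  by rewrite normrN; lra.
have -> : f h - f 0 - h * g 0 =
   (f h - fn n h) - (f 0 - fn n 0) + (fn n h - fn n 0 - h * g 0) by ring.
rewrite ec; have -> : gn n c * h - h * g 0 = (gn n c - g 0) * h by ring.
have := ler_normD ((f h - fn n h) - (f 0 - fn n 0)) ((gn n c - g 0) * h).
have := ler_normB (f h - fn n h) (f 0 - fn n 0).
have a1 := hf n h hr; have a2 := hf n 0 r0'.
have := ler_wpM2r (normr_ge0 h) key; rewrite -normrM.
have := mulr_gt0 e0 hp.
by lra.
Qed.

(** The integrals from [- B] to [t], normalised to vanish at [0], are primitives
    on [|t| < B]; two of them agree where both are defined, so they glue. *)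
Lemma antiderivative (f : R -> R) : continuous f ->
  exists2 F : R -> R, F 0 = 0 & forall t : R, is_derive t 1 F (f t).
Proof.
move=> fc.
pose G (B t : R) := \int[lebesgue_measure]_(x in `[- B, t]) f x -
  \int[lebesgue_measure]_(x in `[- B, 0]) f x.
have ifab a b : lebesgue_measure.-integrable `[a, b] (EFin \o f).
  apply: continuous_compact_integrable; first exact: segment_compact.
  exact: continuous_subspaceT.
have GE B : G B 0 = 0 by rewrite /G subrr.
have Gd (B t : R) : `|t| < B -> is_derive t 1 (G B) (f t).
  move=> tB; have [tB1 tB2] : - B < t /\ t < B.
    by move: tB; rewrite ltr_norml => /andP[].
  have [d1 d2] := @continuous_FTC1_closed _ f (- B) t B tB2 (ifab _ _) tB1 (fc t).
  have h : is_derive t 1 (fun t => \int[lebesgue_measure]_(x in `[- B, t]) f x) (f t).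
    by split; [exact: d1|rewrite -derive1E].
  apply: (is_derive_congr (is_deriveB h (is_derive_cst _ _ _))) => //.
  by rewrite subr0.
have GG B B' t : `|t| < B -> `|t| < B' -> G B t = G B' t.
  move=> tB tB'.
  have [x xt|c ct] := @mean_value (fun t => G B t - G B' t) (fun=> 0) t.
    apply: (is_derive_congr (is_deriveB (Gd B x _) (Gd B' x _))) => //.
    - exact: le_lt_trans xt _.
    - exact: le_lt_trans xt _.
    - by rewrite subrr.
  by rewrite !GE !subr0 mul0r => /eqP; rewrite subr_eq0 => /eqP.
exists (fun t => G (`|t| + 1) t); first exact: GE.
move=> t.
apply: (@near_eq_is_derive _ _ _ (G (`|t| + 2))); last first.
  by apply: Gd; rewrite ltrDl.
near=> x.
have xt : `|x - t| < 1.
  have : ball t 1 x by near: x; apply: nbhsx_ballx.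
  by rewrite /ball /= distrC.
apply: GG; last by rewrite ltrDl.
by have := ler_normD (x - t) t; rewrite subrK; lra.
Unshelve. all: by end_near. Qed.

End RealAnalysis.

(** * Continuity, phases and the Duhamel formula *)

Section Continuity.
Variable R : realType.
Implicit Types T : topologicalType.

Definition cts T (x : T) (f : T -> R[i]) : Prop :=
  {for x, continuous (fun y => complex.Re (f y))} /\
  {for x, continuous (fun y => complex.Im (f y))}.

Lemma cts_cst T (x : T) c : cts x (fun=> c).
Proof. by split; exact: cst_continuous. Qed.

Lemma ctsD T (x : T) f g : cts x f -> cts x g -> cts x (fun y => f y + g y).
Proof.
move=> [f1 f2] [g1 g2]; split.
  under [X in {for x, continuous X}]eq_fun do rewrite cReD.
  exact: (cvgD f1 g1).
under [X in {for x, continuous X}]eq_fun do rewrite cImD.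
exact: (cvgD f2 g2).
Qed.

Lemma ctsM T (x : T) f g : cts x f -> cts x g -> cts x (fun y => f y * g y).
Proof.
move=> [f1 f2] [g1 g2]; split.
  under [X in {for x, continuous X}]eq_fun do rewrite cReM.
  exact: (cvgB (cvgM f1 g1) (cvgM f2 g2)).
under [X in {for x, continuous X}]eq_fun do rewrite cImM.
exact: (cvgD (cvgM f1 g2) (cvgM f2 g1)).
Qed.

Lemma ctsB T (x : T) f g : cts x f -> cts x g -> cts x (fun y => f y - g y).
Proof.
move=> hf hg; under [X in cts _ X]eq_fun do rewrite -mulN1r.
exact: (ctsD hf (ctsM (cts_cst x _) hg)).
Qed.

Lemma ctsJ T (x : T) f : cts x f -> cts x (fun y => conjc (f y)).
Proof.
move=> [f1 f2]; split.
  by under [X in {for x, continuous X}]eq_fun do rewrite cReJ.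
under [X in {for x, continuous X}]eq_fun do rewrite cImJ.
exact: (cvgN f2).
Qed.

Lemma cts_comp T T' (x : T) (g : T -> T') (f : T' -> R[i]) :
  {for x, continuous g} -> cts (g x) f -> cts x (f \o g).
Proof.
by move=> gx [f1 f2]; split; [exact: (continuous_comp gx f1)|
  exact: (continuous_comp gx f2)].
Qed.

Lemma fst_cts (T1 T2 : topologicalType) (p : T1 * T2) : {for p, continuous fst}.
Proof.
by move=> A hA; exists (A, setT) => [|[? ?] []//]; split => //; exact: filterT.
Qed.

Lemma snd_cts (T1 T2 : topologicalType) (p : T1 * T2) : {for p, continuous snd}.
Proof.
by move=> A hA; exists (setT, A) => [|[? ?] []//]; split => //; exact: filterT.
Qed.

Lemma cts_ext T (x : T) f g : f =1 g -> cts x f -> cts x g.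
Proof. by move=> /funext ->. Qed.

Lemma cts_near T (x : T) f g : (\near x, f x = g x) -> cts x f -> cts x g.
Proof.
move=> fg [f1 f2]; have e := nbhs_singleton fg; split.
  rewrite /prop_for /continuous_at -e; apply: cvg_trans f1.
  by apply: near_eq_cvg; apply: filterS fg => y ->.
rewrite /prop_for /continuous_at -e; apply: cvg_trans f2.
by apply: near_eq_cvg; apply: filterS fg => y ->.
Qed.

Lemma is_cderive_cts (x : R) f a : is_cderive x 1 f a -> cts x f.
Proof.
by move=> [[d1 _] [d2 _]]; split; apply: differentiable_continuous;
  [exact/derivable1_diffP|exact/derivable1_diffP].
Qed.

Lemma cts_uniform_limit T (x : T) (f : T -> R[i]) (fn : nat -> T -> R[i])
    (e : nat -> R) (U : set T) :
  nbhs x U -> (forall n y, U y -> normc (f y - fn n y) <= e n) ->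
  (forall n, cts x (fn n)) ->
  (forall eps, 0 < eps -> exists n, e n <= eps) -> cts x f.
Proof.
move=> Ux hf hc he.
have real (g : T -> R) (gn : nat -> T -> R) :
    (forall n y, U y -> `|g y - gn n y| <= e n) ->
    (forall n, {for x, continuous (gn n)}) -> {for x, continuous g}.
  move=> hg gc; apply/cvgrPdist_le => eps e0.
  have [m hm] := he (eps / 3) ltac:(by rewrite divr_gt0).
  have /(cvgrPdist_le _ _)/(_ _ (divr_gt0 e0 (ltr0n _ 3))) := gc m.
  move=> h; near=> y.
  have Uy : U y by near: y.
  have h1 := hg m y Uy; have h2 := hg m x (nbhs_singleton Ux).
  have h3 : `|gn m x - gn m y| <= eps / 3 by near: y.
  have -> : g x - g y = (g x - gn m x) + (gn m x - gn m y) - (g y - gn m y).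
    by ring.
  have := ler_normB ((g x - gn m x) + (gn m x - gn m y)) (g y - gn m y).
  have := ler_normD (g x - gn m x) (gn m x - gn m y).
  by lra.
split; [apply: (real _ (fun n y => complex.Re (fn n y)))
       |apply: (real _ (fun n y => complex.Im (fn n y)))].
- by move=> n y Uy; rewrite -cReN -cReD (le_trans (normc_Re _))// hf.
- by move=> n; case: (hc n).
- by move=> n y Uy; rewrite -cImN -cImD (le_trans (normc_Im _))// hf.
- by move=> n; case: (hc n).
Unshelve. all: by end_near. Qed.

Lemma is_cderive_uniform_limit (f g : R -> R[i]) (fn gn : nat -> R -> R[i])
    (e : nat -> R) (r : R) :
  0 < r ->
  (forall n (h : R), `|h| < r -> is_cderive h 1 (fn n) (gn n h)) ->
  (forall n h, `|h| < r -> normc (f h - fn n h) <= e n) ->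
  (forall n h, `|h| < r -> normc (g h - gn n h) <= e n) ->
  (forall n, cts (0 : R) (gn n)) ->
  (forall eps, 0 < eps -> exists n, e n <= eps) ->
  is_cderive (0 : R) 1 f (g 0).
Proof.
move=> r0 fg hf hg gc he; split.
- apply: (@is_derive_uniform_limit _ _ (fun h => complex.Re (g h))
    (fun n h => complex.Re (fn n h)) (fun n h => complex.Re (gn n h)) e r) => //.
  + by move=> n h /(fg n)[].
  + by move=> n h /(hf n); rewrite -cReN -cReD; apply/le_trans/normc_Re.
  + by move=> n h /(hg n); rewrite -cReN -cReD; apply/le_trans/normc_Re.
  + by move=> n; case: (gc n).
- apply: (@is_derive_uniform_limit _ _ (fun h => complex.Im (g h))
    (fun n h => complex.Im (fn n h)) (fun n h => complex.Im (gn n h)) e r) => //.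
  + by move=> n h /(fg n)[].
  + by move=> n h /(hf n); rewrite -cImN -cImD; apply/le_trans/normc_Im.
  + by move=> n h /(hg n); rewrite -cImN -cImD; apply/le_trans/normc_Im.
  + by move=> n; case: (gc n).
Qed.

End Continuity.

Section Exponential.
Variable R : realType.
Local Notation ii := (Complex 0 1 : R[i]).

Lemma expi0 : expi 0 = 1 :> R[i].
Proof. by rewrite /expi cos0 sin0. Qed.

Lemma expiD (x y : R) : expi (x + y) = expi x * expi y.
Proof.
by apply: eq_ReIm; rewrite ?cReM ?cImM /= ?cosD ?sinD; ring.
Qed.

Lemma expiN (x : R) : expi (- x) = conjc (expi x).
Proof. by rewrite /expi cosN sinN. Qed.

Lemma normc_expi (x : R) : normc (expi x) = 1.
Proof. by rewrite /= cos2Dsin2 sqrtr1. Qed.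

Lemma expiX (x : R) n : expi (x *+ n) = expi x ^+ n.
Proof.
by elim: n => [|n IH]; rewrite ?mulr0n ?expi0 ?expr0// mulrS exprS expiD IH.
Qed.

Lemma expi_pi : expi pi = -1 :> R[i].
Proof. by rewrite /expi cospi sinpi; apply: eq_ReIm => /=; rewrite ?oppr0. Qed.

Lemma expi_periodic (k : int) : expi (k%:~R * (2 * pi)) = 1 :> R[i].
Proof.
have e : expi (2 * pi) = 1 :> R[i] by rewrite mulr_natl expiX expi_pi; ring.
case: k => n.
  by rewrite -pmulrn [n%:R * _]mulr_natl expiX e expr1n.
by rewrite NegzE mulrNz mulNr expiN -pmulrn [n.+1%:R * _]mulr_natl expiX e expr1n rmorph1.
Qed.

Lemma is_cderive_expi (c t : R) :
  is_cderive t 1 (fun t => expi (c * t)) (ii * c%:C * expi (c * t)).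
Proof.
have h : is_derive t 1 (fun t => c * t) c.
  apply: (is_derive_congr (is_derive_affine t 0 c)) => //.
  by apply/funext => x; rewrite add0r.
split; rewrite /expi /=.
  apply: (is_derive_congr (is_derive1_comp (is_derive_cos (c * t)) h)) => //=; ring.
apply: (is_derive_congr (is_derive1_comp (is_derive_sin (c * t)) h)) => //=; ring.
Qed.

Lemma mul_ii : ii * ii = -1.
Proof. by apply: eq_ReIm; rewrite ?cReM ?cImM /=; ring. Qed.

Lemma normc_ii : normc ii = 1.
Proof. by rewrite /= expr0n/= add0r expr1n sqrtr1. Qed.

(** For a real variable the normed structure of the domain has to be fixed
    beforehand for unification to succeed. *)
Lemma is_cderive_ext1 (x : R) (f g : R -> R[i]) a :
  f =1 g -> is_cderive x 1 f a -> is_cderive x 1 g a.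
Proof. exact: is_cderive_ext. Qed.

(** Variation of constants: [exp(i kappa t) A] is a primitive. *)
Lemma duhamel_exists (kappa : R) (a : R -> R[i]) : (forall t, cts t a) ->
  exists A : R -> R[i], A 0 = 0 /\
    forall t : R, is_cderive t 1 A (- ii * (kappa%:C * A t + a t)).
Proof.
move=> ca.
have cb t : cts t (fun t => - ii * (expi (kappa * t) * a t)).
  apply: ctsM; first exact: cts_cst.
  by apply: ctsM => //; exact: is_cderive_cts (is_cderive_expi _ _).
have [B1 B10 B1d] := antiderivative (fun t => (cb t).1).
have [B2 B20 B2d] := antiderivative (fun t => (cb t).2).
exists (fun t => expi (- kappa * t) * (B1 t +i* B2 t)); split.
  by rewrite B10 B20 mulr0.
move=> t; apply: is_cderive_eq.
  apply: is_cderiveM; first exact: is_cderive_expi.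
  have : is_cderive t 1 (fun t => B1 t +i* B2 t) (- ii * (expi (kappa * t) * a t)).
    by split; [exact: B1d|exact: B2d].
  exact.
have e : expi (- kappa * t) * expi (kappa * t) = 1 :> R[i].
  by rewrite -expiD mulNr addNr expi0.
rewrite rmorphN /=; set x := expi _ in e *; set y := expi _ in e *.
rewrite [LHS](_ : _ = - ii * (kappa%:C * (x * (B1 t +i* B2 t)) + x * y * a t));
  last by ring.
by rewrite e mul1r.
Qed.

(** Integrating [exp(L |t|)] gains the factor [1 / L]: this is the smallness that
    drives the iteration on long time intervals. *)
Lemma exp_weight_primitive (B b : R -> R[i]) (m L T : R) :
  0 < L -> B 0 = 0 -> (forall t : R, is_cderive t 1 B (b t)) ->
  (forall t, `|t| <= T -> normc (b t) <= m * expR (L * `|t|)) ->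
  forall t, `|t| <= T -> normc (B t) <= m / L * expR (L * `|t|).
Proof.
move=> L0.
have pos (B' b' : R -> R[i]) : B' 0 = 0 -> (forall t : R, is_cderive t 1 B' (b' t)) ->
    (forall t, `|t| <= T -> normc (b' t) <= m * expR (L * `|t|)) ->
    forall t, 0 < t -> t <= T -> normc (B' t) <= m / L * expR (L * t).
  move=> B0 Bd hb t t0 tT.
  (* Multiplying by the conjugate of the final value turns its modulus into a
     real part, to which the mean value theorem for real functions applies. *)
  pose c := conjc (B' t).
  have m0 : 0 <= m.
    have := hb 0; rewrite normr0 mulr0 expR0 mulr1 => h.
    by rewrite (le_trans (normc_ge0 _) (h _))// (le_trans (ltW t0)).
  pose phi s := complex.Re (c * B' s) - normc c * m / L * expR (L * s).
  pose dphi s := complex.Re (c * b' s) - normc c * m / L * (L * expR (L * s)).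
  have phid (s : R) : is_derive s 1 phi (dphi s).
    have h1 : is_derive s 1 (fun s => L * s) L.
      apply: (is_derive_congr (is_derive_affine s 0 L)) => //.
      by apply/funext => x; rewrite add0r.
    have h2 := is_derive1_comp (is_derive_expR (L * s)) h1.
    have [h3 _] := is_cderiveZ c (Bd s).
    have h4 := is_deriveM (is_derive_cst (normc c * m / L) s 1) h2.
    apply: (is_derive_congr (is_deriveB h3 h4)) => //.
    by rewrite /dphi /GRing.scale /=; ring.
  have [|s] := @MVT _ phi dphi 0 t t0 (fun x _ => phid x).
    by apply: derivable_within_continuous => x _; have [] := phid x.
  rewrite in_itv/= => /andP[s0 st] e.
  have dle : dphi s <= 0.
    rewrite /dphi subr_le0 (le_trans (ler_norm _))//.
    rewrite (le_trans (normc_Re _))// normcEM.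
    have := hb s; rewrite gtr0_norm// => /(_ (ltW (lt_le_trans st tT))) h.
    rewrite (le_trans (ler_wpM2l (normc_ge0 _) h))// le_eqVlt; apply/orP; left.
    by apply/eqP; field; rewrite gt_eqF.
  have : phi t - phi 0 <= 0 by rewrite e mulr_le0_ge0// subr0 ltW.
  rewrite /phi B0 mulr0 mulr0 expR0 mulr1 [complex.Re 0]/= sub0r opprK.
  rewrite -(normcJE (B' t)) -/c => h.
  have h1 : normc c ^+ 2 <= normc c * (m / L * expR (L * t)).
    have -> : normc c ^+ 2 = complex.Re (c * B' t).
      rewrite normc_sq /c cReM cReJ cImJ; ring.
    have : 0 <= normc c * m / L by rewrite !mulr_ge0 ?normc_ge0 ?invr_ge0// ltW.
    by rewrite !mulrA; lra.
  have [->|c0] := eqVneq (normc c) 0.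
    by rewrite !mulr_ge0 ?invr_ge0 ?expR_ge0// ltW.
  by rewrite -(@ler_pM2l _ (normc c)) ?lt_neqAle ?normc_ge0 ?andbT 1?eq_sym.
move=> B0 Bd hb t tT.
have [t0|t0|->] := ltgtP t 0; last first.
- rewrite B0 ComplexField.Normc.normc0 normr0 mulr0 expR0 mulr1.
  have := hb 0; rewrite normr0 mulr0 expR0 mulr1 => h.
  rewrite mulr_ge0 ?invr_ge0 ?(ltW L0)// (le_trans (normc_ge0 _) (h _))//.
  exact: le_trans tT.
- by rewrite gtr0_norm//; apply: (pos B b) => //; rewrite -(gtr0_norm t0).
- rewrite ltr0_norm// -{1}(opprK t).
  apply: (pos (fun s => B (- s)) (fun s => - 1 * b (- s))).
  + by rewrite oppr0.
  + move=> s; have h0 : is_cderive (0 + -1 * s) 1 B (b (- s)).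
      by rewrite mulN1r add0r.
    have h := is_cderive_affine h0.
    apply: is_cderive_eq; last by rewrite -(rmorphN1 (real_complex R)).
    by apply: is_cderive_ext h => x; rewrite mulN1r add0r.
  + move=> s sT; rewrite normcEM normcNE ComplexField.Normc.normc1 mul1r.
    by have := hb (- s); rewrite normrN; apply.
  + by rewrite oppr_gt0.
  + by rewrite -(ltr0_norm t0).
Qed.

(** The rotation by [exp(i kappa t)] does not change moduli, so the bound does not
    depend on [kappa]: the waves may oscillate arbitrarily fast. *)
Lemma duhamel_bound (kappa : R) (A a : R -> R[i]) (m L T : R) : 0 < L ->
  A 0 = 0 ->
  (forall t : R, is_cderive t 1 A (- ii * (kappa%:C * A t + a t))) ->
  (forall t, `|t| <= T -> normc (a t) <= m * expR (L * `|t|)) ->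
  forall t, `|t| <= T -> normc (A t) <= m / L * expR (L * `|t|).
Proof.
move=> L0 A0 Ad ha t tT.
have -> : normc (A t) = normc (expi (kappa * t) * A t).
  by rewrite normcEM normc_expi mul1r.
apply: (@exp_weight_primitive (fun t => expi (kappa * t) * A t)
  (fun t => - ii * expi (kappa * t) * a t) m L T) => //.
- by rewrite A0 mulr0.
- move=> s; apply: is_cderive_eq.
    by apply: is_cderiveM; [exact: is_cderive_expi|exact: Ad].
  by cbv beta; ring.
- by move=> s sT; rewrite !normcEM normcNE normc_ii normc_expi !mul1r ha.
Qed.

End Exponential.

(** * Trigonometric polynomials with time-dependent coefficients *)

Section TrigonometricPolynomials.
Variable R : realType.
Local Notation ii := (Complex 0 1 : R[i]).

(** A pair [(k, a)] stands for [a(t) exp(i k z)].  Frequencies may be repeated in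
    a list: nothing is ever collected, so that products need no convolution and
    the norm below is submultiplicative on the nose. *)
Definition trig : Type := seq (int * (R -> R[i])).

(** The [j]-th derivative in [z] of the function that the list represents. *)
Definition synth (j : nat) (l : trig) (t z : R) : R[i] :=
  \sum_(q <- l) (ii * (q.1%:~R)%:C) ^+ j * q.2 t * expi (q.1%:~R * z).

Definition weight (k : int) : R := expR `|k%:~R|.

Definition mult (l1 l2 : trig) : trig :=
  [seq (p.1 + q.1, fun t => p.2 t * q.2 t) | p <- l1, q <- l2].
Definition conjt (l : trig) : trig :=
  [seq (- q.1, fun t => conjc (q.2 t)) | q <- l].
Definition scalet (c : R[i]) (l : trig) : trig :=
  [seq (q.1, fun t => c * q.2 t) | q <- l].

(** [bounded L T l M]: on [|t| <= T], the norm of [l] in the Wiener algebra with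
    weight [exp |k|] is at most [M exp(L |t|)].  The exponential weight in the
    frequency controls all the derivatives in [z]; the one in time makes the
    Duhamel operator a contraction on arbitrarily long intervals. *)
Fixpoint bounded (L T : R) (l : trig) (M : R) : Prop :=
  if l is q :: l' then exists m,
    [/\ forall t, cts t q.2,
        forall t, `|t| <= T -> normc (q.2 t) <= m * expR (L * `|t|) &
        bounded L T l' (M - weight q.1 * m)]
  else 0 <= M.

Lemma weight_gt0 k : 0 < weight k.
Proof. exact: expR_gt0. Qed.

Lemma weightD k k' : weight (k + k') <= weight k * weight k'.
Proof. by rewrite /weight -expRD ler_expR intrD ler_normD. Qed.

Lemma weightN k : weight (- k) = weight k.
Proof. by rewrite /weight mulrNz normrN. Qed.

(** This is [1 + x / j <= exp(x / j)], raised to the power [j]. *)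
Lemma pow_weight (j : nat) (k : int) :
  `|k%:~R| ^+ j <= j%:R ^+ j * weight k :> R.
Proof.
case: j => [|j]; first by rewrite !expr0 mul1r /weight -expR0 ler_expR.
set x : R := `|k%:~R|.
have -> : weight k = expR (x / j.+1%:R) ^+ j.+1.
  by rewrite -expRM_natr mulfVK.
rewrite -exprMn lerXn2r ?nnegrE ?mulr_ge0 ?expR_ge0 ?normr_ge0//.
rewrite mulrC -ler_pdivrMr ?ltr0n// (le_trans _ (expR_ge1Dx _))// lerDr//.
Qed.

Lemma synth_nil j t z : synth j [::] t z = 0.
Proof. by rewrite /synth big_nil. Qed.

Lemma synth_cons j q l t z : synth j (q :: l) t z =
  (ii * (q.1%:~R)%:C) ^+ j * q.2 t * expi (q.1%:~R * z) + synth j l t z.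
Proof. by rewrite /synth big_cons. Qed.

Lemma synth_cat j l1 l2 t z :
  synth j (l1 ++ l2) t z = synth j l1 t z + synth j l2 t z.
Proof. by rewrite /synth big_cat. Qed.

Lemma synth_scale j c l t z : synth j (scalet c l) t z = c * synth j l t z.
Proof.
rewrite /synth big_map mulr_sumr; apply: eq_bigr => q _ /=; ring.
Qed.

Lemma synth_mult l1 l2 t z :
  synth 0 (mult l1 l2) t z = synth 0 l1 t z * synth 0 l2 t z.
Proof.
rewrite /synth big_allpairs_dep mulr_suml; apply: eq_bigr => p _.
rewrite mulr_sumr; apply: eq_bigr => q _ /=.
by rewrite !expr0 intrD mulrDl expiD; ring.
Qed.

Lemma synth_conj l t z : synth 0 (conjt l) t z = conjc (synth 0 l t z).
Proof.
rewrite /synth big_map rmorph_sum; apply: eq_bigr => q _ /=.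
by rewrite !expr0 !mul1r mulrNz mulNr expiN -conjM.
Qed.

Section Bounds.
Variables (T : R) (T0 : 0 <= T).

Lemma bounded_ge0 L l M : bounded L T l M -> 0 <= M.
Proof.
elim: l M => [|q l IH] M //= [m [_ hm /IH]].
have := hm 0; rewrite normr0 mulr0 expR0 mulr1 => /(_ T0) h.
have : 0 <= weight q.1 * m.
  by rewrite mulr_ge0 ?(ltW (weight_gt0 _))// (le_trans (normc_ge0 _) h).
lra.
Qed.

Lemma bounded_le L l M M' : M <= M' -> bounded L T l M -> bounded L T l M'.
Proof.
elim: l M M' => [|q l IH] M M' /= MM'; first by move/le_trans; apply.
by move=> [m [h1 h2 h3]]; exists m; split => //; apply: IH h3; rewrite lerD2r.
Qed.

Lemma bounded_cons L q l m M M' : (forall t, cts t q.2) ->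
  (forall t, `|t| <= T -> normc (q.2 t) <= m * expR (L * `|t|)) ->
  bounded L T l M -> weight q.1 * m + M <= M' -> bounded L T (q :: l) M'.
Proof.
move=> h1 h2 h3 h4; exists m; split => //; apply: bounded_le h3; lra.
Qed.

Lemma bounded_cat L l1 l2 M1 M2 : bounded L T l1 M1 -> bounded L T l2 M2 ->
  bounded L T (l1 ++ l2) (M1 + M2).
Proof.
elim: l1 M1 => [|q l IH] M1 /= h1 h2; first by apply: bounded_le h2; lra.
move: h1 => [m [c1 c2 c3]].
by apply: bounded_cons c1 c2 (IH _ c3 h2) _; lra.
Qed.

(** One factor may grow like [exp(L |t|)]; the other one has to be bounded for the
    product to satisfy a bound of the same kind. *)
Lemma bounded_mult L l1 l2 M1 M2 : bounded L T l1 M1 -> bounded 0 T l2 M2 ->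
  bounded L T (mult l1 l2) (M1 * M2).
Proof.
move=> + h2; have M20 := bounded_ge0 h2.
elim: l1 M1 => [|p l IH] M1 h1; first by rewrite /= in h1 *; exact: mulr_ge0.
move: h1 => [m [c1 c2 c3]].
have -> : M1 * M2 = weight p.1 * m * M2 + (M1 - weight p.1 * m) * M2 by ring.
apply: bounded_cat (IH _ c3).
have m0 : 0 <= m.
  have := c2 0; rewrite normr0 mulr0 expR0 mulr1 => /(_ T0).
  exact/le_trans/normc_ge0.
clear c3 IH M20; elim: l2 M2 h2 => [|q l2 IH] M2 h2.
  by rewrite /= in h2 *; rewrite mulr_ge0// mulr_ge0// ltW// weight_gt0.
move: h2 => [m' [d1 d2 d3]].
have m'0 : 0 <= m'.
  have := d2 0; rewrite normr0 mulr0 expR0 mulr1 => /(_ T0).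
  exact/le_trans/normc_ge0.
rewrite map_cons; apply: (bounded_cons (m := m * m') _ _ (IH _ d3)).
- by move=> t; apply: ctsM.
- move=> t tT; rewrite normcEM (le_trans (ler_pM _ _ (c2 t tT) (d2 t tT))) ?normc_ge0//.
  by rewrite mul0r expR0 mulr1 mulrAC.
- have : weight (p.1 + q.1) * (m * m') <= weight p.1 * weight q.1 * (m * m').
    by rewrite ler_wpM2r ?mulr_ge0// weightD.
  by rewrite /=; lra.
Qed.

Lemma bounded_conj L l M : bounded L T l M -> bounded L T (conjt l) M.
Proof.
elim: l M => [|q l IH] M //= [m [c1 c2 c3]]; exists m; split.
- by move=> t; apply: ctsJ.
- by move=> t tT; rewrite normcJE c2.
- by rewrite weightN; apply: IH.
Qed.

Lemma bounded_scale L c l M : bounded L T l M ->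
  bounded L T (scalet c l) (normc c * M).
Proof.
elim: l M => [|q l IH] M /= h; first by rewrite mulr_ge0 ?normc_ge0.
move: h => [m [c1 c2 c3]]; exists (normc c * m); split.
- by move=> t; apply: ctsM => //; exact: cts_cst.
- by move=> t tT; rewrite normcEM -mulrA ler_wpM2l ?normc_ge0// c2.
- by rewrite [weight _ * _]mulrCA -mulrBr; apply: IH.
Qed.

Lemma bounded_weaken L l M : 0 <= L -> bounded L T l M ->
  bounded 0 T l (expR (L * T) * M).
Proof.
move=> L0; elim: l M => [|q l IH] M /= h; first by rewrite mulr_ge0 ?expR_ge0.
move: h => [m [c1 c2 c3]]; exists (expR (L * T) * m); split => //.
- move=> t tT; rewrite (le_trans (c2 t tT))// mul0r expR0 mulr1 mulrC.
  rewrite ler_wpM2r ?ler_expR ?ler_wpM2l//.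
  have := c2 0; rewrite normr0 mulr0 expR0 mulr1 => /(_ T0).
  exact/le_trans/normc_ge0.
- by rewrite mulrCA -mulrBr; apply: IH.
Qed.

Lemma bounded_strengthen L l M : 0 <= L -> bounded 0 T l M -> bounded L T l M.
Proof.
move=> L0; elim: l M => [|q l IH] M //= [m [c1 c2 c3]]; exists m; split => //.
- move=> t tT; rewrite (le_trans (c2 t tT))// mul0r expR0 mulr1.
  rewrite ler_peMr// -?expR0 ?ler_expR ?mulr_ge0//.
  have := c2 0; rewrite normr0 mulr0 expR0 mulr1 => /(_ T0).
  exact/le_trans/normc_ge0.
- exact: IH.
Qed.

Lemma synth_bound L j l M t z : bounded L T l M -> `|t| <= T ->
  normc (synth j l t z) <= j%:R ^+ j * M * expR (L * `|t|).
Proof.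
move=> + tT; elim: l M => [|q l IH] M /= h.
  by rewrite synth_nil ComplexField.Normc.normc0 !mulr_ge0 ?expR_ge0.
move: h => [m [c1 c2 c3]]; rewrite synth_cons (le_trans (normcD_le _ _))//.
have -> : M = weight q.1 * m + (M - weight q.1 * m) by ring.
rewrite mulrDr mulrDl lerD ?IH//.
rewrite !normcEM normc_expi mulr1 normcX normcEM normc_ii mul1r normc_real.
rewrite mulrA -[leRHS]mulrA ler_pM ?normc_ge0 ?exprn_ge0 ?pow_weight ?c2//.
Qed.

End Bounds.

Lemma bounded_cts L T l M j (p : R * R) : bounded L T l M ->
  cts p (fun p : R * R => synth j l p.1 p.2).
Proof.
elim: l M => [|q l IH] M /=.
  move=> _; apply: cts_ext (cts_cst p 0) => y.
  by rewrite synth_nil.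
move=> [m [c1 _ /IH h]].
apply: (@cts_ext _ _ _ (fun p : R * R => (ii * (q.1%:~R)%:C) ^+ j * q.2 p.1 *
   expi (q.1%:~R * p.2) + synth j l p.1 p.2)).
  by move=> y; rewrite synth_cons.
have h1 := cts_comp (@fst_cts _ _ p) (c1 p.1).
have h2 : cts p.2 (fun z : R => expi (q.1%:~R * z)).
  exact: is_cderive_cts (is_cderive_expi _ _).
exact: (ctsD (ctsM (ctsM (cts_cst p _) h1) (cts_comp (@snd_cts _ _ p) h2)) h).
Qed.

Lemma synth_dz j l t z c : is_cderive (z : R) 1
  (fun y => synth j l t (c + y)) (synth j.+1 l t (c + z)).
Proof.
elim: l => [|q l IH].
  rewrite synth_nil; apply: is_cderive_ext (is_cderive_cst _ _ 0) => y.
  by rewrite synth_nil.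
rewrite synth_cons.
apply: (@is_cderive_ext1 _ _ (fun y => ((ii * (q.1%:~R)%:C) ^+ j * q.2 t *
  expi (q.1%:~R * c)) * expi (q.1%:~R * y) + synth j l t (c + y))).
  by move=> y; rewrite synth_cons mulrDr expiD mulrA.
apply: is_cderiveD => //; apply: is_cderive_eq.
  by apply: is_cderiveZ; exact: is_cderive_expi.
by rewrite mulrDr expiD exprS; ring.
Qed.

(** [solves nu l s]: [i l_t + (nu / 2) l_zz = s] for all the [z]-derivatives at
    once.  Space and time are mixed because smoothness will be needed along
    every direction of space-time. *)
Definition solves (nu : R) (l s : trig) : Prop :=
  forall j t z tau zeta (h : R), is_cderive h 1
    (fun y => synth j l (t + tau * y) (z + zeta * y))
    (tau%:C * (ii * ((nu / 2)%:C * synth j.+2 l (t + tau * h) (z + zeta * h) -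
                     synth j s (t + tau * h) (z + zeta * h))) +
     zeta%:C * synth j.+1 l (t + tau * h) (z + zeta * h)).

Lemma solves_cat nu l1 l2 s1 s2 : solves nu l1 s1 -> solves nu l2 s2 ->
  solves nu (l1 ++ l2) (s1 ++ s2).
Proof.
move=> h1 h2 j t z tau zeta h.
apply: (@is_cderive_ext1 _ _ (fun y =>
    synth j l1 (t + tau * y) (z + zeta * y) +
    synth j l2 (t + tau * y) (z + zeta * y))).
  by move=> y; rewrite synth_cat.
apply: is_cderive_eq; first exact: is_cderiveD (h1 _ _ _ _ _ _) (h2 _ _ _ _ _ _).
by rewrite !synth_cat; ring.
Qed.

Lemma solves1 nu k (A a : R -> R[i]) :
  (forall t : R, is_cderive t 1 A
     (- ii * ((nu / 2 * k%:~R ^+ 2)%:C * A t + a t))) ->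
  solves nu [:: (k, A)] [:: (k, a)].
Proof.
move=> hA j t z tau zeta h.
apply: (@is_cderive_ext1 _ _ (fun y => (ii * (k%:~R)%:C) ^+ j *
   (A (t + tau * y) * expi (k%:~R * (z + zeta * y))))).
  by move=> y; rewrite synth_cons synth_nil addr0 mulrA.
apply: is_cderive_eq.
  apply: is_cderiveZ; apply: is_cderiveM.
    by apply: is_cderive_affine; exact: hA.
  by apply: (@is_cderive_affine _ (fun z => expi (k%:~R * z))); exact: is_cderive_expi.
rewrite !synth_cons !synth_nil !addr0 /=.
have -> : (nu / 2 * k%:~R ^+ 2)%:C = (nu / 2)%:C * (k%:~R)%:C * (k%:~R)%:C :> R[i].
  by rewrite expr2 [nu / 2 * _]mulrA !rmorphM.
rewrite !exprS; have e : ii * ii * ii = - ii by rewrite mul_ii mulN1r.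
set w := (ii * _) ^+ j; set x := expi _; set K := (k%:~R)%:C.
set n2 := (nu / 2)%:C.
have -> : ii * (n2 * (ii * K * (ii * K * w) * A (t + tau * h) * x)
   - w * a (t + tau * h) * x) = (ii * ii * ii) * n2 * K * K * w * A (t + tau * h) * x
   - ii * w * a (t + tau * h) * x by ring.
by rewrite e; ring.
Qed.

(** The list [l'] is chosen before the bound, because the solution of a given
    source is a function of that source alone in the iteration below. *)
Lemma duhamel nu L T l M : 0 < L -> bounded L T l M ->
  exists l', [/\ forall M', bounded L T l M' -> bounded L T l' (M' / L),
    solves nu l' l & forall j z, synth j l' 0 z = 0].
Proof.
move=> L0; elim: l M => [|[k a] l IH] M /=.
  move=> M0; exists [::]; split => /=.
  - by move=> M' M'0; rewrite divr_ge0// ltW.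
  - move=> j t z tau zeta h; rewrite !synth_nil.
    apply: is_cderive_ext (is_cderive_eq (is_cderive_cst _ _ 0) _).
      by move=> y; rewrite synth_nil.
    by ring.
  - by move=> j z; rewrite synth_nil.
move=> [m [c1 _ /IH[l' [h1 h2 h3]]]].
have [A [A0 Ad]] := duhamel_exists (nu / 2 * k%:~R ^+ 2) c1.
exists ((k, A) :: l'); split.
- move=> M' [m' [_ c2 c3]]; exists (m' / L); split => //=.
  + by move=> t; exact: is_cderive_cts (Ad t).
  + exact: duhamel_bound L0 A0 Ad c2.
  + by move: (h1 _ c3); rewrite mulrBl mulrA.
- exact: (@solves_cat _ [:: (k, A)] l' [:: (k, a)] l (solves1 Ad) h2).
- by move=> j z; rewrite synth_cons h3 /= A0 mulr0 mul0r addr0.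
Qed.

(** ** The nonlinearity *)

Definition onet : trig := [:: (0, fun=> 1)].

(** A pair [(a, d)] stands for a quantity [a] with its increment [d].  After
    multiplications by [b], whose increment is [beta], every term of the increment
    contains [d] or [beta] explicitly, so that its smallness is never hidden in a
    cancellation. *)
Definition mult_incr (b beta : trig) (n : nat) (ad : trig * trig) : trig * trig :=
  iter n (fun ad => (mult ad.1 b, mult ad.2 (b ++ beta) ++ mult beta ad.1)) ad.

Definition nonlin_incr (sigma : nat) (b beta : trig) : trig * trig :=
  mult_incr (conjt b) (conjt beta) sigma
    (mult_incr b beta sigma.+1 (onet, [::])).

(** The nonlinearity as a product, the form in which it is defined on
    trigonometric polynomials and passes to limits. *)
Definition nonlin (sigma : nat) (v : R[i]) : R[i] := v ^+ sigma.+1 * conjc v ^+ sigma.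

Lemma nonlinE sigma v : nonlin sigma v = (normc v ^+ (2 * sigma))%:C * v.
Proof.
by rewrite exprM rmorphXn /= normc_sqC /nonlin exprMn exprS; ring.
Qed.

Lemma conjt_cat l1 l2 : conjt (l1 ++ l2) = conjt l1 ++ conjt l2.
Proof. exact: map_cat. Qed.

Lemma mult_incr_synth b beta n ad t z :
  synth 0 (mult_incr b beta n ad).1 t z =
    synth 0 ad.1 t z * synth 0 b t z ^+ n /\
  synth 0 (mult_incr b beta n ad).2 t z =
    (synth 0 ad.1 t z + synth 0 ad.2 t z) * synth 0 (b ++ beta) t z ^+ n -
    synth 0 ad.1 t z * synth 0 b t z ^+ n.
Proof.
elim: n => [|n [IH1 IH2]] /=; first by rewrite !expr0 !mulr1; split; ring.
rewrite synth_cat !synth_mult IH1 IH2 synth_cat !exprS; split; ring.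
Qed.

Lemma nonlin_incr_synth sigma b beta t z :
  synth 0 (nonlin_incr sigma b beta).2 t z =
  nonlin sigma (synth 0 (b ++ beta) t z) - nonlin sigma (synth 0 b t z).
Proof.
rewrite /nonlin_incr; set ad := mult_incr b beta _ _.
have [_ ->] := mult_incr_synth (conjt b) (conjt beta) sigma ad t z.
rewrite -conjt_cat !synth_conj.
have [-> ->] := mult_incr_synth b beta sigma.+1 (onet, [::]) t z.
have -> : synth 0 onet t z = 1.
  by rewrite synth_cons synth_nil /= mul0r expi0 expr0; ring.
by rewrite synth_nil /nonlin; ring.
Qed.

Lemma mult_incr_bounded L T b beta n ad M A D D' : 0 <= T -> 1 <= M ->
  bounded 0 T b M -> bounded 0 T (b ++ beta) M -> bounded L T beta D ->
  bounded 0 T ad.1 A -> bounded L T ad.2 D' ->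
  bounded 0 T (mult_incr b beta n ad).1 (A * M ^+ n) /\
  bounded L T (mult_incr b beta n ad).2 ((D' + n%:R * A * D) * M ^+ n).
Proof.
move=> T0 M1 hb hbb hbeta ha hd.
elim: n => [|n [IH1 IH2]] /=.
  by rewrite !expr0 !mulr1 !mul0r addr0.
split; first by rewrite exprSr mulrA; apply: bounded_mult.
apply: (bounded_le _ (bounded_cat (bounded_mult T0 IH2 hbb)
  (bounded_mult T0 hbeta IH1))).
have D0 := bounded_ge0 T0 hbeta; have A0 := bounded_ge0 T0 ha.
have : 0 <= A * M ^+ n * D by rewrite !mulr_ge0// exprn_ge0// (le_trans ler01).
rewrite exprSr -natr1; nra.
Qed.

(** The increment of a product of [2 sigma + 1] factors is a sum of [2 sigma + 1]
    terms, each of them containing the increment of one factor. *)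
Lemma nonlin_incr_bounded L T sigma b beta M D : 0 <= T -> 1 <= M ->
  bounded 0 T b M -> bounded 0 T (b ++ beta) M -> bounded L T beta D ->
  bounded L T (nonlin_incr sigma b beta).2
    ((2 * sigma + 1)%:R * D * M ^+ (2 * sigma + 1)).
Proof.
move=> T0 M1 hb hbb hbeta.
have one1 : bounded 0 T onet 1.
  exists 1; split.
  - by move=> t; exact: cts_cst.
  - by move=> t _; rewrite [normc _]ComplexField.Normc.normc1 mul0r expR0 mulr1.
  - by rewrite /= /weight mulr0z normr0 expR0 mulr1 subrr lexx.
have nil0 : bounded L T [::] 0 by exact: lexx.
have [h1 h2] := @mult_incr_bounded L T b beta sigma.+1 (onet, [::]) M 1 D 0
  T0 M1 hb hbb hbeta one1 nil0.
have hcc : bounded 0 T (conjt b ++ conjt beta) M.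
  by rewrite -conjt_cat; exact: bounded_conj.
have [_] := mult_incr_bounded sigma T0 M1 (bounded_conj hb) hcc
  (bounded_conj hbeta) h1 h2.
apply: bounded_le; rewrite le_eqVlt; apply/orP; left; apply/eqP.
have -> : (2 * sigma + 1 = sigma.+1 + sigma)%N by lia.
by rewrite exprD natrD; ring.
Qed.

End TrigonometricPolynomials.

(** * Uniform limits along lines *)

Section Limits.
Variable R : realType.

Definition clim (x : nat -> R[i]) (l : R[i]) : Prop :=
  forall eps, 0 < eps -> exists N, forall n, (N <= n)%N -> normc (x n - l) <= eps.

Lemma clim_uniq x l l' : clim x l -> clim x l' -> l = l'.
Proof.
move=> h h'; apply/eqP; rewrite -subr_eq0 -normc_eq0.
apply/negP => /negP ne; have pos : 0 < normc (l - l').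
  by rewrite lt_neqAle eq_sym ne normc_ge0.
have e0 : 0 < normc (l - l') / 3 by rewrite divr_gt0.
have [N hN] := h _ e0; have [N' hN'] := h' _ e0.
have h1 := hN (N + N')%N (leq_addr _ _); have h2 := hN' (N + N')%N (leq_addl _ _).
have : normc (l - l') <= normc (x (N + N')%N - l') + normc (x (N + N')%N - l).
  have -> : l - l' = (x (N + N')%N - l') - (x (N + N')%N - l) by ring.
  exact: normcB_le.
lra.
Qed.

Lemma clim_cst c : clim (fun=> c) c.
Proof.
by move=> eps e0; exists 0%N => n _; rewrite subrr ComplexField.Normc.normc0 ltW.
Qed.

Lemma climM x y l m : clim x l -> clim y m -> clim (fun n => x n * y n) (l * m).
Proof.
move=> hx hy eps e0.
pose d := Num.min 1 (eps / (1 + normc l + normc m)).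
have q0 : 0 < 1 + normc l + normc m.
  by rewrite -addrA ltr_pwDl// addr_ge0// normc_ge0.
have d0 : 0 < d by rewrite lt_min ltr01 divr_gt0.
have [N hN] := hx _ d0; have [N' hN'] := hy _ d0.
exists (maxn N N') => n; rewrite geq_max => /andP[n1 n2].
have h1 := hN n n1; have h2 := hN' n n2.
have -> : x n * y n - l * m =
  (x n - l) * (y n - m) + (l * (y n - m) + (x n - l) * m) by ring.
rewrite (le_trans (normcD_le _ _))// (le_trans (lerD (lexx _) (normcD_le _ _)))//.
rewrite !normcEM.
have dl : d <= 1 by rewrite ge_min lexx.
have dq : d * (1 + normc l + normc m) <= eps.
  by rewrite -ler_pdivlMr// ge_min lexx orbT.
have b1 : normc (x n - l) * normc (y n - m) <= d * 1.
  by apply: ler_pM; rewrite ?normc_ge0// (le_trans h2).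
have b2 : normc l * normc (y n - m) <= normc l * d by rewrite ler_wpM2l ?normc_ge0.
have b3 : normc (x n - l) * normc m <= d * normc m by rewrite ler_wpM2r ?normc_ge0.
lra.
Qed.

Lemma climJ x l : clim x l -> clim (fun n => conjc (x n)) (conjc l).
Proof.
by move=> h eps /h[N hN]; exists N => n /hN; rewrite -rmorphB normcJE.
Qed.

Lemma climX x l k : clim x l -> clim (fun n => x n ^+ k) (l ^+ k).
Proof.
move=> h; elim: k => [|k IH].
  by rewrite expr0; under [X in clim X]eq_fun do rewrite expr0; exact: clim_cst.
by rewrite exprS; under [X in clim X]eq_fun do rewrite exprS; exact: climM.
Qed.

Lemma geometric_small (K eps : R) : 0 < eps -> exists N, forall n, (N <= n)%N ->
  K / 2 ^+ n <= eps.
Proof.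
move=> e0.
have [K0|K0] := leP K 0.
  exists 0%N => n _; rewrite (le_trans _ (ltW e0))// mulr_le0_ge0// invr_ge0 exprn_ge0//.
have hN := archi_boundP (ltW (divr_gt0 K0 e0)); set N := Num.bound _ in hN.
exists N => n Nn; rewrite ler_pdivrMr ?exprn_gt0//.
have h : (n%:R : R) <= 2 ^+ n by rewrite -natrX ler_nat ltnW// ltn_expl.
have : K / eps <= n%:R by rewrite (le_trans (ltW hN))// ler_nat.
rewrite ler_pdivrMr// => /le_trans; apply.
by rewrite mulrC ler_wpM2l// ltW.
Qed.

Lemma clim_geometric x l (K : R) :
  (forall n, normc (l - x n) <= K / 2 ^+ n) -> clim x l.
Proof.
move=> h eps /(geometric_small K)[N hN]; exists N => n Nn.
by rewrite normcBC (le_trans (h n))// hN.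
Qed.

End Limits.

(** * Picard iteration *)

Section Picard.
Variable R : realType.
Local Notation ii := (Complex 0 1 : R[i]).

(** The unknown is [p + E + (increments)].  The polynomial [p + E] solves the
    linear equation whose source is the nonlinearity at [p] alone: [E] is the small
    response of the linear equation to what [p] leaves unresolved.  The nonlinearity
    at [p + E] minus the nonlinearity at [p] is the source of the first increment,
    and so on.  The hypothesis [room] keeps the iterates in the ball of radius [M],
    and [L_large] halves the increments. *)
Variables (sigma : nat) (lam nu T L M M0 D Ms : R) (p E src : trig R).
Hypotheses (lam1 : normc lam%:C = 1) (T0 : 0 < T) (L0 : 0 < L) (M1 : 1 <= M).
Hypothesis pE_solves : solves nu (p ++ E) src.
Hypothesis src_eq :
  forall t z, synth 0 src t z = lam%:C * nonlin sigma (synth 0 p t z).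
Hypothesis p_bounded : bounded 0 T p M0.
Hypothesis E_bounded : bounded L T E D.
Hypothesis src_bounded : bounded L T src Ms.
Hypothesis E_init : forall j z, synth j E 0 z = 0.
Hypothesis room : M0 + 2 * (expR (L * T) * D) <= M.
Hypothesis L_large : 2 * ((2 * sigma + 1)%:R * M ^+ (2 * sigma + 1)) <= L.

(** A choice of the solution constructed in [duhamel], so that the iteration is a
    function. *)
Definition duh (l : trig R) : trig R := xget [::] [set l' |
  [/\ forall M', bounded L T l M' -> bounded L T l' (M' / L),
    solves nu l' l & forall j z, synth j l' 0 z = 0]].

Lemma duhP l M' : bounded L T l M' ->
  [/\ bounded L T (duh l) (M' / L), solves nu (duh l) l &
      forall j z, synth j (duh l) 0 z = 0].
Proof.
move=> h; have [l' hl'] := duhamel nu L0 h.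
by have [h1 h2 h3] := @xgetPex _ [::] [set l' | [/\ forall M',
  bounded L T l M' -> bounded L T l' (M' / L), solves nu l' l &
  forall j z, synth j l' 0 z = 0]] (ex_intro _ _ hl'); split => //; exact: h1.
Qed.

Record state := State { cur : trig R; incr : trig R; source : trig R }.

Definition src_incr (st : state) : trig R :=
  scalet lam%:C (nonlin_incr sigma (cur st) (incr st)).2.

Definition step (st : state) : state :=
  State (cur st ++ incr st) (duh (src_incr st)) (source st ++ src_incr st).

Definition iterate (n : nat) : state := iter n step (State p E src).

Definition apx (n : nat) : trig R := cur (iterate n) ++ incr (iterate n).

Lemma D_ge0 : 0 <= D. Proof. exact (bounded_ge0 (ltW T0) E_bounded). Qed.

Lemma bound_le_M n : M0 + 2 * (expR (L * T) * D) * (1 - 2^-1 ^+ n) <= M.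
Proof.
rewrite (le_trans _ room)// lerD2l ler_piMr ?mulr_ge0 ?expR_ge0 ?D_ge0//.
Qed.

Lemma src_incr_bounded n :
  bounded 0 T (cur (iterate n)) M -> bounded 0 T (apx n) M ->
  bounded L T (incr (iterate n)) (D / 2 ^+ n) ->
  bounded L T (src_incr (iterate n)) (L * D / 2 ^+ n.+1).
Proof.
move=> h1 h2 h3.
apply: bounded_le (bounded_scale _ (nonlin_incr_bounded _ (ltW T0) M1 h1 h2 h3)).
rewrite lam1 mul1r exprS.
have := ler_wpM2r (divr_ge0 D_ge0 (exprn_ge0 n (ler0n R 2))) L_large.
set a := _ ^+ (2 * sigma + 1); set c := _%:R.
have -> : L * D / (2 * 2 ^+ n) = (L * (D / 2 ^+ n)) / 2.
  by field; rewrite expf_neq0.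
lra.
Qed.

(** The contraction: each increment is half the previous one in the norm weighted
    by [exp(- L |t|)], and [room] keeps the sum of all of them in the ball of
    radius [M] where the Lipschitz constant of the nonlinearity is controlled by
    [L]. *)
Lemma iterateP n :
  [/\ bounded 0 T (cur (iterate n)) (M0 + 2 * (expR (L * T) * D) * (1 - 2^-1 ^+ n)),
      bounded L T (incr (iterate n)) (D / 2 ^+ n),
      exists Ms, bounded L T (source (iterate n)) Ms,
      solves nu (apx n) (source (iterate n)) &
      forall t z, synth 0 (source (iterate n)) t z =
        lam%:C * nonlin sigma (synth 0 (cur (iterate n)) t z)].
Proof.
elim: n => [|n [h1 h2 [Ms' h3] h4 h5]].
  by split => //=; rewrite ?expr0 ?subrr ?mulr0 ?addr0 ?invr1 ?mulr1//; exists Ms.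
have c1 : bounded 0 T (cur (iterate n)) M.
  exact: bounded_le (bound_le_M n) h1.
have c2 : bounded 0 T (apx n) (M0 + 2 * (expR (L * T) * D) * (1 - 2^-1 ^+ n.+1)).
  apply: bounded_le (bounded_cat h1 (bounded_weaken (ltW T0) (ltW L0) h2)).
  rewrite le_eqVlt; apply/orP; left; apply/eqP.
  by rewrite !exprVn exprS; field; rewrite expf_neq0.
have c3 := src_incr_bounded c1 (bounded_le (bound_le_M n.+1) c2) h2.
have [d1 d2 d3] := duhP c3.
split => //.
- apply: bounded_le d1; rewrite le_eqVlt; apply/orP; left; apply/eqP.
  by field; rewrite expf_neq0//= gt_eqF.
- by exists (Ms' + L * D / 2 ^+ n.+1); exact: bounded_cat.
- exact: solves_cat.
- move=> t z; rewrite /= synth_cat h5 synth_scale nonlin_incr_synth; ring.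
Qed.

Lemma src_incrP n : bounded L T (src_incr (iterate n)) (L * D / 2 ^+ n.+1).
Proof.
have [h1 h2 _ _ _] := iterateP n; have [h3 _ _ _ _] := iterateP n.+1.
by apply: src_incr_bounded => //; apply: bounded_le (bound_le_M _) _; eassumption.
Qed.

Lemma apx_init n j z : synth j (apx n) 0 z = synth j p 0 z.
Proof.
have incr0 m : synth j (incr (iterate m)) 0 z = 0.
  by case: m => [|m]; [exact: E_init|have [_ _ ->] := duhP (src_incrP m)].
rewrite synth_cat incr0 addr0.
by elim: n => [//|n IH] /=; rewrite synth_cat incr0 IH addr0.
Qed.

(** A common rate of convergence for the [j]-th derivatives of the iterates and of
    their sources. *)
Definition rate (j : nat) : R := j%:R ^+ j * ((1 + L) * D) * expR (L * T).

Lemma term_bound j l C n t z : `|t| <= T -> bounded L T l (C / 2 ^+ n.+1) ->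
  0 <= C -> C <= (1 + L) * D -> normc (synth j l t z) <= rate j / 2 ^+ n.
Proof.
move=> tT hl C0 hC; rewrite (le_trans (synth_bound j z hl tT))// /rate.
rewrite [leRHS]mulrAC ler_pM ?expR_ge0 ?mulr_ge0 ?exprn_ge0 ?invr_ge0//.
  rewrite -[leRHS]mulrA ler_wpM2l ?exprn_ge0// ler_pM ?invr_ge0 ?exprn_ge0//.
  by rewrite lef_pV2 ?posrE ?exprn_gt0// exprS ler_peMl ?exprn_ge0// ler1n.
by rewrite ler_expR ler_wpM2l// ltW.
Qed.

Lemma apx_cauchy j n t z : `|t| <= T ->
  normc (synth j (apx n.+1) t z - synth j (apx n) t z) <= rate j / 2 ^+ n.
Proof.
move=> tT; rewrite synth_cat addrC addKr.
have [_ h _ _ _] := iterateP n.+1.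
apply: term_bound tT h D_ge0 _.
by rewrite ler_peMl ?D_ge0// lerDl ltW.
Qed.

Lemma source_cauchy j n t z : `|t| <= T ->
  normc (synth j (source (iterate n.+1)) t z - synth j (source (iterate n)) t z)
    <= rate j / 2 ^+ n.
Proof.
move=> tT; rewrite /= synth_cat addrC addKr.
apply: term_bound tT (src_incrP n) _ _; first by rewrite mulr_ge0 ?D_ge0// ltW.
by rewrite ler_wpM2r ?D_ge0// lerDr.
Qed.

Definition vlim (j : nat) (t z : R) : R[i] := xget 0
  [set l | forall n, normc (l - synth j (apx n) t z) <= 4 * rate j / 2 ^+ n].
Definition slim (j : nat) (t z : R) : R[i] := xget 0
  [set l | forall n, normc (l - synth j (source (iterate n)) t z)
                       <= 4 * rate j / 2 ^+ n].

Lemma vlimP j t z n : `|t| <= T ->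
  normc (vlim j t z - synth j (apx n) t z) <= 4 * rate j / 2 ^+ n.
Proof.
move=> tT; have [l hl] := geometric_climit (fun n => apx_cauchy j n z tT).
exact: (@xgetPex _ 0 [set l | forall n, normc (l - synth j (apx n) t z) <=
  4 * rate j / 2 ^+ n] (ex_intro _ l hl) n).
Qed.

Lemma slimP j t z n : `|t| <= T ->
  normc (slim j t z - synth j (source (iterate n)) t z) <= 4 * rate j / 2 ^+ n.
Proof.
move=> tT; have [l hl] := geometric_climit (fun n => source_cauchy j n z tT).
exact: (@xgetPex _ 0 [set l | forall n,
  normc (l - synth j (source (iterate n)) t z) <= 4 * rate j / 2 ^+ n]
  (ex_intro _ l hl) n).
Qed.

Lemma apx_cts j n (q : R * R) : cts q (fun q => synth j (apx n) q.1 q.2).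
Proof. by have [h _ _ _ _] := iterateP n.+1; exact: bounded_cts h. Qed.

Lemma source_cts j n (q : R * R) :
  cts q (fun q => synth j (source (iterate n)) q.1 q.2).
Proof. by have [_ _ [? h] _ _] := iterateP n; exact: bounded_cts h. Qed.

Lemma line_cts (f : R * R -> R[i]) t z tau zeta (h : R) : (forall q, cts q f) ->
  cts h (fun y => f (t + tau * y, z + zeta * y)).
Proof.
move=> hf.
have g1 : {for h, continuous (fun y : R => (t + tau * y, z + zeta * y))}.
  have aff (c d : R) : {for h, continuous (fun y : R => c + d * y)}.
    apply: differentiable_continuous; apply/derivable1_diffP.
    by have [] := is_derive_affine h c d.
  exact: cvg_pair (aff t tau) (aff z zeta).
exact: (cts_comp g1 (hf _)).
Qed.

Lemma near_line (t tau : R) : `|t| < T ->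
  exists2 r, 0 < r & forall h, `|h| < r -> `|t + tau * h| <= T.
Proof.
move=> tT; have q0 : 0 < 1 + `|tau| by rewrite ltr_pwDl.
exists ((T - `|t|) / (1 + `|tau|)); first by rewrite divr_gt0 ?subr_gt0.
move=> h; rewrite ltr_pdivlMr// => hh.
rewrite (le_trans (ler_normD _ _))// normrM.
by have := normr_ge0 h; lra.
Qed.

(** Along a line, the derivatives of the iterates converge at the same geometric
    rate as the iterates themselves. *)
Lemma vlim_derive j t z tau zeta : `|t| < T ->
  is_cderive (0 : R) 1 (fun h => vlim j (t + tau * h) (z + zeta * h))
    (tau%:C * (ii * ((nu / 2)%:C * vlim j.+2 t z - slim j t z)) +
     zeta%:C * vlim j.+1 t z).
Proof.
move=> tT; have [r r0 hr] := near_line tau tT.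
pose g (l2 s0 l1 : R -> R -> R[i]) (h : R) :=
  tau%:C * (ii * ((nu / 2)%:C * l2 (t + tau * h) (z + zeta * h) -
                  s0 (t + tau * h) (z + zeta * h))) +
  zeta%:C * l1 (t + tau * h) (z + zeta * h).
pose C := 4 * rate j + normc tau%:C * (normc (nu / 2)%:C * (4 * rate j.+2) + 4 * rate j)
  + normc zeta%:C * (4 * rate j.+1).
have rate0 i : 0 <= 4 * rate i.
  rewrite mulr_ge0// /rate !mulr_ge0 ?expR_ge0 ?exprn_ge0 ?D_ge0//.
  by rewrite addr_ge0// ltW.
have pw n : 0 < (2 ^+ n : R)^-1 by rewrite invr_gt0 exprn_gt0.
have -> : tau%:C * (ii * ((nu / 2)%:C * vlim j.+2 t z - slim j t z)) +
    zeta%:C * vlim j.+1 t z = g (vlim j.+2) (slim j) (vlim j.+1) 0.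
  by rewrite /g !mulr0 !addr0.
apply: (@is_cderive_uniform_limit _ _ _
  (fun n h => synth j (apx n) (t + tau * h) (z + zeta * h))
  (fun n => g (synth j.+2 (apx n)) (synth j (source (iterate n))) (synth j.+1 (apx n)))
  (fun n => C / 2 ^+ n) r r0).
- by move=> n h _; have [_ _ _ hs _] := iterateP n; exact: hs.
- move=> n h /hr /vlimP hv; rewrite (le_trans (hv _ _ _))//.
  rewrite ler_wpM2r ?(ltW (pw n))// /C -addrA lerDl.
  apply: addr_ge0; apply: mulr_ge0; rewrite ?normc_ge0 ?rate0//.
  by apply: addr_ge0; rewrite ?rate0//; apply: mulr_ge0; rewrite ?normc_ge0 ?rate0.
- move=> n h /hr hT; rewrite /g.
  set v2 := vlim j.+2 _ _; set v1 := vlim j.+1 _ _; set s0 := slim j _ _.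
  set w2 := synth j.+2 _ _ _; set w1 := synth j.+1 _ _ _; set u0 := synth j _ _ _.
  have -> : tau%:C * (ii * ((nu / 2)%:C * v2 - s0)) + zeta%:C * v1 -
     (tau%:C * (ii * ((nu / 2)%:C * w2 - u0)) + zeta%:C * w1) =
     tau%:C * (ii * ((nu / 2)%:C * (v2 - w2) - (s0 - u0))) + zeta%:C * (v1 - w1).
    by ring.
  rewrite (le_trans (normcD_le _ _))// !normcEM normc_ii mul1r.
  have h1 := vlimP j.+2 (z + zeta * h) n hT; have h2 := vlimP j.+1 (z + zeta * h) n hT.
  have h3 := slimP j (z + zeta * h) n hT.
  have h4 : normc ((nu / 2)%:C * (v2 - w2) - (s0 - u0)) <=
      normc (nu / 2)%:C * (4 * rate j.+2 / 2 ^+ n) + 4 * rate j / 2 ^+ n.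
    rewrite (le_trans (normcB_le _ _))// normcEM lerD// ler_wpM2l ?normc_ge0//.
  have h5 := ler_wpM2l (normc_ge0 tau%:C) h4.
  have h6 := ler_wpM2l (normc_ge0 zeta%:C) h2.
  have h7 := mulr_ge0 (rate0 j) (ltW (pw n)).
  rewrite (le_trans (lerD h5 h6))//.
  have -> : C / 2 ^+ n = 4 * rate j / 2 ^+ n +
    (normc tau%:C * (normc (nu / 2)%:C * (4 * rate j.+2 / 2 ^+ n) +
     4 * rate j / 2 ^+ n) + normc zeta%:C * (4 * rate j.+1 / 2 ^+ n)).
    by rewrite /C; ring.
  by rewrite lerDr.
- move=> n; rewrite /g.
  have cl := fun i => line_cts t z tau zeta 0 (apx_cts i n).
  have cs := line_cts t z tau zeta 0 (source_cts j n).
  apply: ctsD; last by apply: ctsM; [exact: cts_cst|exact: (cl j.+1)].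
  apply: ctsM; first exact: cts_cst.
  apply: ctsM; first exact: cts_cst.
  apply: ctsB; last exact: cs.
  by apply: ctsM; [exact: cts_cst|exact: (cl j.+2)].
- by move=> eps /(geometric_small C)[N hN]; exists N; exact: hN.
Qed.

Lemma slim_dz j t z : `|t| <= T ->
  is_cderive (0 : R) 1 (fun h => slim j t (z + h)) (slim j.+1 t z).
Proof.
move=> tT; rewrite -{2}(addr0 z).
have rate0 i : 0 <= 4 * rate i.
  rewrite mulr_ge0// /rate !mulr_ge0 ?expR_ge0 ?exprn_ge0 ?D_ge0//.
  by rewrite addr_ge0// ltW.
have pw n : 0 <= (2 ^+ n : R)^-1 by rewrite invr_ge0 exprn_ge0.
apply: (@is_cderive_uniform_limit _ _ (fun h => slim j.+1 t (z + h))
  (fun n h => synth j (source (iterate n)) t (z + h))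
  (fun n h => synth j.+1 (source (iterate n)) t (z + h))
  (fun n => (4 * rate j + 4 * rate j.+1) / 2 ^+ n) 1 ltr01).
- by move=> n h _; exact: synth_dz.
- move=> n h _; rewrite (le_trans (slimP _ _ _ tT))//.
  by rewrite ler_wpM2r ?pw// lerDl.
- move=> n h _; rewrite (le_trans (slimP _ _ _ tT))//.
  by rewrite ler_wpM2r ?pw// lerDr.
- by move=> n; exact: is_cderive_cts (synth_dz _ _ _ _ _).
- by move=> eps /(geometric_small (4 * rate j + 4 * rate j.+1))[N hN]; exists N; exact: hN.
Qed.

Lemma vlim_cts j t z : `|t| < T ->
  cts (t, z) (fun q : R * R => vlim j q.1 q.2).
Proof.
move=> tT.
apply: (@cts_uniform_limit _ _ _ _ (fun n q => synth j (apx n) q.1 q.2)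
  (fun n => 4 * rate j / 2 ^+ n) [set q : R * R | `|q.1| <= T]).
- have ht : nbhs t [set x : R | `|x| <= T].
    have d0 : 0 < T - `|t| by rewrite subr_gt0.
    apply/nbhs_ballP; exists (T - `|t|) => //= x; rewrite /ball /= => h.
    by have := ler_normD t (- (t - x)); rewrite normrN opprB addrC subrK; lra.
  exact: (@fst_cts R R (t, z) _ ht).
- by move=> n [t' z'] /= h; exact: vlimP.
- by move=> n; exact: apx_cts.
- by move=> eps /(geometric_small (4 * rate j))[N hN]; exists N; exact: hN.
Qed.

Lemma vlim_clim j t z : `|t| <= T -> clim (fun n => synth j (apx n) t z) (vlim j t z).
Proof. by move=> tT; apply: clim_geometric => n; exact: vlimP. Qed.

(** The source of the approximation [n + 1] is the nonlinearity evaluated at the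
    approximation [n]. *)
Lemma slim_eq t z : `|t| <= T -> slim 0 t z = lam%:C * nonlin sigma (vlim 0 t z).
Proof.
move=> tT; apply: (@clim_uniq _ (fun n => synth 0 (source (iterate n.+1)) t z)).
  have h : clim (fun n => synth 0 (source (iterate n)) t z) (slim 0 t z).
    by apply: clim_geometric => n; exact: slimP.
  by move=> eps /h[N hN]; exists N => n Nn; apply: hN; rewrite ltnW.
have e : (fun n => synth 0 (source (iterate n.+1)) t z) =
    (fun n => lam%:C * nonlin sigma (synth 0 (apx n) t z)).
  by apply/funext => n; have [_ _ _ _ ->] := iterateP n.+1.
rewrite e; apply: climM; first exact: clim_cst.
have h := vlim_clim 0 z tT.
by apply: climM; apply: climX => //; exact: climJ.
Qed.

(** All the increments vanish at time 0. *)
Lemma vlim_init j z : vlim j 0 z = synth j p 0 z.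
Proof.
apply: (@clim_uniq _ (fun n => synth j (apx n) 0 z)).
  by apply: vlim_clim; rewrite normr0 ltW.
by under [X in clim X]eq_fun do rewrite apx_init; exact: clim_cst.
Qed.

Lemma vlim_approx t z : `|t| <= T ->
  normc (vlim 0 t z - synth 0 p t z) <= (5 + 4 * L) * D * expR (L * T).
Proof.
move=> tT; have h1 := vlimP 0 z 0 tT.
have h2 := synth_bound 0 z E_bounded tT.
have h3 : D * expR (L * `|t|) <= D * expR (L * T).
  by rewrite ler_wpM2l ?D_ge0// ler_expR ler_wpM2l// ltW.
have -> : vlim 0 t z - synth 0 p t z = (vlim 0 t z - synth 0 (apx 0) t z) + synth 0 E t z.
  by rewrite /apx /= synth_cat; ring.
rewrite (le_trans (normcD_le _ _))//.
by move: h1 h2; rewrite /rate !expr0 invr1 mulr1 !mul1r; lra.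
Qed.

Lemma vlim_periodic t z (m : int) : `|t| <= T ->
  vlim 0 t (z + m%:~R * (2 * pi)) = vlim 0 t z.
Proof.
move=> tT; apply: (@clim_uniq _ (fun n => synth 0 (apx n) t z)); last exact: vlim_clim.
have e : (fun n => synth 0 (apx n) t z) =
    (fun n => synth 0 (apx n) t (z + m%:~R * (2 * pi))).
  apply/funext => n; rewrite /synth; apply: eq_bigr => q _.
  by rewrite mulrDr expiD [q.1%:~R * (m%:~R * _)]mulrA -intrM expi_periodic mulr1.
by rewrite e; exact: vlim_clim.
Qed.

End Picard.

(** * Smoothness *)

Section SmoothCriterion.
Variables (R : realType) (V : normedModType R) (U : set V).
Variable F : set (V -> R[i]).
Hypothesis U_open : open U.
Hypothesis F_cts : forall f, F f -> forall x, U x -> cts x f.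
Hypothesis F_derive : forall f, F f -> forall v, exists2 g : V -> R[i], F g &
  forall x, U x -> is_cderive x v f (g x).

(** By induction on the list of directions, the iterated derivatives coincide on
    [U] with members of the family. *)
Lemma smooth_family f : F f -> smooth_on U f.
Proof.
move=> Ff.
have near_in x : U x -> \forall y \near x, U y by move=> Ux; exact: open_nbhs_nbhs.
have cds vs : exists2 g : V -> R[i], F g & forall x, U x -> cderives vs f x = g x.
  elim: vs => [|v vs [g Fg hg]]; first by exists f.
  have [g' Fg' hg'] := F_derive Fg v; exists g' => // x Ux /=.
  apply: is_cderiveE; apply: is_cderive_near (hg' x Ux).
  by apply: filterS (near_in x Ux) => y /hg ->.
move=> vs x Ux; have [g Fg hg] := cds vs.
have gx : cts x (cderives vs f).
  by apply: cts_near (F_cts Fg Ux); apply: filterS (near_in x Ux) => y /hg ->.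
split; [exact: (proj1 gx)|exact: (proj2 gx)|move=> v].
have [g' _ hg'] := F_derive Fg v.
have : is_cderive x v (cderives vs f) (g' x).
  by apply: is_cderive_near (hg' x Ux); apply: filterS (near_in x Ux) => y /hg ->.
by case=> -[d1 _] [d2 _].
Qed.

End SmoothCriterion.

Section LimitSmoothness.
Variable R : realType.
Local Notation ii := (Complex 0 1 : R[i]).
Variables (sigma : nat) (lam nu T : R) (V S : nat -> R -> R -> R[i]).
Hypothesis V_derive : forall j t z tau zeta, `|t| < T ->
  is_cderive (0 : R) 1 (fun h => V j (t + tau * h) (z + zeta * h))
    (tau%:C * (ii * ((nu / 2)%:C * V j.+2 t z - S j t z)) +
     zeta%:C * V j.+1 t z).
Hypothesis S_dz : forall j t z, `|t| < T ->
  is_cderive (0 : R) 1 (fun h => S j t (z + h)) (S j.+1 t z).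
Hypothesis V_cts : forall j t z, `|t| < T ->
  cts (t, z) (fun q : R * R => V j q.1 q.2).
Hypothesis S_eq : forall t z, `|t| < T ->
  S 0 t z = lam%:C * nonlin sigma (V 0 t z).

(** The algebra generated by the [z]-derivatives of the solution.  The equation
    exchanges one time derivative for two space derivatives and the
    nonlinearity, so that this algebra is closed under all derivatives. *)
Inductive jet : (R -> R -> R[i]) -> Prop :=
| jet_cst c : jet (fun _ _ => c)
| jet_V j : jet (V j)
| jet_add f g : jet f -> jet g -> jet (fun t z => f t z + g t z)
| jet_mul f g : jet f -> jet g -> jet (fun t z => f t z * g t z)
| jet_conj f : jet f -> jet (fun t z => conjc (f t z)).

(** Leibniz' rule reduces the claim to the generators.  The set of directions is a
    parameter because the purely spatial derivatives come first: they are used to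
    see that the sources are jets, which the time derivatives require. *)
Lemma jet_derive_gen (dirs : R -> R -> Prop) :
  (forall j tau zeta, dirs tau zeta -> exists2 g, jet g & forall t z, `|t| < T ->
    is_cderive (0 : R) 1 (fun h => V j (t + tau * h) (z + zeta * h)) (g t z)) ->
  forall f, jet f -> forall tau zeta, dirs tau zeta ->
  exists2 g, jet g & forall t z, `|t| < T ->
    is_cderive (0 : R) 1 (fun h => f (t + tau * h) (z + zeta * h)) (g t z).
Proof.
move=> HV f jf tau zeta td.
elim: jf => [c|j|{}f g jf [f' jf' hf] jg [g' jg' hg]
            |{}f g jf [f' jf' hf] jg [g' jg' hg]|{}f jf [f' jf' hf]].
- by exists (fun _ _ => 0); [exact: jet_cst|move=> t z _; exact: is_cderive_cst].
- exact: HV.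
- exists (fun t z => f' t z + g' t z); first exact: jet_add.
  by move=> t z tT; exact: is_cderiveD (hf _ _ tT) (hg _ _ tT).
- exists (fun t z => f' t z * g t z + f t z * g' t z).
    by apply: jet_add; apply: jet_mul.
  move=> t z tT; apply: is_cderive_eq (is_cderiveM (hf t z tT) (hg t z tT)) _.
  by rewrite !mulr0 !addr0.
- exists (fun t z => conjc (f' t z)); first exact: jet_conj.
  by move=> t z tT; exact: is_cderiveJ (hf _ _ tT).
Qed.

Lemma jet_exp f n : jet f -> jet (fun t z => f t z ^+ n).
Proof.
move=> jf; elim: n => [|n IH].
  by under eq_fun do under eq_fun do rewrite expr0; exact: jet_cst.
by under eq_fun do under eq_fun do rewrite exprS; exact: jet_mul.
Qed.

(** [S 0] is a polynomial in [V 0] and its conjugate, and [S j.+1] is the space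
    derivative of [S j]. *)
Lemma jet_S j : exists2 g, jet g & forall t z, `|t| < T -> S j t z = g t z.
Proof.
elim: j => [|j [g jg hg]].
  exists (fun t z => lam%:C * nonlin sigma (V 0 t z)); last exact: S_eq.
  apply: jet_mul; first exact: jet_cst.
  apply: jet_mul; apply: jet_exp; first exact: jet_V.
  by apply: jet_conj; exact: jet_V.
have [i tau zeta [-> ->]||g' jg' hg'] := @jet_derive_gen
    (fun tau zeta => tau = 0 /\ zeta = 1) _ g jg 0 1 _; [|by []|].
  exists (V i.+1); first exact: jet_V.
  move=> t z tT; apply: is_cderive_eq (V_derive i z 0 1 tT) _.
  by rewrite mul0r add0r mul1r.
exists g' => // t z tT; apply: is_cderive_uniq (S_dz j z tT) _.
apply: is_cderive_ext (hg' t z tT) => h.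
by rewrite mul0r mul1r addr0 hg.
Qed.

Lemma jet_derive f tau zeta : jet f -> exists2 g, jet g &
  forall t z, `|t| < T ->
    is_cderive (0 : R) 1 (fun h => f (t + tau * h) (z + zeta * h)) (g t z).
Proof.
move=> jf; apply: (@jet_derive_gen (fun _ _ => True)) => // j {}tau {}zeta _.
have [g jg hg] := jet_S j.
exists (fun t z => tau%:C * (ii * ((nu / 2)%:C * V j.+2 t z + -1 * g t z)) +
     zeta%:C * V j.+1 t z).
  apply: jet_add; last by apply: jet_mul; [exact: jet_cst|exact: jet_V].
  apply: jet_mul; first exact: jet_cst.
  apply: jet_mul; first exact: jet_cst.
  apply: jet_add; first by apply: jet_mul; [exact: jet_cst|exact: jet_V].
  by apply: jet_mul => //; exact: jet_cst.
by move=> t z tT; rewrite mulN1r -hg//; exact: V_derive.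
Qed.

Lemma jet_cts f t z : jet f -> `|t| < T -> cts (t, z) (fun q : R * R => f q.1 q.2).
Proof.
move=> + tT; elim=> [c|j|{}f g _ hf _ hg|{}f g _ hf _ hg|{}f _ hf].
- exact: cts_cst.
- exact: V_cts.
- exact: ctsD.
- exact: ctsM.
- exact: ctsJ.
Qed.

Section Lift.
Variables (d : nat) (N : R).
Hypothesis nuE : nu = N ^+ 2.
Local Notation J := [set t : R | `|t| < T].

Lemma J_itv : J = [set` `]- T, T[].
Proof. by apply/seteqP; split => x /=; rewrite in_itv/= ltr_norml. Qed.

Lemma J_open : open J.
Proof. by rewrite J_itv; exact: itv_open. Qed.

(** A function of [z] becomes a function on the torus through [z = N x_1]. *)
Definition lift_jet (f : R -> R -> R[i]) (p : R * 'rV[R]_d.+1) : R[i] :=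
  f p.1 (N * p.2 0 0).

Lemma coord_cts (x : 'rV[R]_d.+1) : {for x, continuous (fun y : 'rV[R]_d.+1 => y 0 0)}.
Proof. exact: coord_continuous. Qed.

Lemma lift_jet_line f p v : (fun h : R => lift_jet f (p + h *: v)) =
  (fun h => f (p.1 + v.1 * h) (N * p.2 0 0 + N * v.2 0 0 * h)).
Proof.
apply/funext => h; rewrite /lift_jet /= !mxE mulrDr [v.1 * h]mulrC; congr f.
by rewrite mulrCA [RHS]addrC [LHS]addrC; congr (_ + _); ring.
Qed.

Lemma lift_jet_smooth f : jet f ->
  smooth_on (J `*` [set: 'rV[R]_d.+1]) (lift_jet f).
Proof.
move=> jf.
apply: (@smooth_family _ _ _ [set g | exists2 a, jet a & g = lift_jet a]);
  last by exists f.
- have -> : J `*` [set: 'rV[R]_d.+1] = fst @^-1` J by apply/seteqP; split=> -[? ?] //= [].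
  apply: open_comp => //; first by move=> p _; exact: fst_cts.
  exact: J_open.
- move=> _ [a ja ->] [t x] [/= tT _].
  have h1 : {for (t, x), continuous
      (fun p : R * 'rV[R]_d.+1 => (p.1, N * p.2 0 0))}.
    have h0 : {for (t, x), continuous (fun p : R * 'rV[R]_d.+1 => p.2 0 0)}.
      exact: (continuous_comp (@snd_cts _ _ (t, x)) (@coord_cts _)).
    have h2 : {for (t, x), continuous (fun p : R * 'rV[R]_d.+1 => N * p.2 0 0)}.
      exact: (cvgM (cvg_cst N) h0).
    exact: (cvg_pair (@fst_cts _ _ (t, x)) h2).
  exact: (cts_comp h1 (jet_cts _ ja tT)).
- move=> _ [a ja ->] v.
  have [g jg hg] := jet_derive v.1 (N * v.2 0 0) ja.
  exists (lift_jet g); first by exists g.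
  move=> [t x] [/= tT _]; apply/is_cderive_line; rewrite lift_jet_line /=.
  exact: hg.
Qed.

Hypothesis V_periodic : forall t z (m : int), `|t| < T ->
  V 0 t (z + m%:~R * (2 * pi)) = V 0 t z.
Hypothesis N_int : exists m : int, N = m%:~R.
Hypothesis T0 : 0 < T.

Lemma lift_solution :
  nls_solution sigma lam J (fun t (x : 'rV[R]_d.+1) => V 0 t (N * x 0 0)).
Proof.
split.
- by rewrite J_itv; exact: interval_is_interval.
- exact: J_open.
- by rewrite /= normr0.
- by apply: lift_jet_smooth; exact: jet_V.
- move=> t tT x j; have [m ->] := N_int; rewrite !mxE /= mulrDr.
  case: (0 == j); last by rewrite mulr0 mulr0 addr0.
  by rewrite mulr1 V_periodic.
- move=> t x tT.
  have dx j (y : 'rV[R]_d.+1) i : is_cderive y (delta_mx 0 i)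
      (fun x : 'rV[R]_d.+1 => V j t (N * x 0 0)) ((N * (0 == i)%:R)%:C * V j.+1 t (N * y 0 0)).
    apply/is_cderive_line.
    have := V_derive j (N * y 0 0) 0 (N * (0 == i)%:R) tT.
    rewrite mul0r add0r; apply: is_cderive_ext => h.
    by rewrite mul0r addr0 !mxE eqxx /=; congr (V j t _); ring.
  have lap : laplacian (fun x => V 0 t (N * x 0 0)) x = (N ^+ 2)%:C * V 2 t (N * x 0 0).
    rewrite /laplacian (bigD1 0)//= big1 ?addr0.
      have -> : cderive (delta_mx 0 0) (fun x : 'rV[R]_d.+1 => V 0 t (N * x 0 0)) =
          (fun x : 'rV[R]_d.+1 => N%:C * V 1 t (N * x 0 0)).
        by apply/funext => y; rewrite (is_cderiveE (dx 0 y 0)) eqxx mulr1.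
      rewrite (is_cderiveE (is_cderiveZ N%:C (dx 1 x 0))) eqxx mulr1 mulrA.
      by rewrite -rmorphM.
    move=> i i0.
    have -> : cderive (delta_mx 0 i) (fun x : 'rV[R]_d.+1 => V 0 t (N * x 0 0)) =
          (fun=> 0).
      apply/funext => y; rewrite (is_cderiveE (dx 0 y i)).
      by rewrite eq_sym (negbTE i0) mulr0 mul0r.
    exact: is_cderiveE (is_cderive_cst _ _ _).
  rewrite lap.
  have -> : cderive (1 : R^o) (fun t => V 0 t (N * x 0 0)) t =
      ii * ((nu / 2)%:C * V 2 t (N * x 0 0) - S 0 t (N * x 0 0)).
    apply: is_cderiveE; apply/is_cderive_line.
    have := V_derive 0 (N * x 0 0) 1 0 tT.
    rewrite mul0r addr0 mul1r; apply: is_cderive_ext => h.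
    by rewrite mul0r addr0 mul1r /GRing.scale /= mulr1.
  rewrite S_eq// nonlinE nuE.
  have iiE z : 'i * (ii * z) = - z :> R[i].
    by rewrite mulrA -[X in X = _]/(ii * ii * z) mul_ii mulN1r.
  rewrite iiE.
  have -> : (N ^+ 2 / 2)%:C = (2^-1)%:C * (N ^+ 2)%:C :> R[i].
    by rewrite mulrC rmorphM.
  ring.
Qed.

End Lift.
End LimitSmoothness.

(** * Two interacting modes *)

Section TwoModes.
Variable R : realType.
Local Notation ii := (Complex 0 1 : R[i]).

Lemma bounded_map (I : eqType) (T : R) (s : seq I) (k : I -> int)
    (a : I -> R -> R[i]) (m : I -> R) :
  (forall i, i \in s -> forall t, cts t (a i)) ->
  (forall i, i \in s -> forall t, normc (a i t) <= m i) ->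
  bounded 0 T [seq (k i, a i) | i <- s] (\sum_(i <- s) weight R (k i) * m i).
Proof.
elim: s => [|i s IH] h1 h2; first by rewrite big_nil /=.
rewrite big_cons map_cons; exists (m i); split => /=.
- by apply: h1; rewrite mem_head.
- by move=> t _; rewrite mul0r expR0 mulr1 h2// mem_head.
- rewrite addrC addKr; apply: IH => j js; [apply: h1|apply: h2];
    by rewrite in_cons js orbT.
Qed.

Lemma solves_map (I : eqType) (nu : R) (s : seq I) (k : I -> int)
    (A a : I -> R -> R[i]) :
  (forall i, i \in s -> forall t : R, is_cderive t 1 (A i)
     (- ii * ((nu / 2 * (k i)%:~R ^+ 2)%:C * A i t + a i t))) ->
  solves nu [seq (k i, A i) | i <- s] [seq (k i, a i) | i <- s].
Proof.
elim: s => [|i s IH] h.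
  move=> j t z tau zeta y; rewrite !synth_nil.
  apply: is_cderive_ext (is_cderive_eq (is_cderive_cst _ _ 0) _).
    by move=> ?; rewrite synth_nil.
  by ring.
rewrite !map_cons.
apply: (@solves_cat _ _ [:: _] _ [:: _]).
  by apply: solves1; apply: h; rewrite mem_head.
by apply: IH => j js; apply: h; rewrite in_cons js orbT.
Qed.

Lemma synth_map (I : eqType) (s : seq I) (k : I -> int) (A : I -> R -> R[i]) t z :
  synth 0 [seq (k i, A i) | i <- s] t z = \sum_(i <- s) A i t * expi ((k i)%:~R * z).
Proof.
by rewrite /synth big_map; apply: eq_bigr => i _; rewrite expr0 mul1r.
Qed.

(** Up to the sign [lam], the speed at which the interaction rotates the mean, as
    a function of the squared moduli [A] and [B] of the modes 0 and 1. *)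
Definition shift_poly (sigma : nat) (A B : R) : R := \sum_(0 <= i < sigma.+1)
  ('C(sigma.+1, i) * 'C(sigma, i))%:R * A ^+ (sigma - i) * B ^+ i.

Variables (sigma : nat) (lam : R) (a0 : R[i]) (a1 : R).

Definition freq_shift0 : R := lam * shift_poly sigma (normc a0 ^+ 2) (a1 ^+ 2).
Definition freq_shift1 : R := lam * \sum_(0 <= i < sigma.+1)
  ('C(sigma.+1, i.+1) * 'C(sigma, i))%:R * (normc a0 ^+ 2) ^+ (sigma - i) * (a1 ^+ 2) ^+ i.

(** The coefficient of the term with [i] factors from the mode 1 and [j] factors
    from its conjugate in the binomial expansion of the nonlinearity; the frequency
    of that term is [i - j]. *)
Definition coef (i j : nat) : R[i] :=
  (lam * ('C(sigma.+1, i) * 'C(sigma, j))%:R)%:C * a0 ^+ (sigma.+1 - i) *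
  conjc a0 ^+ (sigma - j) * (a1 ^+ (i + j))%:C.

Variable nu : R.

(** The time frequency of a product of modes and conjugate modes of total degree 1
    and of frequency [k]. *)
Definition mode_freq (k : int) : R :=
  freq_shift0 * (1 - k%:~R) + (freq_shift1 + nu / 2) * k%:~R.

Definition mode (k : bool) (t : R) : R[i] :=
  (if k then a1%:C else a0) * expi (- mode_freq k * t).

Definition diffz (q : nat * nat) : int := q.1%:Z - q.2%:Z.

(** The terms that do not force the modes 0 and 1 themselves. *)
Definition nonres : seq (nat * nat) :=
  [seq q <- [seq (i, j) | j <- iota 0 sigma.+1, i <- iota 0 sigma.+2] |
     (q.1 != q.2) && (q.1 != q.2.+1)].

Lemma sum_nonres (F : nat -> nat -> R[i]) :
  \sum_(0 <= j < sigma.+1) \sum_(0 <= i < sigma.+2) F i j =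
  \sum_(0 <= j < sigma.+1) F j j + \sum_(0 <= j < sigma.+1) F j.+1 j +
  \sum_(q <- nonres) F q.1 q.2.
Proof.
have -> : \sum_(q <- nonres) F q.1 q.2 =
    \sum_(0 <= j < sigma.+1) \sum_(0 <= i < sigma.+2)
      if (i != j) && (i != j.+1) then F i j else 0.
  by rewrite /nonres big_filter big_mkcond big_allpairs_dep /index_iota !subn0.
rewrite -!big_split /=; apply: eq_big_nat => j /andP[_ hj].
have pick (G : nat -> R[i]) m : (m < sigma.+2)%N ->
    \sum_(0 <= i < sigma.+2) (if i == m then G i else 0) = G m.
  move=> hm; rewrite (bigD1_seq m) ?iota_uniq ?mem_index_iota//= eqxx.
  by rewrite big1 ?addr0// => i /negbTE ->.
rewrite -(pick (F^~ j) j (leqW hj)) -(pick (F^~ j) j.+1 hj) -!big_split /=.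
apply: eq_bigr => i _.
have [->|ij] := eqVneq i j; first by rewrite (ltn_eqF (ltnSn j)) !addr0.
by have [->|ij1] := eqVneq i j.+1; rewrite ?addr0 ?add0r.
Qed.

Lemma conj_real (x : R) : conjc x%:C = x%:C.
Proof. by apply: eq_ReIm; rewrite ?cReJ ?cImJ /= ?oppr0. Qed.

Lemma expr_expi (x : R) n : expi x ^+ n = expi (n%:R * x).
Proof. by rewrite mulr_natl expiX. Qed.

(** All the terms with the same [i - j] rotate with the same speed, because
    [mode_freq] is affine in [k] and the nonlinearity has one more factor [v] than
    factors [conjc v]. *)
Lemma nonlin_modes t z :
  lam%:C * nonlin sigma (mode false t + mode true t * expi z) =
  \sum_(0 <= j < sigma.+1) \sum_(0 <= i < sigma.+2)
     coef i j * expi (- mode_freq (diffz (i, j)) * t) * expi ((diffz (i, j))%:~R * z).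
Proof.
rewrite big_mkord; under eq_bigr do rewrite big_mkord.
have -> : mode false t = a0 * expi (- mode_freq 0 * t) by [].
have -> : mode true t = a1%:C * expi (- mode_freq 1 * t) by [].
rewrite /nonlin conjD !conjM -!expiN conj_real !exprDn [RHS]exchange_big.
rewrite big_distrlr mulr_sumr.
apply: eq_bigr => i _; rewrite mulr_sumr; apply: eq_bigr => j _.
rewrite !exprMn !expr_expi.
rewrite -[_ *+ 'C(sigma.+1, i)]mulr_natr -[_ *+ 'C(sigma, j)]mulr_natr.
have hi : (i <= sigma.+1)%N by rewrite -ltnS.
have hj : (j <= sigma)%N by rewrite -ltnS.
set x0 := expi ((sigma.+1 - i)%:R * _); set x1 := expi (i%:R * _).
set x2 := expi (i%:R * _); set x3 := expi ((sigma - j)%:R * _).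
set x4 := expi (j%:R * _); set x5 := expi (j%:R * _).
set y1 := expi _; set y2 := expi _.
have e : x0 * x1 * x2 * x3 * x4 * x5 = y1 * y2.
  rewrite /x0 /x1 /x2 /x3 /x4 /x5 /y1 /y2 -!expiD; congr expi.
  rewrite !natrB//= /mode_freq /diffz rmorphB /= -!pmulrn.
  rewrite -natr1; ring.
rewrite /coef realCM realC_nat natrM realCX exprD.
set A := a0 ^+ _; set B := conjc a0 ^+ _; set C := _ ^+ i; set C' := _ ^+ j.
set b := _%:R; set b' := 'C(sigma, j)%:R; set l := lam%:C.
have -> : l * (A * x0 * (C * x1 * x2) * b * (B * x3 * (C' * x4 * x5) * b')) =
  l * b * b' * A * B * (C * C') * (x0 * x1 * x2 * x3 * x4 * x5) by ring.
by rewrite e; ring.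
Qed.

Lemma sum_diag : \sum_(0 <= j < sigma.+1) coef j j = freq_shift0%:C * a0.
Proof.
rewrite /freq_shift0 /shift_poly realCM realC_sum mulrAC mulr_sumr; apply: eq_big_nat => j /andP[_ hj].
rewrite /coef addnn -mul2n exprM !realCM realC_nat natrM [((normc _ ^+ 2) ^+ _)%:C]realCX normc_sqC.
rewrite subSn// exprS [(a0 * _) ^+ _]exprMn.
set A := a0 ^+ _; set B := conjc a0 ^+ _; set C := (_ ^+ j)%:C; ring.
Qed.

Lemma sum_offdiag : \sum_(0 <= j < sigma.+1) coef j.+1 j = freq_shift1%:C * a1%:C.
Proof.
rewrite /freq_shift1 realCM realC_sum mulrAC mulr_sumr; apply: eq_big_nat => j /andP[_ hj].
rewrite /coef subSS addSn addnn -mul2n exprS exprM !realCM realC_nat natrM [((normc _ ^+ 2) ^+ _)%:C]realCX normc_sqC.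
rewrite [(a0 * _) ^+ _]exprMn.
set A := a0 ^+ _; set B := conjc a0 ^+ _; set C := (_ ^+ j)%:C; ring.
Qed.

Definition ptrig : trig R := [:: (0, mode false); (1, mode true)].

Definition psrc : trig R := [:: (0, fun t => freq_shift0%:C * mode false t);
                                (1, fun t => freq_shift1%:C * mode true t)].

Definition qsrc : trig R := [seq (diffz q, fun t : R =>
  coef q.1 q.2 * expi (- mode_freq (diffz q) * t)) | q <- nonres].

Definition free_freq (k : int) : R := nu / 2 * k%:~R ^+ 2.

(** The frequency at which the nonlinearity forces a mode, relative to its own
    frequency.  For the modes 0 and 1 only the frequency shifts are left. *)
Definition detuning (k : int) : R := mode_freq k - free_freq k.

(** The response to the nonresonant terms, with zero initial datum. *)
Definition etrig : trig R := [seq (diffz q, fun t : R =>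
  coef q.1 q.2 * (detuning (diffz q))^-1%:C *
  (expi (- mode_freq (diffz q) * t) - expi (- free_freq (diffz q) * t)))
  | q <- nonres].

Lemma diff0 j : diffz (j, j) = 0.
Proof. by rewrite /diffz subrr. Qed.

Lemma diff1 j : diffz (j.+1, j) = 1.
Proof. by rewrite /diffz /=; lia. Qed.

Lemma source_eq t z : synth 0 (psrc ++ qsrc) t z =
  lam%:C * nonlin sigma (synth 0 ptrig t z).
Proof.
have -> : synth 0 ptrig t z = mode false t + mode true t * expi z.
  by rewrite !synth_cons synth_nil !expr0 !mul1r addr0 /= mulr0z mul0r expi0 mulr1.
rewrite nonlin_modes.
rewrite (sum_nonres (fun i j => coef i j * expi (- mode_freq (diffz (i, j)) * t) *
  expi ((diffz (i, j))%:~R * z))) synth_cat; congr (_ + _); last first.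
  by rewrite synth_map; apply: eq_bigr => -[i j].
rewrite !synth_cons synth_nil !expr0 !mul1r addr0; congr (_ + _).
  under eq_bigr => j _ do rewrite diff0 mulr0z mul0r expi0 mulr1.
  rewrite -mulr_suml sum_diag mulr0z mul0r expi0 mulr1.
  by rewrite -mulrA.
under eq_bigr => j _ do rewrite diff1 -mulrA.
rewrite -mulr_suml sum_offdiag.
rewrite -[LHS]/(freq_shift1%:C * (a1%:C * expi (- mode_freq 1 * t)) * expi z) mulr1z mul1r.
by rewrite !mulrA.
Qed.

Hypothesis nonres_detuned : forall q, q \in nonres -> detuning (diffz q) != 0.

Lemma mode_solves (b : bool) (t : R) : is_cderive t 1 (mode b)
  (- ii * ((nu / 2 * ((b : int)%:~R : R) ^+ 2)%:C * mode b t +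
           (if b then freq_shift1 else freq_shift0)%:C * mode b t)).
Proof.
apply: is_cderive_eq; first by apply: is_cderiveZ; exact: is_cderive_expi.
have -> : (- mode_freq b)%:C = - ((nu / 2 * ((b : int)%:~R : R) ^+ 2)%:C +
    (if b then freq_shift1 else freq_shift0)%:C) :> R[i].
  rewrite -realCD -realCN; congr (_%:C); rewrite /mode_freq.
  by case: b => /=; rewrite ?mulr1z ?mulr0z; ring.
rewrite /mode; set c := if b then a1%:C else a0; set e := expi _; ring.
Qed.

Lemma source_solves : solves nu (ptrig ++ etrig) (psrc ++ qsrc).
Proof.
apply: solves_cat.
  apply: (@solves_cat _ _ [:: _] [:: _] [:: _] [:: _]); apply: solves1 => t.
  - exact: mode_solves false t.
  - exact: mode_solves true t.
apply: solves_map => q hq t.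
apply: is_cderive_eq.
  apply: is_cderiveZ.
  apply: (is_cderiveD (is_cderive_expi _ _)).
  by apply: is_cderive_ext (is_cderiveZ (-1) (is_cderive_expi _ t)) => y; rewrite mulN1r.
rewrite -/(free_freq _); set f := free_freq _; set m := mode_freq _.
have d0 : m%:C - f%:C != 0 :> R[i].
  by rewrite -realCN -realCD realC_eq0; exact: nonres_detuned.
have -> : (detuning (diffz q))^-1%:C = (m%:C - f%:C)^-1 :> R[i].
  by rewrite /detuning realCV realCD realCN.
rewrite !realCN.
set x := expi _; set y := expi _.
by field.
Qed.

Lemma etrig_init j z : synth j etrig 0 z = 0.
Proof.
rewrite /synth big_map big1// => q _ /=.
by rewrite !mulr0 subrr mulr0 mulr0 mul0r.
Qed.

Lemma mode_cts b t : cts t (mode b).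
Proof. exact: is_cderive_cts (mode_solves b t). Qed.

Lemma normc_mode b t : normc (mode b t) = if b then `|a1| else normc a0.
Proof. by case: b; rewrite /mode normcEM normc_expi mulr1 ?normc_real. Qed.

Lemma weight0 : weight R 0 = 1.
Proof. by rewrite /weight mulr0z normr0 expR0. Qed.

Lemma ptrig_bounded T : bounded 0 T ptrig (normc a0 + weight R 1 * `|a1|).
Proof.
exists (normc a0); split; first by move=> t; exact: mode_cts.
  by move=> t _; rewrite mul0r expR0 mulr1 (normc_mode false).
exists `|a1|; split; first by move=> t; exact: mode_cts.
  by move=> t _; rewrite mul0r expR0 mulr1 (normc_mode true).
by rewrite /= weight0 mul1r; lra.
Qed.

Lemma psrc_bounded T : exists M, bounded 0 T psrc M.
Proof.
pose m0 := normc freq_shift0%:C * normc a0; pose m1 := normc freq_shift1%:C * `|a1|.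
exists (m0 + weight R 1 * m1).
exists m0; split; first by move=> t; apply: ctsM; [exact: cts_cst|exact: mode_cts].
  by move=> t _; rewrite mul0r expR0 mulr1 normcEM (normc_mode false).
exists m1; split; first by move=> t; apply: ctsM; [exact: cts_cst|exact: mode_cts].
  by move=> t _; rewrite mul0r expR0 mulr1 normcEM (normc_mode true).
by rewrite /= weight0 mul1r; lra.
Qed.

Lemma qsrc_bounded T : exists M, bounded 0 T qsrc M.
Proof.
eexists; apply: (@bounded_map _ _ _ _ _ (fun q => normc (coef q.1 q.2))).
  move=> q _ t; apply: ctsM; first exact: cts_cst.
  exact: is_cderive_cts (is_cderive_expi _ _).
by move=> q _ t; rewrite normcEM normc_expi mulr1.
Qed.

Definition esize : R := \sum_(q <- nonres) weight R (diffz q) * normc (coef q.1 q.2).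

Lemma etrig_bounded T c : 0 < c ->
  (forall q, q \in nonres -> c <= `|detuning (diffz q)|) ->
  bounded 0 T etrig (2 / c * esize).
Proof.
move=> c0 hc.
apply: (@bounded_le _ _ _ _ (\sum_(q <- nonres) weight R (diffz q) *
  (normc (coef q.1 q.2) * c^-1 * 2))).
  rewrite /esize mulr_sumr; rewrite le_eqVlt; apply/orP; left; apply/eqP.
  by apply: eq_bigr => q _; ring.
apply: bounded_map => q hq t.
  apply: ctsM; first exact: cts_cst.
  apply: ctsB; exact: is_cderive_cts (is_cderive_expi _ _).
rewrite /= normcEM (normcEM (coef _ _)) normc_real normfV.
apply: ler_pM; rewrite ?mulr_ge0 ?normc_ge0 ?invr_ge0//.
  by rewrite ler_wpM2l ?normc_ge0// lef_pV2 ?posrE ?hc// (lt_le_trans c0)// hc.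
by rewrite (le_trans (normcB_le _ _))// !normc_expi.
Qed.

(** The integers [k] other than 0 and 1 satisfy [k (k - 1) / 2 >= 1], so that [nu]
    dominates the frequency shifts. *)
Lemma detuning_ge : (`|freq_shift0| + `|freq_shift1|) * (sigma.+3)%:R <= nu / 2 ->
  forall q, q \in nonres -> nu / 2 <= `|detuning (diffz q)|.
Proof.
move=> hnu q; rewrite mem_filter => /andP[/andP[q1 q2]].
move=> /allpairsPdep[j [i [hj hi e]]]; rewrite e /= in q1 q2 *.
rewrite mem_iota in hj; rewrite mem_iota in hi.
have nu0 : 0 <= nu / 2.
  by rewrite (le_trans _ hnu)// mulr_ge0// addr_ge0.
pose k : int := diffz (i, j); rewrite -/k.
have kk : 2 <= k * (k - 1).
  by rewrite /k /diffz /=; nia.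
have k1 : `|k| <= sigma.+1%:Z by rewrite /k /diffz /=; lia.
have k2 : `|1 - k| <= sigma.+2%:Z by rewrite /k /diffz /=; lia.
have h1 : `|(k%:~R : R)| <= sigma.+1%:R by rewrite -intr_norm -[leRHS]/(sigma.+1%:Z%:~R) ler_int.
have h2 : `|1 - (k%:~R : R)| <= sigma.+2%:R.
  by rewrite -[1]/(1%:~R) -intrB -intr_norm -[leRHS]/(sigma.+2%:Z%:~R) ler_int.
have kk' : 2 <= (k%:~R : R) * (k%:~R - 1).
  by rewrite -[X in _ - X]/(1%:~R) -intrB -intrM -[leLHS]/(2%:~R) ler_int.
have -> : detuning k = (freq_shift0 * (1 - k%:~R) + freq_shift1 * k%:~R) -
    nu / 2 * (k%:~R * (k%:~R - 1)) by rewrite /detuning /mode_freq /free_freq; ring.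
have h3 : `|freq_shift0 * (1 - k%:~R) + freq_shift1 * k%:~R| <= nu / 2.
  rewrite (le_trans (ler_normD _ _))// (le_trans _ hnu)//.
  rewrite (normrM freq_shift0) (normrM freq_shift1) mulrDl; apply: lerD; apply: ler_pM => //.
    by rewrite (le_trans h2)// ler_nat.
  by rewrite (le_trans h1)// ler_nat; lia.
have h4 : nu / 2 * 2 <= nu / 2 * (k%:~R * (k%:~R - 1)) by rewrite ler_wpM2l.
move: h3; rewrite ler_norml => /andP[h3 h3'].
by rewrite -normrN (le_trans _ (ler_norm _))//; lra.
Qed.

End TwoModes.

Section TwoModeSolution.
Variable R : realType.

Lemma V_line_cts (V : R -> R -> R[i]) t (z : R) :
  cts (t, z) (fun q : R * R => V q.1 q.2) -> cts z (V t).
Proof.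
move=> h.
have g : {for z, continuous (fun z : R => (t, z))}.
  exact: (cvg_pair (cvg_cst t) cvg_id).
exact: (cts_comp g h).
Qed.

(** The corrector [etrig] is of size [O(1 / nu)], and all the other constants of the
    iteration are independent of [nu].  For [N] large there is therefore room for
    the iteration on the given time interval, and the solution stays within [eta] of
    the two modes. *)
Theorem two_mode_solution (d sigma : nat) (lam : R) (a0 : R[i]) (a1 T eta : R) :
  `|lam| = 1 -> 0 < T -> 0 < eta ->
  exists N0 : nat, forall N : nat, (N0 <= N)%N ->
  exists (V : R -> R -> R[i]) (c : R -> R[i]),
    [/\ nls_solution sigma lam [set t | `|t| < T]
          (fun t (x : 'rV[R]_d.+1) => V t (N%:R * x 0 0)),
        forall z, V 0 z = a0 + a1%:C * expi z,
        forall t z, `|t| < T -> cts z (V t) &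
        forall t z, `|t| < T -> normc (V t z -
          (a0 * expi (- freq_shift0 sigma lam a0 a1 * t) + c t * expi z)) <= eta].
Proof.
move=> lam1 T0 eta0.
pose M0 := normc a0 + weight R 1 * `|a1|.
pose M := M0 + 1.
have M00 : 0 <= M0 by rewrite addr_ge0 ?normc_ge0// mulr_ge0// ltW// weight_gt0.
have M1 : 1 <= M by rewrite lerDr.
pose L : R := 2 * ((2 * sigma + 1)%:R * M ^+ (2 * sigma + 1)).
have L0 : 0 < L.
  by rewrite !mulr_gt0 ?exprn_gt0 ?ltr0n ?addn1// (lt_le_trans ltr01).
pose C1 := 4 * esize sigma lam a0 a1.
have C10 : 0 <= C1.
  rewrite mulr_ge0// sumr_ge0// => q _.
  by rewrite mulr_ge0 ?normc_ge0// ltW// weight_gt0.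
pose S := 2 * ((`|freq_shift0 sigma lam a0 a1| + `|freq_shift1 sigma lam a0 a1|) * sigma.+3%:R).
have S0 : 0 <= S by rewrite !mulr_ge0// addr_ge0.
pose X := expR (L * T) * C1.
have X0 : 0 <= X by rewrite mulr_ge0 ?expR_ge0.
(* Each summand takes care of one smallness condition: [2 X] of [room], the next
   one of the distance [eta], and [S] of the nonresonance. *)
pose K := 1 + 2 * X + (5 + 4 * L) * X / eta + S.
have Y0 : 0 <= (5 + 4 * L) * X / eta.
  by rewrite divr_ge0 ?(ltW eta0)// mulr_ge0// addr_ge0// mulr_ge0// ltW.
have K0 : 0 <= K by rewrite /K; lra.
exists (Num.bound K) => N hN.
have NK : K <= N%:R.
  by rewrite (le_trans (ltW (archi_boundP K0)))// ler_nat.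
pose nu : R := N%:R ^+ 2.
have N1 : 1 <= (N%:R : R) by rewrite (le_trans _ NK)// /K; lra.
have nuK : K <= nu by rewrite (le_trans NK)// /nu expr2 ler_peMl// (le_trans ler01).
have nu0 : 0 < nu by rewrite (lt_le_trans _ nuK)// /K; lra.
have det : forall q, q \in nonres sigma ->
    nu / 2 <= `|detuning sigma lam a0 a1 nu (diffz q)|.
  apply: detuning_ge; rewrite ler_pdivlMr// (le_trans _ nuK)//.
  by move: X0 Y0; rewrite /K /S; lra.
have det0 q : q \in nonres sigma -> detuning sigma lam a0 a1 nu (diffz q) != 0.
  by move=> /det; apply: contraTneq => ->; rewrite normr0 -ltNge divr_gt0.
pose p := ptrig sigma lam a0 a1 nu; pose E := etrig sigma lam a0 a1 nu.
pose src := psrc sigma lam a0 a1 nu ++ qsrc sigma lam a0 a1 nu.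
pose D := C1 / nu.
have E_bd : bounded L T E D.
  apply: (bounded_strengthen (ltW T0) (ltW L0)).
  apply: bounded_le (etrig_bounded _ (divr_gt0 nu0 (ltr0n _ 2)) det).
  rewrite /D /C1 le_eqVlt; apply/orP; left; apply/eqP; field.
  by rewrite gt_eqF.
have [Ms1 hMs1] := psrc_bounded sigma lam a0 a1 nu T.
have [Ms2 hMs2] := qsrc_bounded sigma lam a0 a1 nu T.
have src_bd : bounded L T src (Ms1 + Ms2).
  exact: (bounded_strengthen (ltW T0) (ltW L0) (bounded_cat hMs1 hMs2)).
have lamc : normc lam%:C = 1 by rewrite normc_real.
have room : M0 + 2 * (expR (L * T) * D) <= M.
  rewrite lerD2l /D.
  have -> : 2 * (expR (L * T) * (C1 / nu)) = 2 * X / nu by rewrite /X; ring.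
  rewrite ler_pdivrMr// mul1r (le_trans _ nuK)//.
  by move: X0 Y0 S0; rewrite /K; lra.
have small : (5 + 4 * L) * D * expR (L * T) <= eta.
  have -> : (5 + 4 * L) * D * expR (L * T) = (5 + 4 * L) * X / nu.
    by rewrite /D /X; ring.
  rewrite ler_pdivrMr// [leRHS]mulrC -ler_pdivrMr// (le_trans _ nuK)//.
  by move: X0 Y0 S0; rewrite /K; lra.
pose V := vlim sigma lam nu T L D p E src.
have pE := source_solves det0.
have src_eq := @source_eq R sigma lam a0 a1 nu.
have p_bd := ptrig_bounded sigma lam a0 a1 nu T.
have E0 := @etrig_init R sigma lam a0 a1 nu.
have Lge : 2 * ((2 * sigma + 1)%:R * M ^+ (2 * sigma + 1)) <= L by [].
have modes t z : synth 0 p t z = a0 * expi (- freq_shift0 sigma lam a0 a1 * t) +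
    a1%:C * expi (- mode_freq sigma lam a0 a1 nu 1 * t) * expi z.
  rewrite !synth_cons synth_nil !expr0 !mul1r addr0 /= mulr0z mul0r expi0 mulr1.
  by rewrite /mode /mode_freq /= mulr0z mulr0 subr0 mulr1 addr0.
exists (V 0); exists (fun t => a1%:C * expi (- mode_freq sigma lam a0 a1 nu 1 * t)).
split.
- apply: (@lift_solution _ _ _ nu _ V (slim sigma lam nu T L D p E src)) => //.
  + by move=> *; apply: (vlim_derive (M := M) (M0 := M0) (Ms := Ms1 + Ms2)).
  + move=> j t z /ltW tT.
    by apply: (slim_dz (M := M) (M0 := M0) (Ms := Ms1 + Ms2)).
  + by move=> *; apply: (vlim_cts (M := M) (M0 := M0) (Ms := Ms1 + Ms2)).
  + move=> t z /ltW tT.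
    by apply: (slim_eq (M := M) (M0 := M0) (Ms := Ms1 + Ms2)).
  + move=> t z m /ltW tT.
    by apply: (vlim_periodic (M := M) (M0 := M0) (Ms := Ms1 + Ms2)).
  + by exists N%:Z.
- move=> z; rewrite /V (vlim_init (M := M) (M0 := M0) (Ms := Ms1 + Ms2))//.
  by rewrite modes !mulr0 expi0 !mulr1.
- move=> t z tT; apply: V_line_cts.
  by apply: (vlim_cts (M := M) (M0 := M0) (Ms := Ms1 + Ms2)).
- move=> t z /ltW tT; rewrite -modes (le_trans _ small)//.
  by apply: (vlim_approx (M := M) (M0 := M0) (Ms := Ms1 + Ms2)).
Qed.

End TwoModeSolution.

(** * Integration on the torus *)

Section TorusMeasure.
Variable R : realType.

Definition box (a b : R) (m : nat) : set (m.-tuple R) :=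
  [set x | forall j, a <= tnth x j < b].

Arguments box : clear implicits.

Lemma measurable_box a b m : measurable (box a b m).
Proof.
have -> : box a b m = \bigcap_(j in [set: 'I_m])
    ((fun x : m.-tuple R => tnth x j) @^-1` [set` `[a, b[]).
  apply/seteqP; split => x h j; first by have := h j; rewrite /= in_itv.
  by have /= := h j I; rewrite in_itv.
apply: fin_bigcap_measurable => // j _; rewrite -[X in measurable X]setTI.
by apply: measurable_tnth => //; exact: measurable_itv.
Qed.

Lemma cons_box a b m : (fun p : m.-tuple R * R => [tuple of p.2 :: p.1]) @^-1`
  box a b m.+1 = box a b m `*` [set` `[a, b[].
Proof.
apply/seteqP; split => -[x y] /= h.
  split; last by have := h ord0; rewrite tnth0 in_itv.
  by move=> j; have := h (lift ord0 j); rewrite tnthS.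
move=> j; case: (unliftP ord0 j) => [i ->|->].
  by rewrite tnthS; exact: h.1.
by rewrite tnth0; have := h.2; rewrite in_itv.
Qed.

Lemma box_measure a b m : a <= b ->
  lebesgue_tuple R m (box a b m) = ((b - a) ^+ m)%:E.
Proof.
move=> ab; elim: m => [|m IH].
  rewrite /= diracE mem_set ?expr0//.
  by move=> -[].
rewrite [LHS]/= /pushforward cons_box product_measure1E//; last exact: measurable_box.
rewrite IH -[LHS]/(((b - a) ^+ m)%:E * lebesgue_measure [set` `[a, b[])%E lebesgue_measure_itv /= lte_fin; case: ltP => [_|ba].
  by rewrite -EFinB -EFinM exprSr.
by have -> : a = b; [lra|rewrite subrr mule0 exprS mul0r].
Qed.

(** Needed to apply Fubini's theorem to the iterated product measures. *)
Lemma lebesgue_tuple_sigma_finite m : sigma_finite setT (lebesgue_tuple R m).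
Proof.
exists (fun n => box (- n%:R) n%:R m).
  apply/seteqP; split => // x _.
  pose B := \sum_(j < m) `|tnth x j|.
  exists (Num.bound B) => //= j.
  have : `|tnth x j| < (Num.bound B)%:R.
    apply: le_lt_trans (archi_boundP _); last exact: sumr_ge0.
    by rewrite /B (bigD1 j)//= lerDl sumr_ge0.
  by rewrite ltr_norml => /andP[/ltW -> ->].
move=> n; split; first exact: measurable_box.
by rewrite box_measure ?ltry//; have := ler0n R n; lra.
Qed.

Lemma cubeE m : @cube R m = box 0 (2 * pi) m.
Proof. by []. Qed.

Lemma measurable_cube m : measurable (@cube R m).
Proof. exact: measurable_box. Qed.

Lemma two_pi_ge0 : 0 <= 2 * pi :> R.
Proof. by rewrite mulr_ge0// pi_ge0. Qed.

Lemma cube_measure m : lebesgue_tuple R m (@cube R m) = ((2 * pi) ^+ m)%:E.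
Proof. by rewrite cubeE box_measure ?subr0// two_pi_ge0. Qed.

Lemma cube_measure_lty m : (lebesgue_tuple R m (@cube R m) < +oo)%E.
Proof. by rewrite cube_measure ltry. Qed.

Section FubiniMeasure.
Context d1 d2 (T1 : measurableType d1) (T2 : measurableType d2).
Variable m1 : {measure set T1 -> \bar R}.
Variable m2 : {sigma_finite_measure set T2 -> \bar R}.
Hypothesis m1_sigma_finite : sigma_finite setT m1.

(* An alias of [m1], on which the instance is declared. *)
Let m1' : set T1 -> \bar R := m1.
HB.instance Definition _ := Measure.on m1'.
HB.instance Definition _ := @Measure_isSigmaFinite.Build _ _ _ m1' m1_sigma_finite.

Lemma fubini_measure (f : T1 * T2 -> \bar R) :
  ((m1 \x m2).-integrable setT f ->
  \int[m1 \x m2]_z f z = \int[m1]_x \int[m2]_y f (x, y))%E.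
Proof. by move=> fi; have := @integral12_prod_meas1 _ _ _ _ R m1' m2 f fi => <-. Qed.

(** Fubini's theorem for bounded functions, in the form needed for measures that are
    transported from a product. *)
Lemma fubini_pushforward d (Y : measurableType d) (phi : T1 * T2 -> Y)
    (D : set Y) (A : set T1) (I : set T2) (g : Y -> R) (B : R) :
  measurable_fun setT phi -> measurable D -> measurable A -> measurable I ->
  (m1 A < +oo)%E -> (m2 I < +oo)%E -> phi @^-1` D = A `*` I ->
  measurable_fun setT g -> (forall x, `|g x| <= B) ->
  (\int[pushforward (m1 \x m2) phi]_(x in D) (g x)%:E =
   \int[m1]_(x in A) \int[m2]_(y in I) (g (phi (x, y)))%:E)%E.
Proof.
move=> mphi mD mA mI Afin Ifin pre mg gB.
have mAI : measurable (A `*` I) by exact: measurableX.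
have ig : (m1 \x m2)%E.-integrable (A `*` I) (EFin \o (g \o phi)).
  apply: measurable_bounded_integrable => //.
  - by rewrite [X in (X < _)%E]product_measure1E// lte_mul_pinfty// ge0_fin_numE.
  - by apply: measurable_funTS; apply: measurableT_comp.
  - exists B; split; first exact: num_real.
    by move=> M BM x _; rewrite /= (le_trans (gB _))// ltW.
rewrite (@integral_pushforward _ _ _ _ R phi mphi _ D (fun x => (g x)%:E))//;
  last 2 first.
- by apply/measurable_EFinP.
- by rewrite pre.
rewrite pre integral_mkcond fubini_measure; last first.
  by apply: ((integrable_mkcond (EFin \o (g \o phi)) mAI).1 ig).
rewrite [RHS]integral_mkcond; apply: eq_integral => x _.
rewrite [RHS]patchE; case: ifPn => xc.
  rewrite [RHS]integral_mkcond; apply: eq_integral => y _.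
  rewrite !patchE; congr (if _ then _ else _).
  by apply/idP/idP; rewrite !inE /=; [case|move=> yI; split => //; rewrite inE in xc].
rewrite (eq_integral (fun=> 0%E)) ?integral0// => y _.
rewrite patchE ifF//; apply/negP; rewrite inE => -[/= xc' _].
by move/negP: xc; apply; rewrite inE.
Qed.

End FubiniMeasure.

Lemma torus_fubini m (g : m.+1.-tuple R -> R) (B : R) :
  measurable_fun setT g -> (forall x, `|g x| <= B) ->
  (\int[lebesgue_tuple R m.+1]_(x in @cube R m.+1) (g x)%:E =
   \int[lebesgue_tuple R m]_(x in @cube R m)
     \int[lebesgue_measure]_(y in [set` `[0%R, (2 * pi)%R[])
        (g [tuple of y :: x])%:E)%E.
Proof.
move=> mg gB.
apply: (@fubini_pushforward _ _ _ _ _ lebesgue_measure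
  (lebesgue_tuple_sigma_finite m) _ _ _ _ _ _ g B (@measurable_tuple_cons R m)) => //.
- exact: measurable_cube.
- exact: measurable_cube.
- exact: cube_measure_lty.
- have h : (lebesgue_measure ([set` `[0%R, (2 * pi)%R[] : set R) < +oo)%E.
    by rewrite lebesgue_measure_itv /=; case: ifP => _; rewrite ltry.
  exact: h.
- by rewrite !cubeE cons_box.
Qed.


End TorusMeasure.

(** * Characters and bounded integrands *)

Section TorusExponentials.
Variable R : realType.

Lemma continuous_affine_comp (f : R -> R) (c e : R) : continuous f ->
  continuous (fun y => f (c + e * y)).
Proof.
move=> fc y.
have h : {for y, continuous (fun y => c + e * y)}.
  apply: differentiable_continuous; apply/derivable1_diffP.
  by have [] := is_derive_affine y c e.
exact: (continuous_comp h (fc _)).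
Qed.

(** The phase [theta] will contain the contribution of the other coordinates. *)
Lemma circle_cos (theta : R) (k : int) :
  (\int[lebesgue_measure]_(y in [set` `[0%R, (2 * pi)%R[])
     (cos (theta + k%:~R * y))%:E = (if k == 0 then 2 * pi * cos theta else 0)%:E)%E.
Proof.
rewrite integral_itv_bndo_bndc; last first.
  apply/measurable_EFinP; apply: measurable_funTS; apply: continuous_measurable_fun.
  by apply: continuous_affine_comp; exact: continuous_cos.
have pi20 : 0 < 2 * pi :> R by rewrite mulr_gt0// pi_gt0.
have cosc : {within `[0, 2 * pi], continuous (fun y : R => cos (theta + k%:~R * y))}.
  apply: continuous_subspaceT; apply: continuous_affine_comp; exact: continuous_cos.
case: eqVneq => [->|k0].
  under eq_integral do rewrite mulr0z mul0r addr0.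
  rewrite integral_cst//= lebesgue_measure_itv /= lte_fin pi20 -EFinB subr0 -EFinM.
  by rewrite mulrC.
have kR : k%:~R != 0 :> R by rewrite intr_eq0.
pose F (y : R) := k%:~R^-1 * sin (theta + k%:~R * y).
have Fd (y : R) : is_derive y 1 F (cos (theta + k%:~R * y)).
  have h := @is_derive1_comp _ sin (fun y : R => theta + k%:~R * y) y _ _
    (is_derive_sin (theta + k%:~R * y))
    (is_derive_affine y theta k%:~R).
  have h' := is_deriveM (is_derive_cst (k%:~R^-1 : R) (y : R) 1) h.
  apply: (is_derive_congr h') => //.
  by rewrite /GRing.scale /= mulr0 addr0 mulrCA mulVf ?mulr1.
rewrite (@continuous_FTC2 _ _ F)//.
- rewrite /F mulr0 addr0 -EFinB -mulrBr.
  have := @expi_periodic R k => -[ce se].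
  by rewrite sinD ce se mulr1 mulr0 addr0 subrr mulr0.
- have Fc : continuous F.
    move=> y; apply: differentiable_continuous; apply/derivable1_diffP.
    by have [] := Fd y.
  split.
  + by move=> y _; have [] := Fd y.
  + by apply: cvg_at_right_filter; exact: Fc.
  + by apply: cvg_at_left_filter; exact: Fc.
- by move=> y _; rewrite derive1E; have [_ ->] := Fd y.
Qed.

Lemma measurable_cos_phase m (k : 'I_m -> int) (theta : R) :
  measurable_fun [set: m.-tuple R]
    (fun x => cos (theta + \sum_(j < m) (k j)%:~R * tnth x j)).
Proof.
apply: (@measurableT_comp _ _ _ _ _ _ cos).
  by apply: continuous_measurable_fun; exact: continuous_cos.
apply: measurable_funD; first exact: measurable_cst.
apply: measurable_sum => j; apply: measurable_funM; first exact: measurable_cst.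
exact: measurable_tnth.
Qed.

Lemma cube_integrable m (f : m.-tuple R -> R) (B : R) :
  measurable_fun (@cube R m) f -> (forall x, `|f x| <= B) ->
  (lebesgue_tuple R m).-integrable (@cube R m) (EFin \o f).
Proof.
move=> mf fB; apply: measurable_bounded_integrable => //.
- exact: measurable_cube.
- exact: cube_measure_lty.
- exists B; split; first exact: num_real.
  by move=> M BM x _; rewrite /= (le_trans (fB _))// ltW.
Qed.

(** The phase is arbitrary for the induction: integrating out one coordinate leaves
    the others as a phase. *)
Lemma cube_cos m (k : 'I_m -> int) (theta : R) :
  (\int[lebesgue_tuple R m]_(x in @cube R m)
     (cos (theta + \sum_(j < m) (k j)%:~R * tnth x j))%:E =
   (if [forall j, k j == 0] then (2 * pi) ^+ m * cos theta else 0)%:E)%E.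
Proof.
elim: m k theta => [|m IH] k theta.
  under eq_integral do rewrite big_ord0 addr0.
  rewrite integral_cst; last exact: measurable_cube.
  by rewrite cube_measure expr0 mule1 mul1r; case: ifP => // /negP[]; apply/forallP => -[].
rewrite (@torus_fubini _ _ _ 1); last 2 first.
- exact: measurable_cos_phase.
- by move=> x; rewrite ler_norml cos_geN1 cos_le1.
have inner (x : m.-tuple R) : (\int[lebesgue_measure]_(y in [set` `[0%R, (2 * pi)%R[])
    (cos (theta + \sum_(j < m.+1) (k j)%:~R * tnth [tuple of y :: x] j))%:E =
   (if k ord0 == 0 then 2 * pi *
      cos (theta + \sum_(j < m) (k (lift ord0 j))%:~R * tnth x j) else 0)%:E)%E.
  rewrite -circle_cos; apply: eq_integral => y _; congr (cos _)%:E.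
  rewrite big_ord_recl tnth0 -addrA; congr (_ + _); rewrite addrC; congr (_ + _).
  by apply: eq_bigr => j _; rewrite tnthS.
under eq_integral do rewrite inner.
have -> : [forall j, k j == 0] = (k ord0 == 0) && [forall j, k (lift ord0 j) == 0].
  apply/forallP/andP => [h|[h0 /forallP h] j].
    by split => //; apply/forallP => j; exact: h.
  by case: (unliftP ord0 j) => [i ->|->].
case: eqVneq => /= k0; last by rewrite integral0.
rewrite (eq_integral (fun x : m.-tuple R => ((2 * pi)%:E * (cos (theta +
  \sum_(j < m) (k (lift ord0 j))%:~R * tnth x j))%:E)%E)); last first.
  by move=> x _; rewrite EFinM.
rewrite integralZl//; last 2 first.
- exact: measurable_cube.
- apply: cube_integrable 1 _ _; first exact: measurable_funTS (measurable_cos_phase _ _).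
  by move=> x; rewrite ler_norml cos_geN1 cos_le1.
by rewrite IH; case: ifP => _; rewrite -EFinM ?mulr0// exprS mulrA.
Qed.

(** A class of integrands which is stable under products. *)
Definition tame d (f : 'rV[R]_d -> R[i]) : Prop :=
  [/\ measurable_fun (@cube R d) (fun x => complex.Re (f (row_of x))),
      measurable_fun (@cube R d) (fun x => complex.Im (f (row_of x))) &
      exists B, forall x, normc (f x) <= B].

Definition torus_integrable d (f : 'rV[R]_d -> R[i]) : Prop :=
  (lebesgue_tuple R d).-integrable (@cube R d)
     (EFin \o (fun x => complex.Re (f (row_of x)))) /\
  (lebesgue_tuple R d).-integrable (@cube R d)
     (EFin \o (fun x => complex.Im (f (row_of x)))).

Section Tame.
Variable d : nat.
Implicit Types f g : 'rV[R]_d -> R[i].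

Lemma tame_integrable f : tame f -> torus_integrable f.
Proof.
move=> [m1 m2 [B hB]]; split; apply: (cube_integrable (B := B)) => // x.
  exact: le_trans (normc_Re _) (hB _).
exact: le_trans (normc_Im _) (hB _).
Qed.

Lemma tame_cst c : tame (fun _ : 'rV[R]_d => c).
Proof. by split; [exact: measurable_cst|exact: measurable_cst|exists (normc c)]. Qed.

Lemma tameD f g : tame f -> tame g -> tame (fun x => f x + g x).
Proof.
move=> [f1 f2 [B hB]] [g1 g2 [B' hB']]; split.
- by under eq_fun do rewrite cReD; exact: measurable_funD.
- by under eq_fun do rewrite cImD; exact: measurable_funD.
- exists (B + B') => x; rewrite (le_trans (normcD_le _ _))// lerD//.
Qed.

Lemma tameM f g : tame f -> tame g -> tame (fun x => f x * g x).
Proof.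
move=> [f1 f2 [B hB]] [g1 g2 [B' hB']]; split.
- under eq_fun do rewrite cReM.
  by apply: measurable_funB; apply: measurable_funM.
- under eq_fun do rewrite cImM.
  by apply: measurable_funD; apply: measurable_funM.
- by exists (B * B') => x; rewrite normcEM ler_pM// normc_ge0.
Qed.

Lemma torus_intD f g : torus_integrable f -> torus_integrable g ->
  torus_int (fun x => f x + g x) = torus_int f + torus_int g.
Proof.
move=> [f1 f2] [g1 g2]; apply: eq_ReIm; rewrite ?cReD ?cImD /=.
- under eq_Rintegral do rewrite cReD.
  by apply: RintegralD => //; exact: measurable_cube.
- under eq_Rintegral do rewrite cImD.
  by apply: RintegralD => //; exact: measurable_cube.
Qed.

Lemma torus_intZ c f : torus_integrable f ->
  torus_int (fun x => c * f x) = c * torus_int f.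
Proof.
move=> [f1 f2]; have mc := @measurable_cube R d.
have Z r (h : d.-tuple R -> R) : (lebesgue_tuple R d).-integrable (@cube R d) (EFin \o h) ->
    (lebesgue_tuple R d).-integrable (@cube R d) (EFin \o (fun x => r * h x)).
  by move=> hi; exact: (integrableZl mc r hi).
apply: eq_ReIm; rewrite ?cReM ?cImM /=.
- under eq_Rintegral do rewrite cReM.
  by rewrite RintegralB//; [rewrite !RintegralZl|exact: Z|exact: Z].
- under eq_Rintegral do rewrite cImM.
  by rewrite RintegralD//; [rewrite !RintegralZl|exact: Z|exact: Z].
Qed.

(** The factor 2 comes from estimating the real and imaginary parts separately. *)
Lemma torus_int_le f (B : R) : tame f -> (forall x, normc (f x) <= B) ->
  normc (torus_int f) <= 2 * (2 * pi) ^+ d * B.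
Proof.
move=> tf hB; have [f1 f2] := tame_integrable tf.
have mc := @measurable_cube R d.
have bd (h : d.-tuple R -> R) : (lebesgue_tuple R d).-integrable (@cube R d) (EFin \o h) ->
    (forall x, `|h x| <= B) ->
    `|\int[lebesgue_tuple R d]_(x in @cube R d) h x| <= (2 * pi) ^+ d * B.
  move=> hi hh; rewrite (le_trans (le_normr_Rintegral mc hi))//.
  rewrite (le_trans (le_Rintegral (f2 := fun=> B) mc _ _ (fun x _ => hh x)))//.
  - exact: (integrable_norm hi).
  - by apply: (cube_integrable (B := `|B|)) => //; exact: measurable_cst.
  - by rewrite Rintegral_cst// cube_measure /= mulrC.
rewrite (le_trans (normc_ReIm _))//= -mulrA mulr2n mulrDl !mul1r lerD//.
- by apply: bd => // x; exact: le_trans (normc_Re _) (hB _).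
- by apply: bd => // x; exact: le_trans (normc_Im _) (hB _).
Qed.

Definition character (k : 'rV[int]_d) (x : 'rV[R]_d) : R[i] :=
  expi (\sum_(j < d) (k 0 j)%:~R * x 0 j).

Lemma character_row k (x : d.-tuple R) :
  character k (row_of x) = expi (\sum_(j < d) (k 0 j)%:~R * tnth x j).
Proof. by rewrite /character; under eq_bigr do rewrite mxE. Qed.

Lemma cos_shift (x : R) : sin x = cos (- (pi / 2) + x).
Proof. by rewrite cosD cosN sinN cos_pihalf sin_pihalf; ring. Qed.

Lemma tame_character k : tame (character k).
Proof.
split.
- under eq_fun do rewrite character_row /= -[X in cos X]add0r.
  exact: measurable_funTS (measurable_cos_phase _ _).
- under eq_fun do rewrite character_row /= cos_shift.
  exact: measurable_funTS (measurable_cos_phase _ _).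
- by exists 1 => x; rewrite normc_expi.
Qed.

Lemma torus_int_character k :
  torus_int (character k) = (if k == 0 then (2 * pi) ^+ d else 0)%:C.
Proof.
have zero : [forall j, k 0 j == 0] = (k == 0).
  apply/forallP/eqP => [h|-> j]; last by rewrite mxE.
  by apply/rowP => j; rewrite mxE; exact/eqP.
have -> : torus_int (character k) =
    (\int[lebesgue_tuple R d]_(x in @cube R d)
       cos (0 + \sum_(j < d) (k 0 j)%:~R * tnth x j)) +i*
    (\int[lebesgue_tuple R d]_(x in @cube R d)
       cos (- (pi / 2) + \sum_(j < d) (k 0 j)%:~R * tnth x j)).
  congr Complex; apply: eq_Rintegral => x _; rewrite character_row /=.
    by rewrite add0r.
  by rewrite cos_shift.
rewrite /Rintegral !cube_cos /= zero cos0 mulr1 cosN cos_pihalf mulr0.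
by case: ifP.
Qed.

End Tame.

End TorusExponentials.

(** * Sobolev norms and means of two-mode functions *)

Section SobolevNorms.
Variable R : realType.

Lemma esum_pair (I : choiceType) (F : I -> \bar R) (i j : I) : i != j ->
  (forall k, 0 <= F k)%E -> (forall k, k != i -> k != j -> F k = 0%E) ->
  \esum_(k in [set: I]) F k = (F i + F j)%E.
Proof.
move=> ij F0 Fz.
have in1 (k l : I) : (k \in [set l]) = (k == l).
  by apply/idP/eqP; rewrite in_setE.
have one l : \esum_(k in [set: I]) (if k \in [set l] then F k else 0)%E = F l.
  by rewrite -esum_mkcond esum_set1.
rewrite -(one i) -(one j) -esumD; last 2 first.
- by move=> k _; case: ifP.
- by move=> k _; case: ifP.
apply: eq_esum => k _; rewrite !in1.
have [->|ki] := eqVneq k i; first by rewrite (negbTE ij) adde0.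
by have [->|kj] := eqVneq k j; rewrite ?add0e ?adde0// Fz.
Qed.

Variable d : nat.

Lemma character0 : character (0 : 'rV[int]_d) = (fun=> 1 : R[i]).
Proof.
apply/funext => x; rewrite /character big1 ?expi0// => j _.
by rewrite mxE mulr0z mul0r.
Qed.

Lemma characterM (k l : 'rV[int]_d) (x : 'rV[R]_d) :
  character k x * character l x = character (k + l) x.
Proof.
rewrite /character -expiD -big_split; congr expi; apply: eq_bigr => j _ /=.
by rewrite mxE intrD mulrDl.
Qed.

Lemma character_opp (k : 'rV[int]_d) (x : 'rV[R]_d) :
  expi (- \sum_(j < d) (k 0 j)%:~R * x 0 j) = character (- k) x.
Proof.
rewrite /character -sumrN; congr expi; apply: eq_bigr => j _.
by rewrite mxE mulrNz mulNr.
Qed.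

Definition two_modes (a b : R[i]) (K : 'rV[int]_d) (x : 'rV[R]_d) : R[i] :=
  a + b * character K x.

Lemma tame_two_modes a b K : tame (two_modes a b K).
Proof.
apply: tameD; first exact: tame_cst.
by apply: tameM; [exact: tame_cst|exact: tame_character].
Qed.

Lemma two_pi_neq0 : (2 * pi) ^+ d != 0 :> R.
Proof. by rewrite expf_neq0// gt_eqF// mulr_gt0// pi_gt0. Qed.

Lemma fourier_two_modes a b K k :
  fourier_coef (distribution_of (two_modes a b K)) k =
  a * (k == 0)%:R + b * (k == K)%:R.
Proof.
rewrite /fourier_coef /distribution_of.
have -> : (fun x => two_modes a b K x * expi (- \sum_(j < d) (k 0 j)%:~R * x 0 j)) =
    (fun x : 'rV[R]_d => a * character (- k) x + b * character (K - k) x).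
  by apply/funext => x; rewrite character_opp /two_modes mulrDl -mulrA characterM.
have ti c l : torus_integrable (fun x : 'rV[R]_d => c * character l x).
  by apply: tame_integrable; apply: tameM; [exact: tame_cst|exact: tame_character].
have tc l := tame_integrable (@tame_character R d l).
rewrite torus_intD// !torus_intZ// !torus_int_character oppr_eq0 subr_eq0 [K == k]eq_sym.
have h : ((2 * pi) ^+ d)^-1%:C * ((2 * pi) ^+ d)%:C = 1 :> R[i].
  by rewrite -realCM mulVf ?two_pi_neq0.
have s (q : bool) : (if q then (2 * pi) ^+ d else 0)%:C = q%:R * ((2 * pi) ^+ d)%:C :> R[i].
  by case: q; rewrite ?mul1r ?mul0r.
rewrite !s; set P := ((2 * pi) ^+ d)%:C in h *; set Q := _^-1%:C in h *.
have -> : Q * (a * ((k == 0)%:R * P) + b * ((k == K)%:R * P)) =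
  (a * (k == 0)%:R + b * (k == K)%:R) * (Q * P) by ring.
by rewrite h mulr1.
Qed.

Definition sobolev_weight (K : 'rV[int]_d) : R := 1 + \sum_(j < d) (K 0 j)%:~R ^+ 2.

(** Only the Fourier coefficients of the functional matter, so that the lemma also
    applies to differences of distributions. *)
Lemma sobolev_two_modes s T a b K (B : R) : K != 0 -> 0 <= B ->
  (forall k, fourier_coef T k = a * (k == 0)%:R + b * (k == K)%:R) ->
  normc a ^+ 2 + sobolev_weight K `^ s * normc b ^+ 2 <= B ^+ 2 ->
  (sobolev_norm s T <= B%:E)%E.
Proof.
move=> K0 B0 fc hB; rewrite /sobolev_norm.
rewrite (esum_pair (i := 0) (j := K)); last 3 first.
- by rewrite eq_sym.
- by move=> k; rewrite lee_fin mulr_ge0 ?powR_ge0 ?sqr_ge0.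
- move=> k k0 kK; rewrite fc (negbTE k0) (negbTE kK) !mulr0 addr0.
  by rewrite ComplexField.Normc.normc0 expr0n mulr0.
rewrite !fc !eqxx eq_sym (negbTE K0) !mulr1 !mulr0 addr0 add0r.
have -> : 1 + \sum_(j < d) ((0 : 'rV[int]_d) 0 j)%:~R ^+ 2 = 1 :> R.
  by rewrite big1 ?addr0// => j _; rewrite mxE mulr0z expr0n.
rewrite powR1 mul1r -EFinD poweR_EFin lee_fin powR12_sqrt; last first.
  by rewrite addr_ge0 ?sqr_ge0// mulr_ge0 ?powR_ge0 ?sqr_ge0.
by rewrite -[leRHS]ger0_norm// -sqrtr_sqr ler_wsqrtr.
Qed.

(** The zero mode has weight 1 in every Sobolev space: no exponent, however
    negative, hides the mean. *)
Lemma fourier0_le_sobolev s T (B : R) :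
  (sobolev_norm s T < B%:E)%E -> normc (fourier_coef T (0 : 'rV[int]_d)) < B.
Proof.
move=> h; rewrite -lte_fin; apply: le_lt_trans h; rewrite /sobolev_norm.
set c := normc _; have c0 : 0 <= c by exact: normc_ge0.
have e : c%:E = poweR (c ^+ 2)%:E 2^-1.
  by rewrite poweR_EFin powR12_sqrt ?sqr_ge0// sqrtr_sqr ger0_norm.
rewrite e; apply: gt0_ler_poweR; rewrite ?in_itv /= ?andbT ?leey ?lee_fin ?sqr_ge0//.
- by rewrite esum_ge0// => k _; rewrite lee_fin mulr_ge0 ?powR_ge0 ?sqr_ge0.
- apply: esum_ge; exists [set 0]; first by split => //; exact: finite_set1.
  rewrite fsbig_set1 big1 ?addr0 ?powR1 ?mul1r// => j _.
  by rewrite mxE mulr0z expr0n.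
Qed.

End SobolevNorms.

Section HighFrequency.
Variables (R : realType) (d : nat).

Definition high (N : nat) : 'rV[int]_d.+1 := \row_j (if j == 0 then N%:Z else 0).

Lemma high_neq0 N : (0 < N)%N -> high N != 0.
Proof.
move=> N0; apply/eqP => /rowP/(_ 0); rewrite !mxE eqxx => -[N00].
by rewrite N00 in N0.
Qed.

Lemma character_high N (x : 'rV[R]_d.+1) : character (high N) x = expi (N%:R * x 0 0).
Proof.
rewrite /character (bigD1 0)//= big1 ?addr0 ?mxE//.
by move=> j j0; rewrite mxE (negbTE j0) mulr0z mul0r.
Qed.

Lemma sobolev_weight_high N : sobolev_weight R (high N) = 1 + N%:R ^+ 2.
Proof.
rewrite /sobolev_weight (bigD1 0)//= big1 ?addr0 ?mxE//.
by move=> j j0; rewrite mxE (negbTE j0) mulr0z expr0n.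
Qed.

(** The only place where the negativity of [s] is used. *)
Lemma high_weight_small (s eps : R) : s < 0 -> 0 < eps ->
  exists N0 : nat, forall N, (N0 <= N)%N -> sobolev_weight R (high N) `^ s <= eps.
Proof.
move=> s0 e0; pose X := expR (ln eps / s).
have X0 : 0 < X by exact: expR_gt0.
exists (Num.bound X) => N hN; rewrite sobolev_weight_high.
have XN : X <= N%:R by rewrite (le_trans (ltW (archi_boundP (ltW X0))))// ler_nat.
have XN2 : X <= 1 + N%:R ^+ 2 by have := sqr_ge0 (N%:R - 1 : R); nra.
have w0 : 0 < 1 + (N%:R : R) ^+ 2 := lt_le_trans X0 XN2.
rewrite /powR gt_eqF// -(lnK (x := eps)) ?posrE// ler_expR.
have : ln X <= ln (1 + N%:R ^+ 2) by rewrite ler_ln ?posrE.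
rewrite /X expRK => h.
have := ler_wnM2l (ltW s0) h; rewrite mulrCA mulfV ?mulr1// lt_eqF//.
Qed.

(** The fast mode integrates to zero, so the mean is read off from the mode 0. *)
Lemma mean_two_modes (f : 'rV[R]_d.+1 -> R[i]) (V : R -> R[i]) (a c : R[i]) (N : nat)
    (eta : R) : (0 < N)%N -> (forall z, cts z V) ->
  (forall z, normc (V z - (a + c * expi z)) <= eta) ->
  (forall x, f x = V (N%:R * x 0 0)) ->
  torus_integrable f /\
  normc (torus_int f - ((2 * pi) ^+ d.+1)%:C * a) <= 2 * (2 * pi) ^+ d.+1 * eta.
Proof.
move=> N0 cV hV hf.
have tf : tame f.
  have m1 : measurable_fun (@cube R d.+1) (fun x : d.+1.-tuple R => N%:R * tnth x ord0).
    apply: measurable_funM; first exact: measurable_cst.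
    by apply: measurable_funTS; exact: measurable_tnth.
  have fE x : f (row_of x) = V (N%:R * tnth x ord0) by rewrite hf mxE.
  split.
  - under eq_fun do rewrite fE.
    apply: (@measurableT_comp _ _ _ _ _ _ (fun z => complex.Re (V z))) => //.
    by apply: continuous_measurable_fun => z; exact: (cV z).1.
  - under eq_fun do rewrite fE.
    apply: (@measurableT_comp _ _ _ _ _ _ (fun z => complex.Im (V z))) => //.
    by apply: continuous_measurable_fun => z; exact: (cV z).2.
  - exists (eta + (normc a + normc c)) => x; rewrite hf.
    have -> : V (N%:R * x 0 0) = (V (N%:R * x 0 0) - (a + c * expi (N%:R * x 0 0))) +
      (a + c * expi (N%:R * x 0 0)) by ring.
    rewrite (le_trans (normcD_le _ _))// lerD// (le_trans (normcD_le _ _))// lerD//.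
    by rewrite normcEM normc_expi mulr1.
split; first exact: tame_integrable.
have tm : tame (two_modes a c (high N)) by exact: tame_two_modes.
pose g x := f x + (-1) * two_modes a c (high N) x.
have tg : tame g by apply: tameD => //; apply: tameM => //; exact: tame_cst.
have -> : torus_int f - ((2 * pi) ^+ d.+1)%:C * a = torus_int g.
  have tc := @tame_character R d.+1 (high N).
  have t1 : torus_integrable (fun _ : 'rV[R]_d.+1 => a).
    by apply: tame_integrable; exact: tame_cst.
  have t2 : torus_integrable (fun x => c * character (high N) x).
    by apply: tame_integrable; apply: tameM => //; exact: tame_cst.
  rewrite /g torus_intD; last 2 first.
  - exact: (tame_integrable tf).
  - by apply: tame_integrable; apply: tameM => //; exact: tame_cst.
  rewrite torus_intZ; last exact: (tame_integrable tm).
  rewrite /two_modes torus_intD// torus_intZ; last exact: (tame_integrable tc).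
  rewrite torus_int_character (negbTE (high_neq0 N0)) mulr0 addr0.
  have -> : (fun _ : 'rV[R]_d.+1 => a) = (fun x => a * character 0 x).
    by apply/funext => x; rewrite character0 mulr1.
  rewrite torus_intZ; last by apply: tame_integrable; exact: tame_character.
  by rewrite torus_int_character eqxx mulN1r mulrC.
apply: torus_int_le => // x; rewrite /g mulN1r hf /two_modes character_high.
exact: hV.
Qed.

End HighFrequency.

(** * Bessel's inequality and weak convergence *)

Section Bessel.
Context dd (T : measurableType dd) (R : realType).
Variables (mu : {measure set T -> \bar R}) (D : set T) (mD : measurable D).
Hypothesis muD : (mu D < +oo)%E.
Implicit Types f g : T -> R.

Definition square_integrable f : Prop :=
  measurable_fun D f /\ mu.-integrable D (EFin \o (fun x => f x ^+ 2)).

Local Notation I f := (Rintegral mu D f).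

Lemma square_integrableM f g : square_integrable f -> square_integrable g ->
  mu.-integrable D (EFin \o (fun x => f x * g x)).
Proof.
move=> [mf f2] [mg g2].
apply: (@le_integrable _ _ _ _ _ mD _ (EFin \o (fun x => f x ^+ 2 + g x ^+ 2))).
- by apply/measurable_EFinP; exact: measurable_funM.
- move=> x _; rewrite lee_fin [leRHS]ger0_norm ?addr_ge0 ?sqr_ge0//.
  rewrite normrM -(real_normK (num_real (f x))) -(real_normK (num_real (g x))).
  have := sqr_ge0 (`|f x| - `|g x|).
  have := mulr_ge0 (normr_ge0 (f x)) (normr_ge0 (g x)).
  by nra.
- exact: (integrableD mD f2 g2).
Qed.

Lemma bounded_square_integrable f (B : R) : measurable_fun D f ->
  (forall x, `|f x| <= B) -> square_integrable f.
Proof.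
move=> mf fB; split => //; apply: measurable_bounded_integrable => //.
  exact: measurable_funX.
exists (B ^+ 2); split; first exact: num_real.
move=> M BM x _ /=; rewrite normrX (le_trans _ (ltW BM))//.
by rewrite lerXn2r ?nnegrE// (le_trans _ (fB x)).
Qed.

Lemma square_integrableZ c f : square_integrable f ->
  square_integrable (fun x => c * f x).
Proof.
move=> [mf f2]; split; first by apply: measurable_funM => //; exact: measurable_cst.
have := integrableZl mD (c ^+ 2) f2; apply: eq_integrable => // x _ /=.
by rewrite exprMn EFinM.
Qed.

Lemma square_integrableB f g : square_integrable f -> square_integrable g ->
  square_integrable (fun x => f x - g x).
Proof.
move=> sf sg; have fg := square_integrableM sf sg.
have [mf f2] := sf; have [mg g2] := sg.
split; first exact: measurable_funB.
have h : mu.-integrable D (fun x => (f x ^+ 2)%:E + (g x ^+ 2)%:E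
    + ((- 2)%:E * (f x * g x)%:E))%E.
  exact: (integrableD mD (integrableD mD f2 g2) (integrableZl mD (- 2) fg)).
apply: eq_integrable h => // x _ /=.
by rewrite -EFinM -!EFinD; congr EFin; ring.
Qed.

Variables (phi : nat -> T -> R) (kappa : R).
Hypothesis kappa0 : 0 < kappa.
Hypothesis phi_sq : forall n, square_integrable (phi n).
Hypothesis phi_orth : forall n m,
  I (fun x => phi n x * phi m x) = if n == m then kappa else 0.

(** Subtracting the projection on one function of an orthogonal family lowers the
    square integral by the square of its coefficient and does not change the other
    coefficients. *)
Lemma bessel_step f n : square_integrable f ->
  let g x := f x - I (fun x => f x * phi n x) / kappa * phi n x in
  [/\ square_integrable g,
      I (fun x => g x ^+ 2) = I (fun x => f x ^+ 2) - I (fun x => f x * phi n x) ^+ 2 / kappa &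
      forall m, m != n -> I (fun x => g x * phi m x) = I (fun x => f x * phi m x)].
Proof.
move=> sf g; set c := I (fun x => f x * phi n x) in g *.
have sg : square_integrable g.
  by apply: square_integrableB => //; exact: square_integrableZ.
have fphi m := square_integrableM sf (phi_sq m).
have pp m := square_integrableM (phi_sq n) (phi_sq m).
have Z r (h : T -> R) : mu.-integrable D (EFin \o h) ->
    mu.-integrable D (EFin \o (fun x => r * h x)).
  by move=> hi; exact: (integrableZl mD r hi).
split => //.
- have -> : (fun x => g x ^+ 2) = (fun x => (f x ^+ 2 - 2 * (c / kappa) * (f x * phi n x))
      + (c / kappa) ^+ 2 * (phi n x * phi n x)).
    by apply/funext => x; rewrite /g; ring.
  have B : mu.-integrable D (EFin \o (fun x => f x ^+ 2 - 2 * (c / kappa) * (f x * phi n x))).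
    exact: (integrableB mD sf.2 (Z _ _ (fphi n))).
  rewrite RintegralD//; last exact: Z.
  rewrite RintegralB//; [|exact: sf.2|exact: Z].
  rewrite !RintegralZl// phi_orth eqxx -/c; field.
  by rewrite gt_eqF.
- move=> m mn; have -> : (fun x => g x * phi m x) =
      (fun x => f x * phi m x - c / kappa * (phi n x * phi m x)).
    by apply/funext => x; rewrite /g; ring.
  rewrite RintegralB//; last exact: Z.
  by rewrite RintegralZl// phi_orth eq_sym (negbTE mn) mulr0 subr0.
Qed.

(** Iterate [bessel_step]; the square integral of the remainder is nonnegative. *)
Lemma bessel f : square_integrable f -> forall M,
  \sum_(0 <= n < M) I (fun x => f x * phi n x) ^+ 2 <= kappa * I (fun x => f x ^+ 2).
Proof.
move=> sf M.
have [r [sr r2 _]] : exists r, [/\ square_integrable r,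
    I (fun x => r x ^+ 2) = I (fun x => f x ^+ 2) -
      (\sum_(0 <= n < M) I (fun x => f x * phi n x) ^+ 2) / kappa &
    forall m, (M <= m)%N -> I (fun x => r x * phi m x) = I (fun x => f x * phi m x)].
  elim: M => [|M [r [sr r2 rm]]].
    by exists f; split => //; rewrite big_nil mul0r subr0.
  have [s1 s2 s3] := bessel_step M sr.
  exists (fun x => r x - I (fun x => r x * phi M x) / kappa * phi M x); split => //.
    by rewrite s2 r2 rm// big_nat_recr//= mulrDl; ring.
  by move=> m Mm; rewrite s3 ?rm// ?gtn_eqF// ltnW.
have : 0 <= I (fun x => r x ^+ 2) by apply: Rintegral_ge0 => x _; exact: sqr_ge0.
by rewrite r2 subr_ge0 ler_pdivrMr// mulrC.
Qed.

Lemma bessel_cvg0 f (eps : R) : square_integrable f -> 0 < eps ->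
  exists N0, forall n, (N0 <= n)%N -> `|I (fun x => f x * phi n x)| <= eps.
Proof.
move=> sf e0; set c := fun n => I (fun x => f x * phi n x).
have cv : cvgn (series (fun n => c n ^+ 2)).
  apply: nondecreasing_is_cvgn.
    by apply/nondecreasing_seqP => n; rewrite /series /= big_nat_recr//= lerDl sqr_ge0.
  by exists (kappa * I (fun x => f x ^+ 2)) => _ [M _ <-]; exact: bessel.
have /cvgrPdist_le/(_ _ (exprn_gt0 2 e0)) := cvg_series_cvg_0 cv.
move=> [N0 _ hN]; exists N0 => n Nn.
have := hN n Nn; rewrite /= sub0r normrN ger0_norm ?sqr_ge0// -/(c n).
by rewrite -(real_normK (num_real (c n))) ler_pXn2r ?nnegrE// ltW.
Qed.

End Bessel.

Section WeakConvergence.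
Variables (R : realType) (d : nat).

(** The phase [theta] treats cosines ([theta = 0]) and sines ([theta = - pi / 2]) at
    the same time. *)
Definition wave (theta : R) (n : nat) (x : d.+1.-tuple R) : R :=
  cos (theta + \sum_(j < d.+1) (high d n.+1 0 j)%:~R * tnth x j).

Local Notation mu := (lebesgue_tuple R d.+1).
Local Notation Q := (@cube R d.+1).

Lemma wave_square_integrable theta n : square_integrable mu Q (wave theta n).
Proof.
apply: (bounded_square_integrable (@measurable_cube R d.+1) (cube_measure_lty R d.+1)
  (B := 1)).
- exact: measurable_funTS (measurable_cos_phase _ _).
- by move=> x; rewrite ler_norml cos_geN1 cos_le1.
Qed.

Lemma wave_orthogonal theta n m :
  Rintegral mu Q (fun x => wave theta n x * wave theta m x) =
  if n == m then (2 * pi) ^+ d.+1 / 2 else 0.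
Proof.
pose ks (j : 'I_d.+1) : int := high d n.+1 0 j + high d m.+1 0 j.
pose kd (j : 'I_d.+1) : int := high d n.+1 0 j - high d m.+1 0 j.
pose C1 (x : d.+1.-tuple R) := cos (theta + theta + \sum_(j < d.+1) (ks j)%:~R * tnth x j).
pose C2 (x : d.+1.-tuple R) := cos (0 + \sum_(j < d.+1) (kd j)%:~R * tnth x j).
have -> : (fun x => wave theta n x * wave theta m x) =
    (fun x => 2^-1 * (C1 x + C2 x)).
  apply/funext => x; rewrite /wave /C1 /C2.
  set A := \sum_(j < d.+1) _; set B := \sum_(j < d.+1) _.
  have -> : \sum_(j < d.+1) (ks j)%:~R * tnth x j = A + B.
    by rewrite -big_split; apply: eq_bigr => j _ /=; rewrite intrD mulrDl.
  have -> : \sum_(j < d.+1) (kd j)%:~R * tnth x j = A - B.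
    by rewrite -sumrB; apply: eq_bigr => j _ /=; rewrite intrB mulrBl.
  have -> : theta + theta + (A + B) = (theta + A) + (theta + B) by ring.
  have -> : 0 + (A - B) = (theta + A) - (theta + B) by ring.
  by rewrite (cosD (theta + A)) (cosB (theta + A)); field.
have ic k t : mu.-integrable Q
    (EFin \o (fun x => cos (t + \sum_(j < d.+1) (k j)%:~R * tnth x j))).
  apply: (cube_integrable (B := 1)).
    exact: measurable_funTS (measurable_cos_phase _ _).
  by move=> x; rewrite ler_norml cos_geN1 cos_le1.
have mQ := @measurable_cube R d.+1.
rewrite RintegralZl//; last exact: (integrableD mQ (ic ks _) (ic kd _)).
rewrite RintegralD//; [|exact: ic|exact: ic].
rewrite /Rintegral !cube_cos /= cos0 mulr1.
have -> : [forall j, ks j == 0] = false.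
  by apply/negbTE/forallPn; exists 0; rewrite /ks !mxE.
have -> : [forall j, kd j == 0] = (n == m).
  apply/forallP/eqP => [/(_ 0)|nm j]; last by rewrite /kd nm subrr.
  by rewrite /kd !mxE eqxx subr_eq0 => /eqP[].
by case: ifP => _; rewrite add0r ?mulr0// mulrC.
Qed.

Lemma two_pi_gt0 : 0 < (2 * pi) ^+ d.+1 / 2 :> R.
Proof. by rewrite divr_gt0// exprn_gt0// mulr_gt0// pi_gt0. Qed.

Lemma wave_cvg0 theta (f : d.+1.-tuple R -> R) (eps : R) :
  square_integrable mu Q f -> 0 < eps -> exists N0, forall n, (N0 <= n)%N ->
  `|Rintegral mu Q (fun x => f x * wave theta n x)| <= eps.
Proof.
move=> sf e0.
exact: (bessel_cvg0 (@measurable_cube R d.+1) two_pi_gt0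
  (wave_square_integrable theta) (wave_orthogonal theta) sf e0).
Qed.

Lemma L2_square_integrable (g : 'rV[R]_d.+1 -> R[i]) : L2 g ->
  square_integrable mu Q (fun x => complex.Re (g (row_of x))) /\
  square_integrable mu Q (fun x => complex.Im (g (row_of x))).
Proof.
move=> [_ m1 m2 gfin].
have mQ := @measurable_cube R d.+1.
have ng : mu.-integrable Q (EFin \o (fun x => normc (g (row_of x)) ^+ 2)).
  apply/integrableP; split.
    apply/measurable_EFinP.
    have -> : (fun x : d.+1.-tuple R => normc (g (row_of x)) ^+ 2) =
        (fun x => complex.Re (g (row_of x)) ^+ 2 + complex.Im (g (row_of x)) ^+ 2).
      by apply/funext => x; rewrite normc_sq.
    by apply: measurable_funD; apply: measurable_funX.
  under eq_integral do rewrite gee0_abs ?lee_fin ?sqr_ge0//.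
  exact: gfin.
split; split => //; apply: le_integrable ng => //.
- by apply/measurable_EFinP; exact: measurable_funX.
- move=> x _; rewrite lee_fin !ger0_norm ?sqr_ge0// normc_sq lerDl sqr_ge0//.
- by apply/measurable_EFinP; exact: measurable_funX.
- move=> x _; rewrite lee_fin !ger0_norm ?sqr_ge0// normc_sq lerDr sqr_ge0//.
Qed.

Lemma leq_add4 (a b c e n : nat) : (a + b + c + e <= n)%N ->
  [/\ (a <= n)%N, (b <= n)%N, (c <= n)%N & (e <= n)%N].
Proof. by move=> h; split; lia. Qed.

(** Both components of the inner product are combinations of coefficients of square
    integrable functions along the two orthogonal families of waves. *)
Lemma character_weak_cvg0 (b : R[i]) (g : 'rV[R]_d.+1 -> R[i]) (eps : R) :
  L2 g -> 0 < eps -> exists N0, forall N, (N0 <= N)%N ->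
  normc (L2_inner (fun x => b * character (high d N) x) g) < eps.
Proof.
move=> Lg e0; have [s1 s2] := L2_square_integrable Lg.
pose eta := eps / (8 * (normc b + 1)).
have b0 := normc_ge0 b.
have eta0 : 0 < eta by rewrite divr_gt0// mulr_gt0//; lra.
pose sh : R := - (pi / 2).
have [N1 h1] := wave_cvg0 0 s1 eta0; have [N2 h2] := wave_cvg0 0 s2 eta0.
have [N3 h3] := wave_cvg0 sh s1 eta0; have [N4 h4] := wave_cvg0 sh s2 eta0.
exists (N1 + N2 + N3 + N4).+1 => -[//|n]; rewrite ltnS => hn.
have mQ := @measurable_cube R d.+1.
have e1 (x : d.+1.-tuple R) : complex.Re (character (high d n.+1) (row_of x)) = wave 0 n x.
  by rewrite character_row /wave add0r.
have e2 (x : d.+1.-tuple R) : complex.Im (character (high d n.+1) (row_of x)) = wave sh n x.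
  by rewrite character_row /wave /= cos_shift.
have i1 t := square_integrableM mQ s1 (wave_square_integrable t n).
have i2 t := square_integrableM mQ s2 (wave_square_integrable t n).
have ReE (x : d.+1.-tuple R) : complex.Re (character (high d n.+1) (row_of x) * conjc (g (row_of x)))
   = complex.Re (g (row_of x)) * wave 0 n x + complex.Im (g (row_of x)) * wave sh n x.
  by rewrite cReM cReJ cImJ e1 e2; ring.
have ImE (x : d.+1.-tuple R) : complex.Im (character (high d n.+1) (row_of x) * conjc (g (row_of x)))
   = complex.Re (g (row_of x)) * wave sh n x - complex.Im (g (row_of x)) * wave 0 n x.
  by rewrite cImM cReJ cImJ e1 e2; ring.
have ti : torus_integrable (fun x => character (high d n.+1) x * conjc (g x)).
  split.
    under [X in EFin \o X]eq_fun do rewrite ReE.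
    exact: (integrableD mQ (i1 0) (i2 sh)).
  under [X in EFin \o X]eq_fun do rewrite ImE.
  exact: (integrableB mQ (i1 sh) (i2 0)).
have -> : L2_inner (fun x => b * character (high d n.+1) x) g =
    b * torus_int (fun x => character (high d n.+1) x * conjc (g x)).
  rewrite /L2_inner -torus_intZ//; congr torus_int; apply/funext => x.
  by rewrite mulrA.
rewrite normcEM.
have small : normc (torus_int (fun x => character (high d n.+1) x * conjc (g x))) <= 4 * eta.
  have [nn1 nn2 nn3 nn4] := leq_add4 hn.
  rewrite (le_trans (normc_ReIm _))//= /torus_int.
  under eq_Rintegral do rewrite ReE.
  under [X in _ + `|X|]eq_Rintegral do rewrite ImE.
  rewrite RintegralD; [|exact: mQ|exact: i1|exact: i2].
  rewrite RintegralB; [|exact: mQ|exact: i1|exact: i2].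
  have := ler_normD (Rintegral mu Q (fun x => complex.Re (g (row_of x)) * wave 0 n x))
    (Rintegral mu Q (fun x => complex.Im (g (row_of x)) * wave sh n x)).
  have := ler_normB (Rintegral mu Q (fun x => complex.Re (g (row_of x)) * wave sh n x))
    (Rintegral mu Q (fun x => complex.Im (g (row_of x)) * wave 0 n x)).
  have := h1 n nn1; have := h2 n nn2; have := h3 n nn3; have := h4 n nn4.
  lra.
have : normc b * normc (torus_int (fun x => character (high d n.+1) x * conjc (g x)))
    <= normc b * (4 * eta) by rewrite ler_wpM2l.
have : eta * (8 * (normc b + 1)) = eps.
  by rewrite /eta divfK// gt_eqF// mulr_gt0//; lra.
nra.
Qed.

End WeakConvergence.

(** * Plane waves and phase gaps *)

Section PlaneWaves.
Variables (R : realType) (d sigma : nat) (lam : R).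
Local Notation ii := (Complex 0 1 : R[i]).

(** On constants the equation is an ordinary differential equation which preserves
    the modulus. *)
Definition flat (a : R[i]) (t : R) (x : 'rV[R]_d) : R[i] :=
  a * expi (- (lam * (normc a ^+ 2) ^+ sigma) * t).

Lemma flat0 a : flat a 0 = (fun=> a).
Proof. by apply/funext => x; rewrite /flat mulr0 expi0 mulr1. Qed.

Lemma smooth_cst (V : normedModType R) (U : set V) (c : R[i]) :
  open U -> smooth_on U (fun=> c).
Proof.
move=> oU; apply: (@smooth_family _ _ _ [set f | exists c, f = fun=> c]) => //.
- by move=> _ [a ->] x _; exact: cts_cst.
- move=> _ [a ->] v; exists (fun=> 0); first by exists 0.
  by move=> x _; exact: is_cderive_cst.
- by exists c.
Qed.

Lemma test_function_one : test_function (fun _ : 'rV[R]_d => 1).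
Proof. by split => //; apply: smooth_cst; exact: openT. Qed.

Lemma phase_derive (om t : R) (c : R[i]) (tau : R) : is_cderive (0 : R) 1
  (fun h => c * expi (om * (t + tau * h))) (c * (ii * om%:C * tau%:C) * expi (om * t)).
Proof.
have h := @is_cderive_affine _ (fun y => expi (om * y)) 0 t tau _ (is_cderive_expi _ _).
apply: is_cderive_eq (is_cderiveZ c h) _.
by rewrite mulr0 addr0; ring.
Qed.

Lemma flat_solution a : nls_solution sigma lam setT (flat a).
Proof.
set om := - (lam * (normc a ^+ 2) ^+ sigma).
split => //.
- exact: openT.
- apply: (@smooth_family _ _ _ [set f | exists c : R[i],
    f = fun p : R * 'rV[R]_d => c * expi (om * p.1)]); last by exists a.
  + by rewrite setXTT; exact: openT.
  + move=> _ [c ->] p _; apply: ctsM; first exact: cts_cst.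
    have h : cts p.1 (fun t : R => expi (om * t)) := is_cderive_cts (is_cderive_expi om p.1).
    exact: (cts_comp (@fst_cts _ _ p) h).
  + move=> _ [c ->] v; exists (fun p => c * (ii * om%:C * v.1%:C) * expi (om * p.1)).
      by exists (c * (ii * om%:C * v.1%:C)).
    move=> p _; apply/is_cderive_line.
    apply: is_cderive_ext (phase_derive om p.1 c v.1) => h /=.
    by rewrite [v.1 * h]mulrC.
- move=> t x _.
  have -> : cderive (1 : R^o) (fun t => flat a t x) t = ii * om%:C * flat a t x.
    rewrite [RHS](_ : _ = a * (ii * om%:C) * expi (om * t)); last by rewrite /flat; ring.
    apply: is_cderiveE; apply: is_cderive_eq; first by apply: is_cderiveZ; exact: is_cderive_expi.
    by rewrite -/om; ring.
  have -> : laplacian (flat a t) x = 0.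
    rewrite /laplacian big1// => j _.
    have -> : cderive (delta_mx 0 j) (flat a t) = (fun=> 0).
      by apply/funext => y; exact: is_cderiveE (is_cderive_cst _ _ _).
    exact: is_cderiveE (is_cderive_cst _ _ _).
  rewrite mulr0 addr0.
  have iiE z : 'i * (ii * z) = - z :> R[i].
    by rewrite mulrA -[X in X = _]/(ii * ii * z) mul_ii mulN1r.
  rewrite -[ii * _ * _]mulrA iiE /om realCN realCM mulNr opprK.
  have -> : normc (flat a t x) = normc a by rewrite normcEM normc_expi mulr1.
  by rewrite exprM.
Qed.

End PlaneWaves.

Section Gaps.
Variable R : realType.

(** As [exp(i (x - y)) = -1], subtracting the second term adds its modulus. *)
Lemma antiphase (a b x y : R) : 0 <= a -> 0 <= b -> `|x - y| = pi ->
  normc (a%:C * expi x - b%:C * expi y) = a + b.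
Proof.
move=> a0 b0 xy.
have e : expi (x - y) = -1 :> R[i].
  have [h|h] : x - y = pi \/ x - y = - pi.
  - have := xy; case: (ger0P (x - y)) => _ h; [by left|right].
    by rewrite -h opprK.
  - by rewrite h expi_pi.
  - by rewrite h expiN expi_pi rmorphN1.
have -> : expi x = - expi y by rewrite -{1}(subrK y x) expiD e mulN1r.
have -> : a%:C * - expi y - b%:C * expi y = - ((a + b)%:C * expi y).
  by rewrite realCD; ring.
by rewrite normcNE normcEM normc_expi mulr1 normc_real ger0_norm// addr_ge0.
Qed.

Lemma phase_gap (a : R[i]) (x y : R) : a != 0 -> 0 < `|x - y| -> `|x - y| < pi ->
  0 < normc (a * expi x - a * expi y).
Proof.
move=> a0 h1 h2; rewrite normc_gt0 -mulrBr mulf_eq0 (negbTE a0) /=.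
apply/eqP => /eqP; rewrite subr_eq0 => /eqP e.
have e1 : expi (x - y) = 1 :> R[i].
  by rewrite expiD e -expiD subrr expi0.
have s0 : sin (x - y) = 0 by have := congr1 (@complex.Im R) e1.
have : 0 < sin `|x - y| by apply: sin_gt0_pi; rewrite h1 h2.
have [_|_] := ger0P (x - y); first by rewrite s0 ltxx.
by rewrite sinN s0 oppr0 ltxx.
Qed.

(** The second conclusion transfers the bound to the integral of the difference. *)
Lemma mean_gap d (f g : 'rV[R]_d -> R[i]) (a b : R[i]) (e : R) :
  torus_integrable f -> torus_integrable g ->
  normc (torus_int f - ((2 * pi) ^+ d)%:C * a) <= 2 * (2 * pi) ^+ d * e ->
  normc (torus_int g - ((2 * pi) ^+ d)%:C * b) <= 2 * (2 * pi) ^+ d * e ->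
  (2 * pi) ^+ d * (normc (a - b) - 4 * e) <= normc (torus_int f - torus_int g) /\
  torus_int (fun x => f x - g x) = torus_int f - torus_int g.
Proof.
move=> fi gi hf hg; set P := (2 * pi) ^+ d in hf hg *.
have P0 : 0 <= P by rewrite exprn_ge0// two_pi_ge0.
split.
- have : normc (P%:C * (a - b)) = P * normc (a - b).
    by rewrite normcEM normc_real ger0_norm.
  have -> : P%:C * (a - b) = (torus_int f - torus_int g)
    - (torus_int f - P%:C * a) + (torus_int g - P%:C * b) by ring.
  rewrite mulrBr => <-.
  have := normcD_le ((torus_int f - torus_int g) - (torus_int f - P%:C * a))
    (torus_int g - P%:C * b).
  have := normcB_le (torus_int f - torus_int g) (torus_int f - P%:C * a).
  lra.
- have -> : (fun x => f x - g x) = (fun x => f x + (-1) * g x).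
    by apply/funext => x; rewrite mulN1r.
  have gi' : torus_integrable (fun x => (-1) * g x).
    have mc := @measurable_cube R d.
    split.
      under [X in EFin \o X]eq_fun do rewrite mulN1r cReN -mulN1r.
      exact: (integrableZl mc (-1) gi.1).
    under [X in EFin \o X]eq_fun do rewrite mulN1r cImN -mulN1r.
    exact: (integrableZl mc (-1) gi.2).
  by rewrite torus_intD// torus_intZ// mulN1r.
Qed.

Lemma shift_poly_split sigma (A B : R) : shift_poly sigma.+1 A B = A ^+ sigma.+1 +
  (sigma.+2 * sigma.+1)%:R * A ^+ sigma * B +
  \sum_(2 <= i < sigma.+2) ('C(sigma.+2, i) * 'C(sigma.+1, i))%:R *
     A ^+ (sigma.+1 - i) * B ^+ i.
Proof.
rewrite /shift_poly big_nat_recl//= !bin0 mul1n mul1r subn0 expr0 mulr1.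
rewrite big_nat_recl//= !bin1 subn1 expr1 addrA; congr (_ + _).
by rewrite !big_add1.
Qed.

(** Keep the terms of degree 0 and 1 in [B]: the second one makes the shift
    unbounded in the amplitude of the fast mode. *)
Lemma shift_poly_ge sigma (A B : R) : (0 < sigma)%N -> 0 <= A -> 0 <= B ->
  A ^+ sigma + A ^+ sigma.-1 * B <= shift_poly sigma A B.
Proof.
case: sigma => // sigma _ A0 B0; rewrite shift_poly_split /=.
rewrite -[leLHS]addr0 lerD//.
  rewrite lerD2l -mulrA ler_peMl ?mulr_ge0 ?exprn_ge0//.
  by rewrite ler1n muln_gt0.
by apply: sumr_ge0 => i _; rewrite !mulr_ge0// exprn_ge0.
Qed.

Lemma shift_poly_le sigma (A : R) : (0 < sigma)%N -> 0 <= A ->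
  exists2 C, 0 <= C & forall B, 0 <= B -> B <= 1 ->
  shift_poly sigma A B <= A ^+ sigma + C * B.
Proof.
case: sigma => // sigma _ A0.
exists ((sigma.+2 * sigma.+1)%:R * A ^+ sigma +
   \sum_(2 <= i < sigma.+2) ('C(sigma.+2, i) * 'C(sigma.+1, i))%:R * A ^+ (sigma.+1 - i)).
  rewrite addr_ge0 ?mulr_ge0 ?exprn_ge0//.
  by apply: sumr_ge0 => i _; rewrite mulr_ge0// exprn_ge0.
move=> B B0 B1; rewrite shift_poly_split mulrDl addrA lerD2l mulr_suml.
rewrite big_nat_cond [leRHS]big_nat_cond; apply: ler_sum => i /andP[/andP[i2 _] _].
rewrite ler_wpM2l ?mulr_ge0 ?exprn_ge0//.
by rewrite -[leRHS]expr1 ler_wiXn2l// ltnW.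
Qed.

(** Keep the term of degree 1 in [B].  The factor on the left is positive only if
    [sigma > 1]: for the cubic equation this term does not depend on [A]. *)
Lemma shift_poly_increase sigma (A A' B : R) : (0 < sigma)%N -> 0 <= A -> A <= A' -> 0 <= B ->
  (A' ^+ sigma.-1 - A ^+ sigma.-1) * B <= shift_poly sigma A' B - shift_poly sigma A B.
Proof.
case: sigma => // sigma _ A0 AA' B0; rewrite !shift_poly_split /=.
have A'0 := le_trans A0 AA'.
have pw n : A ^+ n <= A' ^+ n by rewrite lerXn2r.
have h : \sum_(2 <= i < sigma.+2) ('C(sigma.+2, i) * 'C(sigma.+1, i))%:R *
     A ^+ (sigma.+1 - i) * B ^+ i <= \sum_(2 <= i < sigma.+2)
     ('C(sigma.+2, i) * 'C(sigma.+1, i))%:R * A' ^+ (sigma.+1 - i) * B ^+ i.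
  by apply: ler_sum => i _; rewrite ler_wpM2r ?exprn_ge0// ler_wpM2l.
have h1 := pw sigma.+1.
have h2 : (A' ^+ sigma - A ^+ sigma) * B <=
    (sigma.+2 * sigma.+1)%:R * ((A' ^+ sigma - A ^+ sigma) * B).
  by rewrite ler_peMl ?mulr_ge0 ?subr_ge0// ler1n muln_gt0.
have : (sigma.+2 * sigma.+1)%:R * ((A' ^+ sigma - A ^+ sigma) * B) =
  (sigma.+2 * sigma.+1)%:R * A' ^+ sigma * B - (sigma.+2 * sigma.+1)%:R * A ^+ sigma * B.
  by ring.
by move: h h1 h2; lra.
Qed.

End Gaps.

(** * Instability *)

Section Instability.
Variables (R : realType) (d sigma : nat) (lam : R).
Hypotheses (lam1 : `|lam| = 1) (sigma0 : (0 < sigma)%N).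

Local Notation P := ((2 * pi) ^+ d.+1 : R).
Local Notation flatw := (@flat R d.+1 sigma lam).
Local Notation phase A B t := (expi (- (lam * shift_poly sigma A B) * t)).

Lemma P_ge1 : 1 <= P.
Proof. by rewrite exprn_ege1//; have := @pi_ge2 R; lra. Qed.

Definition has_mean (f : 'rV[R]_d.+1 -> R[i]) (a : R[i]) (e : R) : Prop :=
  torus_integrable f /\ normc (torus_int f - P%:C * a) <= 2 * P * e.

Lemma flat_mean a e t : 0 <= e ->
  has_mean (flatw a t) (a * expi (- (lam * (normc a ^+ 2) ^+ sigma) * t)) e.
Proof.
move=> e0; set b := a * _.
apply: (@mean_two_modes R d _ (fun=> b) b 0 1 e) => //.
- by move=> z; exact: cts_cst.
- by move=> z; rewrite mul0r addr0 subrr ComplexField.Normc.normc0.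
Qed.

Lemma perturbed_solution (a0 : R[i]) (a1 T e : R) : 0 < T -> 0 < e ->
  exists N0 : nat, forall N : nat, (N0 <= N)%N ->
  exists u : R -> 'rV[R]_d.+1 -> R[i],
    [/\ (0 < N)%N, nls_solution sigma lam [set t | `|t| < T] u,
        u 0 = two_modes a0 a1%:C (high d N) &
        forall t, `|t| < T ->
          has_mean (u t) (a0 * phase (normc a0 ^+ 2) (a1 ^+ 2) t) e].
Proof.
move=> T0 e0; have [N0 hN] := two_mode_solution d sigma a0 a1 lam1 T0 e0.
exists N0.+1 => N NN; have [V [c [h1 h2 h3 h4]]] := hN N (ltnW NN).
have N00 : (0 < N)%N by exact: leq_ltn_trans NN.
exists (fun t x => V t (N%:R * x 0 0)); split => //.
  by apply/funext => x; rewrite h2 /two_modes character_high.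
move=> t tT; apply: (@mean_two_modes R d _ (V t) _ (c t) N e) => // z.
  exact: h3.
exact: h4.
Qed.

Variable s : R.
Hypothesis s0 : s < 0.

(** The amplitude of the fast mode is fixed first, its frequency afterwards. *)
Lemma small_high_mode (a1 eta : R) : 0 < eta -> exists N0 : nat, forall N,
  (N0 <= N)%N -> sobolev_weight R (high d N) `^ s * normc a1%:C ^+ 2 <= eta ^+ 2.
Proof.
move=> eta0.
have q0 : 0 < 1 + normc a1%:C ^+ 2 by have := sqr_ge0 (normc a1%:C); lra.
have [N0 hN] := high_weight_small d s0 (divr_gt0 (exprn_gt0 2 eta0) q0).
exists N0 => N /hN; rewrite ler_pdivlMr//; apply: le_trans.
by rewrite ler_wpM2l ?powR_ge0//; lra.
Qed.

Lemma phase_diff (A B A' B' t : R) : 0 <= t ->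
  0 <= shift_poly sigma A' B' - shift_poly sigma A B ->
  `|- (lam * shift_poly sigma A B) * t - - (lam * shift_poly sigma A' B') * t| =
  (shift_poly sigma A' B' - shift_poly sigma A B) * t.
Proof.
move=> t0 h; have -> : - (lam * shift_poly sigma A B) * t - - (lam * shift_poly sigma A' B') * t =
  lam * ((shift_poly sigma A' B' - shift_poly sigma A B) * t) by ring.
by rewrite normrM lam1 mul1r ger0_norm// mulr_ge0.
Qed.

Lemma shift_poly0 (A : R) : shift_poly sigma A 0 = A ^+ sigma.
Proof.
case: sigma sigma0 => // n _; rewrite shift_poly_split mulr0 addr0 big_nat_cond big1 ?addr0//.
by move=> [|i] /andP[/andP[i2 _] _]//; rewrite expr0n mulr0.
Qed.

(** The amplitude of the fast mode depends on [delta] only, so that its frequency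
    can still be chosen; [K] is the resulting difference of rotation speeds. *)
Lemma half_turn (c delta : R) : 0 < c -> 0 < delta ->
  exists2 a1 : R, 0 < a1 & forall K, c * a1 ^+ 2 <= K ->
    [/\ 0 < K, 0 < pi / K & pi / K <= delta].
Proof.
move=> c0 d0; have p0 := pi_gt0 R.
have q0 : 0 < pi / (delta * c) by rewrite divr_gt0// mulr_gt0.
exists (Num.sqrt (pi / (delta * c))); first by rewrite sqrtr_gt0.
move=> K; rewrite sqr_sqrtr ?(ltW q0)//.
have -> : c * (pi / (delta * c)) = pi / delta.
  by field; rewrite !gt_eqF.
move=> hK; have K0 : 0 < K by apply: lt_le_trans hK; rewrite divr_gt0.
by split; rewrite ?divr_gt0// ler_pdivrMr// -ler_pdivrMl// mulrC.
Qed.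

Lemma antipodal_means (f g : 'rV[R]_d.+1 -> R[i]) (a b x y e : R) :
  0 <= a -> 0 <= b -> `|x - y| = pi ->
  has_mean f (a%:C * expi x) e -> has_mean g (b%:C * expi y) e ->
  P * (a + b - 4 * e) <= normc (torus_int f - torus_int g) /\
  torus_int (fun x => f x - g x) = torus_int f - torus_int g.
Proof.
move=> a0 b0 xy [fi hf] [gi hg].
by have := mean_gap fi gi hf hg; rewrite antiphase.
Qed.

(** Since the mean of the perturbed datum is unchanged, the two means start together
    and are opposite at time [pi / K]. *)
Lemma flat_unstable (a delta T eta : R) : 0 < a -> 0 < delta -> 0 < T -> 0 < eta ->
  exists (N : nat) (a1 t : R) (u : R -> 'rV[R]_d.+1 -> R[i]),
    [/\ (0 < N)%N, nls_solution sigma lam [set t | `|t| < T] u,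
        u 0 = two_modes a%:C a1%:C (high d N),
        sobolev_weight R (high d N) `^ s * normc a1%:C ^+ 2 <= eta ^+ 2 &
        0 <= t <= delta /\ (t < T ->
          P * a <= normc (torus_int (flatw a%:C t) - torus_int (u t)) /\
          torus_int (fun x => flatw a%:C t x - u t x) =
            torus_int (flatw a%:C t) - torus_int (u t))].
Proof.
move=> a0 d0 T0 eta0; set A := normc a%:C ^+ 2.
have A0 : 0 < A by rewrite exprn_gt0// normc_gt0 realC_eq0 gt_eqF.
have c0 : 0 < A ^+ sigma.-1 by rewrite exprn_gt0.
have [a1 a10 ha1] := half_turn c0 d0.
pose K := shift_poly sigma A (a1 ^+ 2) - shift_poly sigma A 0.
have hK : A ^+ sigma.-1 * a1 ^+ 2 <= K.
  rewrite /K shift_poly0 lerBrDl.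
  by apply: shift_poly_ge => //; [exact: ltW|exact: sqr_ge0].
have [K0 t0 tdelta] := ha1 K hK.
have e0 : 0 < a / 4 by rewrite divr_gt0.
have [N1 h1] := perturbed_solution a%:C a1 T0 e0.
have [N2 h2] := small_high_mode a1 eta0.
have [u [N0 u1 u2 u3]] := h1 _ (leq_addr N2 N1).
exists (N1 + N2)%N, a1, (pi / K), u; split => //; first exact: h2 (leq_addl _ _).
split; first by rewrite tdelta (ltW t0).
move=> tT.
have tT' : `|pi / K| < T by rewrite gtr0_norm.
have m1 := flat_mean a%:C (pi / K) (ltW e0).
have m2 := u3 _ tT'.
rewrite -[_ ^+ sigma]shift_poly0 in m1.
have pd := phase_diff (ltW t0) (ltW K0).
rewrite -/K (mulrC K) divfK ?gt_eqF// in pd.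
have [b1 b2] := antipodal_means (ltW a0) (ltW a0) pd m1 m2.
split => //; apply: le_trans b1.
by rewrite ler_wpM2l ?(le_trans ler01 P_ge1)//; lra.
Qed.

End Instability.

Section Conclusions.
Variables (R : realType) (d sigma : nat) (lam s : R).
Hypotheses (lam1 : `|lam| = 1) (sigma0 : (0 < sigma)%N) (s0 : s < 0).

Local Notation P := ((2 * pi) ^+ d.+1 : R).
Local Notation flatw := (@flat R d.+1 sigma lam).

Lemma le_P (x y : R) : 0 <= x -> P * x <= y -> x <= y.
Proof. by move=> x0; apply: le_trans; rewrite ler_peMl// P_ge1. Qed.

Lemma le_sup_mean (f : R -> R[i]) (c delta t : R) : 0 <= t <= delta ->
  c <= normc (f t) ->
  (c%:E <= ereal_sup [set (normc (f t))%:E | t in `[0%R, delta]])%E.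
Proof.
move=> td ct; apply: (@le_trans _ _ (normc (f t))%:E); first by rewrite lee_fin.
by apply: ereal_sup_ubound; exists t => //=; rewrite in_itv.
Qed.

Lemma sobolev_datum (a b : R[i]) (N : nat) (B : R) : (0 < N)%N -> 0 <= B ->
  normc a ^+ 2 + sobolev_weight R (high d N) `^ s * normc b ^+ 2 <= B ^+ 2 ->
  (sobolev_norm s (distribution_of (two_modes a b (high d N))) <= B%:E)%E.
Proof.
move=> N0 B0; apply: sobolev_two_modes => //; first exact: high_neq0.
by move=> k; exact: fourier_two_modes.
Qed.

Lemma sobolev_flat (a : R[i]) :
  (sobolev_norm s (distribution_of (flatw a 0)) <= (normc a)%:E)%E.
Proof.
have -> : flatw a 0 = two_modes a 0 (high d 1).
  by rewrite flat0; apply/funext => x; rewrite /two_modes mul0r addr0.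
apply: sobolev_datum => //; first exact: normc_ge0.
by rewrite ComplexField.Normc.normc0 expr0n mulr0 addr0.
Qed.

(** The reference solution is a plane wave, which exists for all times and does not
    depend on [delta]. *)
Lemma norm_inflation_flat (rho : R) : 0 < rho ->
  exists (J : set R) (u : R -> 'rV[R]_d.+1 -> R[i]),
    [/\ nls_solution sigma lam J u, `[0, +oo[ `<=` J,
        (sobolev_norm s (distribution_of (u 0%R)) < rho%:E)%E &
        forall delta : R, 0 < delta ->
          exists (J' : set R) (u' : R -> 'rV[R]_d.+1 -> R[i]),
            [/\ nls_solution sigma lam J' u', `[0, delta] `<=` J',
                (sobolev_norm s
                   (distribution_of (fun x => (u 0 x - u' 0 x)%R))
                   < delta%:E)%E &
                ((2^-1 * rho)%:E <=
                 ereal_sup [set (normc (torus_int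
                               (fun x => (u t x - u' t x)%R)))%:E
                           | t in `[0%R, delta]])%E]].
Proof.
move=> rho0; pose a := rho / 2; have a0 : 0 < a by rewrite divr_gt0.
exists setT, (flatw a%:C); split => //.
- exact: flat_solution.
- apply: le_lt_trans (sobolev_flat _) _.
  by rewrite normc_real gtr0_norm// lte_fin /a; lra.
move=> delta delta0.
have T0 : 0 < delta + 1 by lra.
have eta0 : 0 < delta / 2 by rewrite divr_gt0.
have [N [a1 [t [u [N0 u1 u2 u3 [td u4]]]]]] :=
  flat_unstable d lam1 sigma0 s0 a0 delta0 T0 eta0.
have tT : t < delta + 1 by case/andP: td; lra.
have [u5 u6] := u4 tT.
exists [set t | `|t| < delta + 1], u; split => //.
- move=> x /=; rewrite in_itv/= => /andP[x0 xd]; rewrite ger0_norm//; lra.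
- have -> : (fun x => flatw a%:C 0 x - u 0 x) = two_modes 0 (- a1%:C) (high d N).
    by apply/funext => x; rewrite flat0 u2 /two_modes; ring.
  apply: (@le_lt_trans _ _ (delta / 2)%:E); last by rewrite lte_fin; lra.
  apply: sobolev_datum => //; first exact: ltW.
  by rewrite ComplexField.Normc.normc0 expr0n add0r normcNE.
- apply: (le_sup_mean (f := fun t => torus_int (fun x => flatw a%:C t x - u t x)) td).
  rewrite u6; apply: le_P; first by rewrite mulr_ge0// ltW.
  by rewrite (le_trans _ u5)// [2^-1 * rho]mulrC.
Qed.

(** The zero Fourier coefficient is controlled by the norm of [H^k] whatever [k] is,
    and testing against the constant 1 identifies the two flows with the smooth
    solutions of [flat_unstable]. *)
Lemma flow_discontinuous (k T : R) (D : set (('rV[R]_d.+1 -> R[i]) -> R[i]))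
    (S : (('rV[R]_d.+1 -> R[i]) -> R[i]) -> R -> ('rV[R]_d.+1 -> R[i]) -> R[i]) :
  0 < T -> nls_solution_map sigma lam s k T D S ->
  ~ sobolev_continuous s k T D S.
Proof.
move=> T0 [_ _ HS] cont.
have [] := HS setT (flatw 1%:C) (flat_solution _ _ _ _) (fun _ _ => I).
set f := distribution_of _ => Df Sf.
have [eta eta0 heta] := cont f Df 1 ltr01.
have e0 : 0 < eta / 2 by rewrite divr_gt0.
have T1 : 0 < T + 1 by lra.
have [N [a1 [t [u [N0 u1 u2 u3 [td u4]]]]]] :=
  flat_unstable d lam1 sigma0 s0 ltr01 T0 T1 e0.
have tT : t < T + 1 by case/andP: td; lra.
have [u5 _] := u4 tT.
have sub : `[0, T] `<=` [set t | `|t| < T + 1].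
  by move=> x /=; rewrite in_itv/= => /andP[x0 xd]; rewrite ger0_norm//; lra.
have [] := HS _ u u1 sub; set g := distribution_of _ => Dg Sg.
have fg : (sobolev_norm s (fun psi => (f psi - g psi)%R) < eta%:E)%E.
  apply: (@le_lt_trans _ _ (eta / 2)%:E); last by rewrite lte_fin; lra.
  apply: (@sobolev_two_modes _ _ _ _ 0 (- a1%:C) (high d N)).
  - exact: high_neq0.
  - exact: ltW.
  - move=> q; rewrite /fourier_coef mulrBr -!/(fourier_coef _ q).
    have -> : f = distribution_of (two_modes 1%:C 0 (high d N)).
      congr distribution_of; rewrite flat0; apply/funext => x.
      by rewrite /two_modes mul0r addr0.
    have -> : g = distribution_of (two_modes 1%:C a1%:C (high d N)).
      by rewrite /g u2.
    by rewrite !fourier_two_modes; ring.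
  - by rewrite ComplexField.Normc.normc0 expr0n add0r normcNE.
have := heta g Dg fg t td => /fourier0_le_sobolev.
have one : (fun x : 'rV[R]_d.+1 => expi (- \sum_(j < d.+1) ((0 : 'rV[int]_d.+1) 0 j)%:~R * x 0 j))
    = (fun=> 1).
  by apply/funext => x; rewrite character_opp oppr0 character0.
have t1 := @test_function_one R d.+1.
rewrite /fourier_coef one Sf// Sg// /distribution_of.
have mul1 (h : 'rV[R]_d.+1 -> R[i]) : (fun x => h x * 1) = h.
  by apply/funext => x; rewrite mulr1.
rewrite !mul1 normcEM normc_real ger0_norm ?invr_ge0 ?exprn_ge0 ?two_pi_ge0//.
have P0 : 0 < P by rewrite (lt_le_trans ltr01 (P_ge1 R d)).
rewrite mulrC ltr_pdivrMr// mul1r ltNge.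
by move: u5; rewrite mulr1 => ->.
Qed.

(** The two data have the same fast mode and means [a < b] of order [rho]; their
    difference is a constant, and it is the amplitude of the fast mode that makes
    the rotation speeds of the means very different. *)
Lemma norm_inflation_smooth : (1 < sigma)%N -> forall rho delta : R, 0 < rho -> 0 < delta ->
  exists (J J' : set R) (u u' : R -> 'rV[R]_d.+1 -> R[i]),
    [/\ nls_solution sigma lam J u /\ `[0, delta] `<=` J,
        nls_solution sigma lam J' u' /\ `[0, delta] `<=` J',
        exists2 a : R[i], normc a <= delta & forall x, u 0 x - u' 0 x = a,
        (sobolev_norm s (distribution_of (u 0%R)) +
         sobolev_norm s (distribution_of (u' 0%R)) <= rho%:E)%E &
        ((8^-1 * rho)%:E <=
         ereal_sup [set (normc (torus_int
                       (fun x => (u t x - u' t x)%R)))%:E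
                   | t in `[0%R, delta]])%E].
Proof.
move=> sigma1 rho delta rho0 delta0.
(* The means [a] and [b = a + h]: their difference [h] is at most [delta], and
   [b <= 2 a] leaves half of the norm [rho / 2] to the fast mode. *)
pose a := rho / 8; pose h := Num.min delta a; pose b := a + h.
have a0 : 0 < a by rewrite divr_gt0.
have h0 : 0 < h by rewrite lt_min delta0.
have ha : h <= a by rewrite ge_min lexx orbT.
have hd : h <= delta by rewrite ge_min lexx.
have b0 : 0 < b by rewrite /b; lra.
pose A := normc a%:C ^+ 2; pose B := normc b%:C ^+ 2.
have AE : A = a ^+ 2 by rewrite /A normc_real gtr0_norm.
have BE : B = b ^+ 2 by rewrite /B normc_real gtr0_norm.
have A0 : 0 <= A by exact: sqr_ge0.
have AB : A < B by rewrite AE BE ltrXn2r ?ltW//; rewrite /b; lra.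
pose c := B ^+ sigma.-1 - A ^+ sigma.-1.
have c0 : 0 < c.
  rewrite subr_gt0 ltrXn2r// ?(ltW AB)//.
  by rewrite -lt0n -ltnS prednK// ltnW.
have [a1 a10 ha1] := half_turn c0 delta0.
pose K := shift_poly sigma B (a1 ^+ 2) - shift_poly sigma A (a1 ^+ 2).
have hK : c * a1 ^+ 2 <= K.
  by apply: shift_poly_increase => //; [exact: ltW|exact: sqr_ge0].
have [K0 t0 tdelta] := ha1 K hK; set t := pi / K in t0 tdelta.
have T0 : 0 < delta + 1 by lra.
have e0 : 0 < rho / 32 by rewrite divr_gt0.
have r0 : 0 < rho / 4 by rewrite divr_gt0.
have [N1 h1] := perturbed_solution d sigma lam1 a%:C a1 T0 e0.
have [N2 h2] := perturbed_solution d sigma lam1 b%:C a1 T0 e0.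
have [N3 h3] := small_high_mode d s0 a1 r0.
have [k1 k2 k3 _] := leq_add4 (leqnn (N1 + N2 + N3 + 0)%N).
set N := (N1 + N2 + N3 + 0)%N in k1 k2 k3.
have [u [N0 u1 u2 u3]] := h1 N k1.
have [v [_ v1 v2 v3]] := h2 N k2.
have w := h3 N k3.
have sub : `[0, delta] `<=` [set t | `|t| < delta + 1].
  by move=> x /=; rewrite in_itv/= => /andP[x0 xd]; rewrite ger0_norm//; lra.
exists [set t | `|t| < delta + 1], [set t | `|t| < delta + 1], u, v; split => //.
- exists (- h%:C); first by rewrite normcNE normc_real gtr0_norm.
  by move=> x; rewrite u2 v2 /two_modes /b realCD; ring.
- have half (r : R) : 0 < r -> r <= rho / 4 ->
      (sobolev_norm s (distribution_of (two_modes r%:C a1%:C (high d N))) <= (rho / 2)%:E)%E.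
    move=> r1 r2; apply: sobolev_datum => //; first by rewrite divr_ge0// ltW.
    rewrite normc_real gtr0_norm//.
    have : r ^+ 2 <= (rho / 4) ^+ 2 by rewrite lerXn2r ?nnegrE// ltW.
    have : (rho / 2) ^+ 2 = 4 * (rho / 4) ^+ 2 by field.
    have := sqr_ge0 (rho / 4); lra.
  rewrite u2 v2 [rho in leRHS](_ : rho = rho / 2 + rho / 2); last by field.
  rewrite EFinD leeD// half//; rewrite /b; move: ha; rewrite /a; lra.
- have td : 0 <= t <= delta by rewrite tdelta ltW.
  have tT : `|t| < delta + 1 by rewrite gtr0_norm//; lra.
  have pd := phase_diff lam1 (ltW t0) (ltW K0).
  rewrite -/K (mulrC K) divfK ?gt_eqF// in pd.
  have [g1 g2] := antipodal_means (ltW a0) (ltW b0) pd (u3 _ tT) (v3 _ tT).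
  apply: (le_sup_mean (f := fun t => torus_int (fun x => u t x - v t x)) td).
  rewrite g2; apply: le_P; first by rewrite mulr_ge0// ltW.
  apply: le_trans g1; rewrite ler_wpM2l ?(le_trans ler01 (P_ge1 R d))//.
  by rewrite /b /a; move: h0; lra.
Qed.

(** The time is given here, and the amplitude of the fast mode is chosen small
    enough for the phase difference to lie strictly between 0 and [pi]. *)
Lemma weak_discontinuous (t : R) (a : R[i]) (D : set ('rV[R]_d.+1 -> R[i]))
    (Phi : ('rV[R]_d.+1 -> R[i]) -> ('rV[R]_d.+1 -> R[i]) -> R[i]) :
  t != 0 -> a != 0 -> nls_flow_at sigma lam t D Phi ->
  ~ weakly_continuous_at D Phi (fun=> a).
Proof.
move=> tN0 aN0 [_ _ HPhi] cont.
have t0 : 0 < `|t| by rewrite normr_gt0.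
pose A := normc a ^+ 2; have A0 : 0 < A by rewrite exprn_gt0// normc_gt0.
have [C C0 hC] := shift_poly_le sigma0 (ltW A0).
(* This choice makes [C B |t|], which bounds the phase difference, at most 1. *)
pose B := Num.min 1 (1 / (`|t| * (C + 1))).
have q0 : 0 < `|t| * (C + 1) by rewrite mulr_gt0//; lra.
have B0 : 0 < B by rewrite lt_min ltr01 divr_gt0.
have B1 : B <= 1 by rewrite ge_min lexx.
have Bq : B * (`|t| * (C + 1)) <= 1 by rewrite -ler_pdivlMr// ge_min lexx orbT.
pose a1 := Num.sqrt B; have a1E : a1 ^+ 2 = B by rewrite sqr_sqrtr// ltW.
pose K := shift_poly sigma A B - shift_poly sigma A 0.
have K0 : 0 < K.
  have := shift_poly_ge sigma0 (ltW A0) (ltW B0).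
  have : 0 < A ^+ sigma.-1 * B by rewrite mulr_gt0// exprn_gt0.
  by rewrite /K shift_poly0//; lra.
have KC : K <= C * B by have := hC B (ltW B0) B1; rewrite /K shift_poly0//; lra.
pose x := - (lam * shift_poly sigma A 0) * t; pose y := - (lam * shift_poly sigma A B) * t.
have xy : `|x - y| = K * `|t|.
  have -> : x - y = lam * (K * t) by rewrite /x /y /K; ring.
  by rewrite normrM lam1 mul1r normrM (gtr0_norm K0).
have gap0 : 0 < normc (a * expi x - a * expi y).
  apply: phase_gap => //; rewrite xy ?mulr_gt0//.
  have := @pi_ge2 R; have : K * `|t| <= C * B * `|t| by rewrite ler_wpM2r.
  have : 0 < B * `|t| by rewrite mulr_gt0.
  by lra.
set gap := normc _ in gap0.
have e0 : 0 < gap / 8 by rewrite divr_gt0.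
have P0 : 0 < P by rewrite (lt_le_trans ltr01 (P_ge1 R d)).
have t1 := @test_function_one R d.+1.
have [||n [g [eta [Lg eta0 heta]]]] := cont (fun=> 1) _ (P * gap / 2) _ => //.
  by rewrite divr_gt0// mulr_gt0.
have T0 : 0 < `|t| + 1 by lra.
have [N1 h1] := perturbed_solution d sigma lam1 a a1 T0 e0.
have weak i := character_weak_cvg0 a1%:C (Lg i) eta0.
pose N := (N1 + \sum_(i < n) sval (cid (weak i)))%N.
have [u [N0 u1 u2 u3]] := h1 N (leq_addr _ _).
have tT : `|t| < `|t| + 1 by lra.
have [Du Pu] := HPhi _ u u1 tT.
have [Df Pf] := HPhi setT (flatw a) (flat_solution _ _ _ _) I.
have close i : normc (L2_inner (fun x => u 0 x - a) (g i)) < eta.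
  have -> : (fun x => u 0 x - a) = (fun x => a1%:C * character (high d N) x).
    by apply/funext => z; rewrite u2 /two_modes addrC addKr.
  apply: (svalP (cid (weak i))).
  by rewrite /N (bigD1 i)//= addnCA leq_addr.
have := heta (u 0) Du close.
rewrite -(@flat0 R d.+1 sigma lam a) Pu// Pf// /distribution_of.
have mul1 (h : 'rV[R]_d.+1 -> R[i]) : (fun x => h x * 1) = h.
  by apply/funext => z; rewrite mulr1.
rewrite !mul1 normcBC.
have [m1i m1] := flat_mean d sigma lam a t (ltW e0).
have [m2i m2] := u3 t tT.
rewrite -[_ ^+ sigma]shift_poly0// in m1; rewrite a1E in m2.
have [b1 _] := mean_gap m1i m2i m1 m2.
have gE : normc (a * expi x - a * expi y) = gap by [].
rewrite gE in b1; move: b1.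
have : P * (gap - 4 * (gap / 8)) = P * gap / 2 by field.
by move=> ->; rewrite ltNge => ->.
Qed.

End Conclusions.

Theorem theorem1p2 (R : realType) (d sigma : nat) (lam s : R)
    (hd : (1 <= d)%N) (hsigma : (1 <= sigma)%N)
    (hlam : lam = 1 \/ lam = -1) (hs : s < 0) :
  ((exists2 c : R, 0 < c & forall rho : R, 0 < rho ->
     exists (J : set R) (u : R -> 'rV[R]_d -> R[i]),
       [/\ nls_solution sigma lam J u, `[0, +oo[ `<=` J,
           (sobolev_norm s (distribution_of (u 0%R)) < rho%:E)%E &
           forall delta : R, 0 < delta ->
             exists (J' : set R) (u' : R -> 'rV[R]_d -> R[i]),
               [/\ nls_solution sigma lam J' u', `[0, delta] `<=` J',
                   (sobolev_norm s
                      (distribution_of (fun x => (u 0 x - u' 0 x)%R))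
                      < delta%:E)%E &
                   ((c * rho)%:E <=
                    ereal_sup [set (normc (torus_int
                                  (fun x => (u t x - u' t x)%R)))%:E
                              | t in `[0%R, delta]])%E]])
   /\
   (forall k T : R, 0 < T ->
      forall (D : set (('rV[R]_d -> R[i]) -> R[i]))
             (S : (('rV[R]_d -> R[i]) -> R[i]) ->
                  R -> ('rV[R]_d -> R[i]) -> R[i]),
        nls_solution_map sigma lam s k T D S ->
        ~ sobolev_continuous s k T D S))
  /\
  ((2 <= sigma)%N ->
   exists2 c : R, 0 < c & forall rho delta : R, 0 < rho -> 0 < delta ->
     exists (J J' : set R) (u u' : R -> 'rV[R]_d -> R[i]),
       [/\ nls_solution sigma lam J u /\ `[0, delta] `<=` J,
           nls_solution sigma lam J' u' /\ `[0, delta] `<=` J',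
           exists2 a : R[i], normc a <= delta &
             forall x, u 0 x - u' 0 x = a,
           (sobolev_norm s (distribution_of (u 0%R)) +
            sobolev_norm s (distribution_of (u' 0%R)) <= rho%:E)%E &
           ((c * rho)%:E <=
            ereal_sup [set (normc (torus_int
                          (fun x => (u t x - u' t x)%R)))%:E
                      | t in `[0%R, delta]])%E])
  /\
  (forall t : R, t != 0 -> forall alpha0 : R[i], alpha0 != 0 ->
     forall (D : set ('rV[R]_d -> R[i]))
            (Phi : ('rV[R]_d -> R[i]) -> ('rV[R]_d -> R[i]) -> R[i]),
       nls_flow_at sigma lam t D Phi ->
       ~ weakly_continuous_at D Phi (fun=> alpha0)).
Proof.
have lam1 : `|lam| = 1 by case: hlam => ->; rewrite ?normrN normr1.
case: d hd => // d _; split; [split|split].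
- exists 2^-1; first by rewrite invr_gt0.
  by move=> rho rho0; exact: norm_inflation_flat.
- by move=> k T T0 D S; exact: flow_discontinuous.
- move=> sigma2; exists 8^-1; first by rewrite invr_gt0.
  by move=> rho delta rho0 delta0; exact: norm_inflation_smooth.
- by move=> t t0 a a0 D Phi; exact: weak_discontinuous.
Qed.
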